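(* Let $G$ be a connected Lie group and let $K$ be a sub-Gaussian density on $G$ which is centered, with $Tf=K*f$. Given any $p\in(1,\infty)$, there exist positive constants $c=c(p)$, $b=b(p)$ depending on $p$ such that $$\|\chi_E T^n\chi_F\|_{p\to p}\le c\,e^{-b\,d(E,F)^2/n}$$ for all $n\in\mathbb{N}$ and all non-empty Borel measurable sets $E,F\subseteq G$.
   Context: $\mathbb{N}=\{1,2,3,\dots\}$; $dg$ is a left Haar measure on $G$; $L^p=L^p(G;dg)$ (complex-valued); $\|\cdot\|_{p\to q}$ is the norm of bounded operators $L^p\to L^q$. Convolution: $(f_1*f_2)(g)=\int_G dh\,f_1(h)f_2(h^{-1}g)$. A probability density on $G$ is a Borel measurable $K:G\to[0,\infty)$ with $\int_G dg\,K(g)=1$. Distance: fix a relatively compact, open, symmetric ($U=U^{-1}$) neighborhood $U$ of the identity $e$ (which generates $G$), and set $\rho(g)=\inf\{n\in\mathbb{N}: g\in U^n\}$, where $U^n=\{g_1\cdots g_n: g_i\in U\}$. For subsets $E,F$ of $G$, $d(E,F)=\inf\{\rho(gh^{-1}):g\in E,h\in F\}$. $\chi_E$ denotes the characteristic function of $E$, and also the operator of pointwise multiplication by it. Sub-Gaussian density: a probability density $K$ such that $\inf\{K(g):g\in W\}>0$ for some neighborhood $W$ of $e$, and $K(g)\le c\,e^{-b\rho(g)^2}$ for some constants $c,b>0$ and all $g\in G$. Centered: let $G_0=\overline{[G,G]}$ be the closure of the commutator subgroup, $\pi_0:G\to G/G_0$ the canonical homomorphism. $G/G_0$ is a connected abelian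 Lie group, so $G/G_0\cong\mathbb{R}^q\times\mathbb{T}^r$ for some integers $q,r\ge0$, $\mathbb{T}=\mathbb{R}/\mathbb{Z}$. Put $G_1=\pi_0^{-1}(\{0\}\times\mathbb{T}^r)$, and let $\pi_1:G\to G/G_1\cong\mathbb{R}^q$ have components $\pi_1^{(i)}:G\to\mathbb{R}$. $K$ is centered if $\int_G dg\,K(g)\pi_1^{(i)}(g)=0$ for all $i\in\{1,\dots,q\}$. *)

(* Defs.v *)
From HB Require Import structures.
From mathcomp Require Import all_boot all_order all_algebra.
From mathcomp Require Import generic_quotient ring_quotient.
From mathcomp Require Import all_classical all_reals all_analysis.
From mathcomp.real_closed Require Import complex.

Set Implicit Arguments.
Unset Strict Implicit.
Unset Printing Implicit Defensive.

Import Order.TTheory GRing.Theory Num.Theory.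
Import numFieldNormedType.Exports.

Local Open Scope classical_set_scope.
Local Open Scope ring_scope.

(* The real numbers are an arbitrary [R : realType]. *)

Section Smooth.
Context {R : realType} {V W : normedModType R}.

(* For V of finite dimension and O open, [Ck k O f] is the usual class C^k:
   continuity of all the first directional derivatives gives C^1. *)
Fixpoint Ck (k : nat) (O : set V) (f : V -> W) : Prop :=
  if k is k'.+1 then
    forall v : V, (forall x, O x -> derivable f x v) /\ Ck k' O ('D_v f)
  else forall x, O x -> {for x, continuous f}.

Definition smooth_on (O : set V) (f : V -> W) : Prop := forall k, Ck k O f.

End Smooth.

(* A chart is a homeomorphism between open subsets of M and R^d; the values of
   [chart_map] and [chart_inv] outside these subsets are irrelevant. *)
Record chart (R : realType) (d : nat) (M : topologicalType) := Chart {
  chart_dom : set M;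
  chart_map : M -> 'rV[R]_d;
  chart_inv : 'rV[R]_d -> M;
  chart_img : set 'rV[R]_d := chart_map @` chart_dom;
  chart_dom_open : open chart_dom;
  chart_img_open : open chart_img;
  chart_mapK : forall x, chart_dom x -> chart_inv (chart_map x) = x;
  chart_map_continuous :
    forall x, chart_dom x -> {for x, continuous chart_map};
  chart_inv_continuous :
    forall y, chart_img y -> {for y, continuous chart_inv}
}.

HB.mixin Record isTopologicalGroup G of PointedTopological G & Group G := {
  mulg_continuous : continuous (fun x : G * G => (x.1 * x.2)%g);
  invg_continuous : continuous (fun x : G => (x^-1)%g)
}.

(* [Pointed] is only there because measurable types are pointed; the
   distinguished point plays no role. *)
#[short(type="topologicalGroupType")]
HB.structure Definition TopologicalGroup :=
  {G of isTopologicalGroup G & PointedTopological G & Group G}.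

HB.mixin Record isLieGroup (R : realType) G of TopologicalGroup G := {
  lie_hausdorff : hausdorff_space G;
  lie_second_countable : @second_countable G;
  lie_dim : nat;
  lie_atlas : set (chart R lie_dim G);
  lie_atlas_cover : forall x : G, exists2 c, lie_atlas c & chart_dom c x;
  lie_atlas_smooth : forall c c', lie_atlas c -> lie_atlas c' ->
    smooth_on [set x | chart_img c x /\ chart_dom c' (chart_inv c x)]
      (fun x => chart_map c' (chart_inv c x));
  lie_mul_smooth : forall c1 c2 c3,
    lie_atlas c1 -> lie_atlas c2 -> lie_atlas c3 ->
    smooth_on
      [set z : 'rV[R]_lie_dim * 'rV[R]_lie_dim |
        [/\ chart_img c1 z.1, chart_img c2 z.2 &
            chart_dom c3 (chart_inv c1 z.1 * chart_inv c2 z.2)%g]]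
      (fun z => chart_map c3 (chart_inv c1 z.1 * chart_inv c2 z.2)%g);
  lie_inv_smooth : forall c c', lie_atlas c -> lie_atlas c' ->
    smooth_on [set x | chart_img c x /\ chart_dom c' (chart_inv c x)^-1%g]
      (fun x => chart_map c' (chart_inv c x)^-1%g)
}.

#[short(type="lieGroupType")]
HB.structure Definition LieGroup (R : realType) :=
  {G of isLieGroup R G & TopologicalGroup G}.

Notation borel G := (g_sigma_algebraType (@open G)).

(* On a second countable locally compact group, a Borel measure which is finite
   on compact sets is automatically regular. *)
Definition left_haar (R : realType) (G : topologicalGroupType)
    (mu : {measure set (borel G) -> \bar R}) : Prop :=
  [/\ forall (g : G) (A : set (borel G)), measurable A ->
        mu [set (g * x)%g | x in A] = mu A,
      forall A : set G, compact A -> (mu A < +oo)%E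
    & mu setT != 0%E].

Section Lp.
Context {d : measure_display} {T : measurableType d} {R : realType}.
Variable mu : {measure set T -> \bar R}.
Local Open Scope complex_scope.

Definition cintegral (f : T -> R[i]) : R[i] :=
  Rintegral mu setT (fun x => complex.Re (f x)) +i*
  Rintegral mu setT (fun x => complex.Im (f x)).

Definition cLnorm (p : R) (f : T -> R[i]) : \bar R :=
  Lnorm mu p%:E (fun x => (ComplexField.Normc.normc (f x))%:E).

Definition cLp (p : R) (f : T -> R[i]) : Prop :=
  [/\ measurable_fun setT (fun x => complex.Re (f x)),
      measurable_fun setT (fun x => complex.Im (f x)) & (cLnorm p f < +oo)%E].

(* The norm of A as an operator L^p -> L^q, equal to +oo when A does not map
   L^p boundedly into L^q. *)
Definition opnorm (p q : R) (A : (T -> R[i]) -> (T -> R[i])) : \bar R :=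
  ereal_inf [set C%:E | C in [set C : R | 0 <= C /\
    forall f, cLp p f ->
      cLp q (A f) /\ (cLnorm q (A f) <= C%:E * cLnorm p f)%E]].

Definition chi (E : set T) (f : T -> R[i]) : T -> R[i] :=
  fun x => \1_E x * f x.

End Lp.

Definition convolution (R : realType) (G : topologicalGroupType)
    (mu : {measure set (borel G) -> \bar R}) (f1 f2 : G -> R[i]) : G -> R[i] :=
  fun g => cintegral mu (fun h : G => f1 h * f2 (h^-1 * g)%g).

Section Distance.
Context {R : realType} {G : topologicalGroupType}.
Implicit Types U E F : set G.

Fixpoint setpow U (n : nat) : set G :=
  if n is n'.+1 then [set (x * y)%g | x in setpow U n' & y in U]
  else [set 1%g].

Definition generating_nbhs U : Prop :=
  [/\ open U, compact (closure U), U 1%g, [set (x^-1)%g | x in U] = U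
    & forall g, exists n, setpow U n g].

Definition rho U (g : G) : R :=
  inf [set n%:R | n in [set n : nat | (0 < n)%N /\ setpow U n g]].

Definition set_dist U E F : R :=
  inf [set rho U (g / h)%g | g in E & h in F].

End Distance.

Section Density.
Context {R : realType} {G : topologicalGroupType}.
Variable mu : {measure set (borel G) -> \bar R}.

Definition probability_density (K : G -> R) : Prop :=
  [/\ measurable_fun setT (K : borel G -> R), forall g, 0 <= K g
    & (\int[mu]_g (K g)%:E = 1)%E].

Definition sub_gaussian (U : set G) (K : G -> R) : Prop :=
  [/\ probability_density K,
      exists2 W : set G, nbhs 1%g W & 0 < inf [set K g | g in W]
    & exists c b : R, [/\ 0 < c, 0 < b
        & forall g, K g <= c * expR (- b * rho U g ^+ 2)]].

End Density.

Section Abelianization.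
Context {G : topologicalGroupType}.

Definition is_subgroup (H : set G) : Prop :=
  H 1%g /\ forall x y, H x -> H y -> H (x / y)%g.

Definition commutator_subgroup : set G :=
  smallest is_subgroup [set z | exists x y : G, z = [~ x, y]%g].

Definition G0 : set G := closure commutator_subgroup.

Lemma is_subgroup_commutator : is_subgroup commutator_subgroup.
Proof.
split=> [H [[H1 _] _]//|x y Hx Hy H [sH cH]].
by apply: sH.2; [apply: Hx|apply: Hy].
Qed.

Lemma is_subgroup_G0 : is_subgroup G0.
Proof.
have [s1 sB] := is_subgroup_commutator.
split=> [|x y Gx Gy B]; first exact: subset_closure.
have cB : continuous (fun z : G * G => (z.1 / z.2)%g).
  move=> z; apply: (@cvg_comp _ _ _ (fun z : G * G => (z.1, z.2^-1%g))
    (fun z : G * G => (z.1 * z.2)%g) _ (nbhs (z.1, z.2^-1%g))).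
    apply: cvg_pair; first exact: cvg_fst.
    by apply: cvg_comp; [exact: cvg_snd|exact: invg_continuous].
  exact: (mulg_continuous (z.1, z.2^-1%g)).
move=> /(cB (x, y)) [[A1 A2] /= [nA1 nA2] sA].
have [a [sa Aa]] := Gx _ nA1; have [b [sb Ab]] := Gy _ nA2.
by exists (a / b)%g; split; [exact: sB|exact: (sA (a, b))].
Qed.

Definition coset_rel (x y : G) : bool := `[< G0 (x^-1 * y)%g >].

Lemma coset_rel_equiv : equiv_class_of coset_rel.
Proof.
have [s1 sB] := is_subgroup_G0.
have sV x : G0 x -> G0 (x^-1)%g by move=> /(sB _ _ s1); rewrite mul1g.
have sym x y : coset_rel x y -> coset_rel y x.
  by move=> /asboolP /sV h; apply/asboolP; rewrite invgM invgK in h.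
split=> [x|x y|y x z].
- by apply/asboolP; rewrite mulVg.
- by apply/idP/idP; exact: sym.
- move=> /asboolP h1 /asboolP/sV h2; apply/asboolP.
  by have := sB _ _ h1 h2; rewrite invgK -mulgA mulVKg.
Qed.

Canonical coset_equiv := EquivRelPack coset_rel_equiv.
Canonical coset_encModRel := defaultEncModRel coset_rel.

(* G / G_0 with its quotient topology. *)
Definition abelianization : Type := quotient_topology {eq_quot coset_rel}%qT.

HB.instance Definition _ := Topological.on abelianization.

Definition pi0 (x : G) : abelianization := (\pi_({eq_quot coset_rel}) x)%qT.

End Abelianization.
Arguments abelianization G : clear implicits.

Definition integers (R : realType) : zmodClosed R :=
  GRing.ZmodClosed.clone R (@Num.int_num_subdef R) _.

Definition circle (R : realType) : Type :=
  quotient_topology (Quotient.quot (integers R)).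

HB.instance Definition _ (R : realType) := Topological.on (circle R).
HB.instance Definition _ (R : realType) := GRing.Zmodule.copy (circle R)
  (Quotient.quot (integers R)).

(* An isomorphism of topological groups G / G_0 ~ R^q x T^r. The group law of
   G / G_0 is determined by its values on the classes [pi0 x]. *)
Record abelianization_iso (R : realType) (G : topologicalGroupType)
    (q r : nat) := AbelianizationIso {
  abiso : abelianization G -> 'rV[R]_q * 'rV[circle R]_r;
  abiso_inv : 'rV[R]_q * 'rV[circle R]_r -> abelianization G;
  abisoK : cancel abiso abiso_inv;
  abiso_invK : cancel abiso_inv abiso;
  abisoM : forall x y : G,
    abiso (pi0 (x * y)%g) = abiso (pi0 x) + abiso (pi0 y);
  abiso_continuous : continuous abiso;
  abiso_inv_continuous : continuous abiso_inv
}.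

(* Under the isomorphism, G / G_1 is the first factor R^q. *)
Definition pi1 (R : realType) (G : topologicalGroupType) (q r : nat)
    (phi : abelianization_iso R G q r) (g : G) : 'rV[R]_q :=
  (abiso phi (pi0 g)).1.

Definition centered (R : realType) (G : topologicalGroupType)
    (mu : {measure set (borel G) -> \bar R}) (q r : nat)
    (phi : abelianization_iso R G q r) (K : G -> R) : Prop :=
  forall i : 'I_q, (\int[mu]_g (K g * pi1 phi g ord0 i)%:E = 0)%E.

(* Main.v *)
(* Davies' method in L^2. The core is the inequality
     int e^(2 eta) (T u)^2 <= e^(w l^2) int e^(2 eta) u^2    (u >= 0)
   for bounded eta with |eta (h x) - eta x| <= l rho h, where w depends only on
   K. Put f = e^eta u and expand (T u)^2 as a double integral against
   K(h) K(k). Polarising each product f(h^-1 x) f(k^-1 x) gives, besides terms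
   of order l^2, first order terms expressed through
     A(h) = int (eta (h x) - eta x) f(x)^2 dx
   and a negative multiple of the squared displacement of f by h^-1 k. The
   function A is a homomorphism up to an error controlled by displacements of
   f. Such a quasi-homomorphism is close to a continuous homomorphism
   v : G -> R; as K is centered, int K v = 0, and the error is absorbed by the
   negative displacement terms, which are coercive since K is bounded below
   near 1 and G is connected.
   Iterating n times with eta = l min (d(., F), d(E, F)) and l of order
   d(E, F) / n gives the theorem for p = 2, and interpolation with the
   contractivity of T on L^1 and L^oo gives it for 1 < p < oo. *)
Require Import Defs.
From HB Require Import structures.
From mathcomp Require Import all_boot all_order all_algebra.
From mathcomp Require Import generic_quotient ring_quotient.
From mathcomp Require Import all_classical all_reals all_analysis.
From mathcomp Require Import finmap measurable_realfun ring lra.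
From mathcomp.real_closed Require Import complex.

Import Order.TTheory GRing.Theory Num.Theory.
Import numFieldNormedType.Exports.

Local Open Scope classical_set_scope.
Local Open Scope ring_scope.

Set Implicit Arguments.
Unset Strict Implicit.
Unset Printing Implicit Defensive.

(** * Word length *)

(** The obstacle is the first order in [l]: one application of T may cost only [1 + O(l^2)], while
    the Lipschitz bound on [eta] alone gives [1 + O(l)]. Integrated against [f^2], the first order
    term becomes A, and by left invariance A(g h) - A(g) - A(h) = int (eta (g x) - eta x) (f(h^-1
    x)^2 - f(x)^2) dx. With N = int f^2 and a free weight e > 0, this is at most a multiple of e
    times the displacement of f plus [l^2 N / e]. The weight e is fixed once and for all, small
    against the coercivity constant, which comes from the lower bound of K on a neighbourhood W x W;
    the displacement part is then absorbed and only [l^2 N] is left. Closeness to a character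
    follows from compactness, with a constant that is not explicit. All errors grow exponentially in
    word length, because a bound is lost with every letter; the Gaussian decay of K makes the
    corresponding moments finite. The analysis is carried out for functions with values in [0, +oo],
    where Tonelli needs no integrability. *)

Section WordLength.
Context {G : topologicalGroupType}.
Implicit Types (U O : set G) (g h : G).

Lemma continuous_mul2 (T : topologicalType) (f g : T -> G) :
  continuous f -> continuous g -> continuous (fun x => (f x * g x)%g).
Proof.
move=> cf cg x; apply: (@cvg_comp _ _ _ (fun x => (f x, g x))
  (fun z : G * G => (z.1 * z.2)%g) _ (nbhs (f x, g x))).
  by apply: cvg_pair; [exact: cf|exact: cg].
exact: (mulg_continuous (f x, g x)).
Qed.

Lemma continuous_mull g : continuous (fun x => (g * x)%g).
Proof.
by apply: (@continuous_mul2 _ (fun=> g) id) => x; [exact: cvg_cst|exact: cvg_id].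
Qed.

Lemma continuous_expg n : continuous (fun x : G => (x ^+ n)%g).
Proof.
elim: n => [|n ih]; first by move=> x; exact: cvg_cst.
rewrite (_ : (fun x => _) = (fun x : G => (x ^+ n * x)%g)); last first.
  by apply/funext => x; rewrite expgSr.
by apply: (@continuous_mul2 _ (fun x : G => (x ^+ n)%g) id) => // x; exact: cvg_id.
Qed.

Lemma mull_image g (A : set G) :
  [set (g * x)%g | x in A] = (fun x => (g^-1 * x)%g) @^-1` A.
Proof.
apply/seteqP; split=> [_ [x Ax <-]|x Ax] /=; first by rewrite mulKg.
by exists (g^-1 * x)%g => //; rewrite mulVKg.
Qed.

Lemma open_mull g O : open O -> open [set (g * x)%g | x in O].
Proof.
by move=> oO; rewrite mull_image; apply: open_comp => // x _; exact: continuous_mull.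
Qed.

Section U.
Variable U : set G.
Hypothesis gU : generating_nbhs U.

Lemma gen_open : open U. Proof. by case: gU. Qed.
Lemma gen1 : U 1%g. Proof. by case: gU. Qed.
Lemma gen_gen g : exists n, setpow U n g. Proof. by case: gU. Qed.
Lemma gen_compact : compact (closure U). Proof. by case: gU. Qed.
Lemma genV x : U x -> U x^-1%g.
Proof. by case: gU => _ _ _ e _ Ux; rewrite -e; exists x. Qed.
Lemma gen_nbhs : nbhs 1%g U.
Proof. exact: (open_nbhs_nbhs (conj gen_open gen1)). Qed.

Lemma setpow_leq m n : (m <= n)%N -> setpow U m `<=` setpow U n.
Proof.
move=> /subnK <-; elim: (n - m)%N => //= k ih x /ih Hx.
by exists x => //; exists 1%g; [exact: gen1|rewrite mulg1].
Qed.

Lemma setpowD m n x y :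
  setpow U m x -> setpow U n y -> setpow U (m + n) (x * y)%g.
Proof.
move=> Hx; elim: n y => [|n ih] y; first by move=> ->; rewrite addn0 mulg1.
move=> [z Hz [u Uu <-]]; rewrite addnS; exists (x * z)%g; first exact: ih.
by exists u => //; rewrite mulgA.
Qed.

Lemma setpowV n x : setpow U n x -> setpow U n x^-1%g.
Proof.
elim: n x => [x ->|n ih x [y Hy [u Uu <-]]]; first by rewrite /= invg1.
rewrite invgM -[n.+1]add1n; apply: setpowD; last exact: ih.
by exists 1%g => //; exists u^-1%g; [exact: genV|rewrite mul1g].
Qed.

Lemma setpow1 u : U u -> setpow U 1 u.
Proof. by move=> Uu; exists 1%g => //; exists u => //; rewrite mul1g. Qed.

Lemma open_setpow n : open (setpow U n.+1).
Proof.
rewrite (_ : setpow U n.+1 = \bigcup_(x in setpow U n) [set (x * y)%g | y in U]).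
  by apply: bigcup_open => x _; apply: open_mull; exact: gen_open.
apply/seteqP; split=> [x [y Hy [u Uu <-]]|x [y Hy [u Uu <-]]].
  by exists y => //; exists u.
by exists y => //; exists u.
Qed.

Context {R : realType}.
Local Notation rho := (@rho R G U).

Lemma rho_has_inf g :
  has_inf [set (n%:R : R) | n in [set n : nat | (0 < n)%N /\ setpow U n g]].
Proof.
split; last by exists 0 => _ [n _ <-].
have [n Hn] := gen_gen g; exists n.+1%:R, n.+1 => //; split => //.
exact: (setpow_leq (leqnSn n) Hn).
Qed.

Lemma rho_le n g : (0 < n)%N -> setpow U n g -> rho g <= n%:R.
Proof. by move=> n0 H; apply: ge_inf; [case: (rho_has_inf g)|exists n]. Qed.

Lemma rho_attained g : exists n, [/\ (0 < n)%N, setpow U n g & rho g = n%:R].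
Proof.
pose P n := (0 < n)%N && `[< setpow U n g >].
have exP : exists n, P n.
  have [n Hn] := gen_gen g; exists n.+1; rewrite /P ltn0Sn.
  by apply/asboolP; exact: (setpow_leq (leqnSn n) Hn).
case: (ex_minnP exP) => n /andP[n0 /asboolP Hn] minn.
exists n; split=> //; apply/le_anti; rewrite rho_le //=.
apply: lb_le_inf; first by case: (rho_has_inf g).
by move=> _ [m [m0 Hm] <-]; rewrite ler_nat minn // /P m0; apply/asboolP.
Qed.

Lemma rho_ge1 g : 1 <= rho g.
Proof. by have [n [n0 _ ->]] := rho_attained g; rewrite ler1n. Qed.

Lemma rho_ge0 g : 0 <= rho g.
Proof. exact: le_trans (rho_ge1 g). Qed.

Lemma rho_leP n g : (0 < n)%N -> rho g <= n%:R <-> setpow U n g.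
Proof.
move=> n0; split; last exact: rho_le.
have [m [m0 Hm ->]] := rho_attained g; rewrite ler_nat => /setpow_leq; exact.
Qed.

Lemma rhoM g h : rho (g * h)%g <= rho g + rho h.
Proof.
have [m [m0 Hm ->]] := rho_attained g; have [n [n0 Hn ->]] := rho_attained h.
by rewrite -natrD rho_le ?addn_gt0 ?m0 //; exact: setpowD.
Qed.

Lemma rhoV g : rho g^-1%g = rho g.
Proof.
suff le x : rho x^-1%g <= rho x by apply/le_anti; rewrite le -{1}(invgK g) le.
by have [m [m0 Hm ->]] := rho_attained x; rewrite rho_le //; exact: setpowV.
Qed.

Lemma rho_gen u : U u -> rho u = 1.
Proof. by move=> Uu; apply/le_anti; rewrite rho_ge1 andbT; apply: (@rho_le 1) => //; exact: setpow1. Qed.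

(** Compactness of the closure of [U] in the form used throughout: a property valid near the
    identity is propagated to all of [U] by finitely many left translates. *)
Lemma closure_cover (O : set G) : nbhs 1%g O ->
  exists s : seq G, forall x, closure U x -> exists2 y, y \in s & O (y^-1 * x)%g.
Proof.
move=> nO; have := gen_compact; rewrite compact_cover => cU.
have [|x _|D sD HD] := cU G setT (fun y => [set (y * x)%g | x in O^°]).
- by move=> y _; apply: open_mull; exact: open_interior.
- by exists x => //; exists 1%g; rewrite ?mulg1.
exists (enum_fset D) => x /HD [y yD [z Oz <-]]; exists y => //.
by rewrite mulKg; exact: interior_subset Oz.
Qed.

End U.
End WordLength.

(** * Quasi-homomorphisms and characters *)

Lemma one_le_expR (R : realType) (x : R) : 0 <= x -> 1 <= expR x.
Proof. by move=> x0; have := expR_ge1Dx x; lra. Qed.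

Ltac norm_lra :=
  rewrite ?(ler_norml, ltr_norml);
  repeat (first [move=> /andP[? ?] | move=> ?]);
  try (apply/andP; split); lra.

Section QuasiHom.
Context {R : realType} {G : topologicalGroupType}.
Variable U : set G.
Hypothesis gU : generating_nbhs U.
Local Notation rho := (@rho R G U).

(** The defect may grow exponentially; the rate 3 is the one at which [disp_bounds] controls
    displacements. *)
Definition quasi_hom (B : R) (A : G -> R) : Prop := forall g h,
  `|A (g * h)%g - A g - A h| <= B * expR (3 * (rho g + rho h)).

Definition real_char (v : G -> R) : Prop :=
  continuous v /\ forall g h, v (g * h)%g = v g + v h.

Lemma hom1 (v : G -> R) : (forall g h, v (g * h)%g = v g + v h) -> v 1%g = 0.
Proof. by move=> vM; have := vM 1%g 1%g; rewrite mulg1; lra. Qed.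

Lemma homX (v : G -> R) : (forall g h, v (g * h)%g = v g + v h) ->
  forall n g, v (g ^+ n)%g = v g *+ n.
Proof.
move=> vM; elim=> [|n ih] g; first by rewrite expg0 hom1.
by rewrite expgSr vM ih mulrSr.
Qed.

Lemma homV (v : G -> R) : (forall g h, v (g * h)%g = v g + v h) ->
  forall g, v g^-1%g = - v g.
Proof. by move=> vM g; have := vM g g^-1%g; rewrite mulgV hom1 //; lra. Qed.

(** If [(x^-1 y)^n] lies in [U], then [n |v y - v x| <= M]; for fixed [n] this holds for all [y]
    near [x]. *)
Lemma bounded_hom_continuous (v : G -> R) (M : R) :
  (forall g h, v (g * h)%g = v g + v h) ->
  (forall u, U u -> `|v u| <= M) -> continuous v.
Proof.
move=> vM vU x; apply/cvgrPdist_lt => e e0.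
have M0 : 0 <= M by apply: le_trans (vU 1%g (gen1 gU)).
have [n n0 hn] : exists2 n, (0 < n)%N & M < e * n%:R.
  exists (Num.truncn (M / e)).+1 => //.
  by rewrite mulrC -ltr_pdivrMr // truncnS_gt // divr_ge0 // ltW.
have : nbhs x [set y | U ((x^-1 * y) ^+ n)%g].
  have cf : continuous (fun y => (x^-1 * y) ^+ n)%g.
    move=> y; apply: (@cvg_comp _ _ _ (fun y => (x^-1 * y)%g) (fun y => (y ^+ n)%g)).
      exact: continuous_mull.
    exact: continuous_expg.
  by apply: (cf x U); rewrite mulVg expg1n; exact: gen_nbhs.
apply: filterS => y /= /vU; rewrite (homX vM) vM homV // normrMn -mulr_natr => h.
rewrite distrC addrC -(ltr_pM2r (x := n%:R)) ?ltr0n //; exact: le_lt_trans hn.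
Qed.

(** Let [s] be the infimum over all characters of the distance to [A] on [U]; by assumption
    [s >= C B]. Subtracting a character at distance less than [2 s] and dividing by [s] brings the
    defect below [C^-1] and the size on [U] below 2, while every character stays at distance at
    least 1. *)
Lemma real_char_normalised (A : G -> R) (B C M : R) :
  0 < B -> 0 < C -> quasi_hom B A -> (forall u, U u -> `|A u| <= M) ->
  ~ (exists v, real_char v /\ forall u, U u -> `|A u - v u| <= C * B) ->
  exists a, [/\ quasi_hom C^-1 a, forall u, U u -> `|a u| <= 2
    & ~ exists v, real_char v /\ forall u, U u -> `|a u - v u| <= 2^-1].
Proof.
move=> B0 C0 qA AM nv.
pose S := [set s : R | exists v, real_char v /\ forall u, U u -> `|A u - v u| <= s].
have CBS s : S s -> C * B <= s.
  move=> [v [cv Hv]]; rewrite leNgt; apply/negP => hs; apply: nv; exists v.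
  by split=> // u Uu; apply: le_trans (ltW hs); exact: Hv.
have infS : has_inf S.
  split; last by exists (C * B) => s /CBS.
  exists M, (fun=> 0); split; last by move=> u; rewrite subr0; exact: AM.
  by split=> [x|g h]; [exact: cvg_cst|rewrite addr0].
have s0 : C * B <= inf S by apply: lb_le_inf => //; case: infS.
have CB0 : 0 < C * B by rewrite mulr_gt0.
have s_gt0 : 0 < inf S by apply: lt_le_trans s0.
have [s [v [[cv vM] Hv]] hs] := inf_adherent s_gt0 infS.
have [V0 s_neq0] : 0 < (inf S)^-1 /\ inf S != 0 by rewrite invr_gt0 gt_eqF.
exists (fun g => (A g - v g) / inf S); split.
- move=> g h; rewrite vM.
  rewrite (_ : _ - _ = (A (g * h)%g - A g - A h) / inf S); last by field.
  rewrite normrM (gtr0_norm V0) ler_pdivrMr // (le_trans (qA g h)) //.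
  rewrite mulrAC ler_pM2r ?expR_gt0 // ler_pdivlMl //.
- move=> u Uu; rewrite normrM (gtr0_norm V0) ler_pdivrMr // (le_trans (Hv u Uu)) //.
  by apply: le_trans (ltW hs) _; lra.
- move=> [v' [[cv' v'M] Hv']]; suff /(ge_inf infS.2) : S (inf S / 2) by lra.
  exists (fun g => v g + inf S * v' g); split.
    split=> [x|g h]; last by rewrite vM v'M; ring.
    by apply: cvgD; [exact: cv|apply: cvgMr; exact: cv'].
  move=> u Uu; 
  rewrite (_ : _ - _ = ((A u - v u) / inf S - v' u) * inf S); last by field.
  by rewrite normrM (gtr0_norm s_gt0) [_ / 2]mulrC ler_pM2r //; exact: Hv'.
Qed.

Lemma quasi_hom_limit (a : nat -> G -> R) :
  (forall j, quasi_hom j.+1%:R^-1 (a j)) ->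
  (forall j u, U u -> `|a j u| <= 2) ->
  exists j v, real_char v /\ forall u, U u -> `|a j u - v u| <= 2^-1.
Proof.
move=> qa aU.
(* An ultrafilter provides limits at all points of [G] at once. *)
have [F [uF oF]] := ultraFilterLemma (@eventually_filter).
have bnd g : exists M : R, forall j, `|a j g| <= M.
  have [n] := gen_gen gU g; elim: n g => [g ->|n ih g [x Hx [u Uu <-]]].
    by exists 2 => j; apply: aU; exact: gen1.
  have [M HM] := ih x Hx; exists (M + 2 + expR (3 * (rho x + rho u))) => j.
  have := qa j x u; have := HM j; have := aU j u Uu; rewrite !ler_norml.
  have : j.+1%:R^-1 * expR (3 * (rho x + rho u)) <= expR (3 * (rho x + rho u)).
    by rewrite ler_piMl ?expR_ge0 // invf_le1 ?ltr0n // ler1n.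
  set q := expR _; set p := _ * q => h1 /andP[h2 h3] /andP[h4 h5] /andP[h6 h7].
  by apply/andP; split; lra.
have lim g : exists l : R, a ^~ g @ F --> l.
  have [M HM] := bnd g.
  have : compact `[- M, M] by exact: segment_compact.
  move=> /(_ (a ^~ g @ F) _ _)[].
    by apply: (@filterE _ F) => j; rewrite /= in_itv /= -ler_norml; exact: HM.
  move=> l [_ Hl]; exists l => N nN.
  have [//|FN] := in_ultra_setVsetC (a ^~ g @^-1` N) uF.
  by have [y [/= Ny]] := Hl (~` N) N FN nN.
have {lim} [l Hl] := choice lim.
have near_l g (e : R) : 0 < e -> \forall j \near F, `|l g - a j g| < e.
  by move=> e0; move/cvgrPdist_lt: (Hl g); apply.
have near_w g h (e : R) : 0 < e ->
    \forall j \near F, j.+1%:R^-1 * expR (3 * (rho g + rho h)) < e.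
  move=> e0; apply: oF; exists (Num.truncn (expR (3 * (rho g + rho h)) / e)) => //.
  move=> j /= hj; rewrite ltr_pdivrMl // -ltr_pdivrMr //.
  by apply: lt_le_trans (truncnS_gt _) _; rewrite ler_nat.
have lM g h : l (g * h)%g = l g + l h.
  suff H (e : R) : 0 < e -> `|l (g * h)%g - (l g + l h)| <= e.
    apply/eqP; rewrite -subr_eq0 -normr_le0.
    by apply/ler_addgt0Pr => e /H; rewrite add0r.
  move=> e0.
  have e40 : 0 < e / 4 by lra.
  have [j [[[h1 h2] h3] h4]] : exists j, ((`|l (g * h)%g - a j (g * h)%g| < e / 4 /\
     `|l g - a j g| < e / 4) /\ `|l h - a j h| < e / 4) /\
     j.+1%:R^-1 * expR (3 * (rho g + rho h)) < e / 4.
    by apply: (@filter_ex _ F); do !apply: filterI; [exact: near_l..|exact: near_w].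
  have := qa j g h; move: h1 h2 h3 h4; set w := _ * expR _.
    norm_lra.
have lU u : U u -> `|l u| <= 2.
  move=> Uu; suff H (e : R) : 0 < e -> `|l u| <= 2 + e by apply/ler_addgt0Pr.
  move=> e0.
  have [j h1] := @filter_ex _ F _ _ (near_l u e e0).
  have := aU j u Uu; move: h1; norm_lra.
have cl := bounded_hom_continuous lM lU.
(* Convergence is only pointwise, whereas closeness on all of [U] is wanted. Let [b] be the
   difference of [a j] and the limit, so [|b| <= 4] on [U]. If [y] and [y^16] lie in [U], four
   doublings bound [16 |b y|] by 4 plus small defects, so [|b y|] is little more than 1/4. Finitely
   many translates of this neighbourhood cover [U], and at their base points [b] is small for
   suitable [j]. *)
pose O := [set y : G | U (y ^+ 16)%g /\ U y].
have nO : nbhs 1%g O.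
  apply: filterI; last exact: gen_nbhs.
  by apply: (@continuous_expg _ 16 1%g U); rewrite expg1n; exact: gen_nbhs.
have [s Hs] := closure_cover gU nO.
have : \forall j \near F, j.+1%:R^-1 * expR (3 * (8 + 8)) < 16^-1 :> R /\
   forall x, x \in s -> `|l x - a j x| < 16^-1 /\
      j.+1%:R^-1 * expR (3 * (rho x + rho 1%g)) < 16^-1.
  apply: filterI.
    apply: oF; exists (Num.truncn (expR (3 * (8 + 8)) * 16 : R)) => //.
    move=> j /= hj; rewrite ltr_pdivrMl // -ltr_pdivrMr ?invr_gt0 // invrK.
    by apply: lt_le_trans (truncnS_gt _) _; rewrite ler_nat.
  elim: s {Hs} => [|x s ih]; first by apply: filterE.
  have h1 : \forall j \near F, `|l x - a j x| < 16^-1 by apply: near_l.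
  have h2 : \forall j \near F, j.+1%:R^-1 * expR (3 * (rho x + rho 1%g)) < 16^-1.
    exact: near_w.
  apply: filterS3 h1 h2 ih => j h1 h2 h3 y; rewrite inE => /orP[/eqP->//|].
  exact: h3.
move/(@filter_ex _ F) => [j [hj1 hj2]].
exists j, l; split=> // u Uu.
have [x /hj2 [hx1 hx2] [Oy16 Oy]] := Hs u (subset_closure Uu).
set y := (x^-1 * u)%g in Oy16 Oy.
pose b z := a j z - l z.
have qb g h : `|b (g * h)%g - b g - b h| <= j.+1%:R^-1 * expR (3 * (rho g + rho h)).
  rewrite (_ : b _ - _ - _ = a j (g * h)%g - a j g - a j h).
    exact: qa.
  by rewrite /b lM; ring.
have b4 z : U z -> `|b z| <= 4.
  by move=> Uz; rewrite (le_trans (ler_normB _ _)) //; have := aU j z Uz; have := lU z Uz; lra.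
have dbl z : rho z <= 8 -> `|b (z * z)%g - b z - b z| <= 16^-1.
  move=> rz; apply: le_trans (qb _ _) _; apply: le_trans (ltW hj1).
  by rewrite ler_pM2l ?invr_gt0 ?ltr0n // ler_expR; lra.
have r1 := rho_gen gU (R := R) Oy.
have r2 : rho (y * y)%g <= 2 by apply: le_trans (rhoM gU _ _) _; lra.
have r4 : rho ((y * y) * (y * y))%g <= 4 by apply: le_trans (rhoM gU _ _) _; lra.
set y4 := ((y * y) * (y * y))%g in r4.
have r8 : rho (y4 * y4)%g <= 8 by apply: le_trans (rhoM gU _ _) _; lra.
have y16 : U ((y4 * y4) * (y4 * y4))%g.
  move: Oy16; rewrite -[16%N]/(2 * 2 * (2 * 2))%N !expgnA !expg2.
  by rewrite /y4.
have := b4 _ y16; have := dbl _ r8; have h4 : rho y4 <= 8 by lra.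
have := dbl _ h4; have h2 : rho (y * y)%g <= 8 by lra.
have := dbl _ h2; have h1 : rho y <= 8 by lra.
have := dbl _ h1; rewrite -/y4.
have := qb x y; rewrite {1}/y mulVKg r1 => q1.
rewrite (rho_gen gU (gen1 gU)) in hx2.
have := le_trans q1 (ltW hx2).
rewrite distrC in hx1; move: hx1; rewrite -/(b x) -/(b u).
norm_lra.
Qed.

(* Otherwise, subtracting nearly optimal characters from counterexamples and
   rescaling, one gets functions [a j] of defect 1/(j+1) at distance at least
   1/2 from every character; but their ultralimit is a character. *)
Lemma quasi_hom_near_char : exists C : R, 0 < C /\
  forall (A : G -> R) (B M : R), 0 < B -> quasi_hom B A ->
    (forall u, U u -> `|A u| <= M) ->
    exists v, real_char v /\ forall u, U u -> `|A u - v u| <= C * B.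
Proof.
apply: contrapT => H.
have Hj (j : nat) : exists a, [/\ quasi_hom j.+1%:R^-1 a,
    forall u, U u -> `|a u| <= 2
    & ~ exists v, real_char v /\ forall u, U u -> `|a u - v u| <= 2^-1].
  apply: contrapT => nj; apply: H; exists j.+1%:R; split=> // A B M B0 qA AM.
  by apply: contrapT => nv; apply: nj; exact: (real_char_normalised B0 _ qA AM nv).
have [a Ha] := choice Hj.
have [|j u Uu|j [v Hv]] := @quasi_hom_limit a.
- by move=> j; case: (Ha j).
- by case: (Ha j) => _ /(_ u Uu).
- by case: (Ha j) => _ _; apply; exists v.
Qed.

(** Letters are removed one at a time. Since [1 + e^3 <= e^4], the rate 4 absorbs both the previous
    value and the defect, whose rate is 3. *)
Lemma quasi_hom_growth (A : G -> R) (B C : R) : 0 < B -> 0 < C ->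
  quasi_hom B A -> (forall u, U u -> `|A u| <= C * B) ->
  forall g, `|A g| <= B * (C + 1) * expR (4 * rho g).
Proof.
move=> B0 C0 qA AU g.
have BC0 : 0 <= B * (C + 1) by rewrite mulr_ge0 //; lra.
have C2 : 1 + expR 3 <= expR 4 :> R.
  have -> : 4 = 1 + 3 :> R by ring.
  rewrite (expRD 1 3); have := @expR_ge1Dx R 1; have := @expR_ge1Dx R 3.
  move: (expR 1 : R) (expR 3 : R) => a b hb ha.
  have : 0 <= (a - 2) * b by apply: mulr_ge0; lra.
  lra.
have [n [n0 Hn ->]] := rho_attained gU (R := R) g.
case: n n0 Hn => // n _; elim: n g => [|n ih] g.
  move=> [x -> [u Uu <-]]; rewrite mul1g (le_trans (AU u Uu)) //.
  have : 1 <= expR (4 * 1) :> R by apply: one_le_expR; lra.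
  by nra.
move=> [x Hx [u Uu <-]].
have rx : rho x <= n.+1%:R by apply: rho_le.
have := qA x u; rewrite (rho_gen gU (R := R) Uu).
have := ih x Hx; have := AU u Uu.
have e3 : expR (3 * (rho x + 1)) <= expR 3 * expR (4 * n.+1%:R) :> R.
  rewrite -expRD ler_expR; have := rho_ge0 gU (R := R) x; lra.
have -> : expR (4 * n.+2%:R) = expR 4 * expR (4 * n.+1%:R) :> R.
  by rewrite -expRD -[n.+2%:R]natr1; congr expR; ring.
have E1 : 1 <= expR (4 * n.+1%:R) :> R by apply: one_le_expR; rewrite mulr_ge0.
have c1 : 1 <= expR 3 :> R by have := @expR_ge1Dx R 3; lra.
move: (expR (3 * (rho x + 1))) (expR (4 * n.+1%:R)) (expR 3) (expR 4) e3 E1 C2 c1.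
move=> a b c d ac b1 cd c1 h1 h2 h3.
have -> : A (x * u)%g = (A (x * u)%g - A x - A u) + A x + A u by ring.
apply: le_trans (ler_normD _ _) _; apply: le_trans (lerD (ler_normD _ _) (lexx _)) _.
apply: (@le_trans _ _ (B * (c * b) + B * (C + 1) * b + C * B)).
  by apply: lerD => //; apply: lerD => //; apply: le_trans h3 _; rewrite ler_pM2l.
have p1 : 0 <= B * C * (c * b - 1).
  by rewrite !mulr_ge0 ?(ltW B0) ?(ltW C0) // subr_ge0 -[1]mulr1 ler_pM.
have p2 : 0 <= B * (C + 1) * (b * (d - 1 - c)) by rewrite mulr_ge0 // mulr_ge0 //; lra.
lra.
Qed.
End QuasiHom.

Lemma continuous_pair (S T1 T2 : topologicalType) (f : S -> T1) (g : S -> T2) :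
  continuous f -> continuous g -> continuous (fun x => (f x, g x)).
Proof.
move=> cf cg x; have : (f y, g y) @[y --> x] --> (f x, g x).
  by apply: cvg_pair; [exact: cf|exact: cg].
by [].
Qed.

(** * Real characters as linear forms in the coordinates of [pi1] *)

Section CharacterFactorization.
Context {R : realType} {G : topologicalGroupType}.

(** The difference [f x - x f(1)] is additive and vanishes at 1, hence is periodic and bounded by
    its extrema on [[0, 1]]; a bounded additive function is zero. *)
Lemma additive_continuous_linear (f : R -> R) :
  {morph f : x y / x + y} -> continuous f -> forall x, f x = x * f 1.
Proof.
move=> fD cf.
pose g x := f x - x * f 1.
have gD : {morph g : x y / x + y} by move=> x y; rewrite /g fD; ring.
have g0 : g 0 = 0 by have := gD 0 0; rewrite addr0; lra.
have gn n x : g (x *+ n) = g x *+ n.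
  by elim: n => [|n ih]; rewrite ?mulr0n // !mulrSr gD ih.
have g1 : g 1 = 0 by rewrite /g; ring.
have gN x : g (- x) = - g x by have := gD x (- x); rewrite subrr g0; lra.
have cg : {within `[0, 1], continuous g}.
  apply: continuous_subspaceT => x.
  by apply: cvgB; [exact: cf|apply: cvgMl; exact: cvg_id].
have [b _ Hb] := EVT_max ler01 cg; have [a _ Ha] := EVT_min ler01 cg.
have bnd x : g a <= g x <= g b.
  have -> : g x = g (x - (Num.floor x)%:~R).
    rewrite gD gN; suff -> : g (Num.floor x)%:~R = 0 by rewrite subr0.
    case: (Num.floor x) => n; first by rewrite -pmulrn gn g1 mul0rn.
    by rewrite NegzE mulrNz gN -pmulrn gn g1 mul0rn oppr0.
  have xI : x - (Num.floor x)%:~R \in `[0, 1].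
    rewrite in_itv /= subr_ge0 floor_le_tmp /= lerBlDl ltW //.
    by rewrite -[_ + 1]/(_ + 1%:~R) -intrD floorD1_gt.
  by rewrite Ha // Hb.
move=> x; suff : g x = 0 by rewrite /g => /eqP; rewrite subr_eq0 => /eqP.
apply/eqP; rewrite -normr_le0; apply/negbNE/negP; rewrite -ltNge => gx.
pose n := (Num.truncn ((`|g a| + `|g b|) / `|g x|)).+1.
have hn : `|g a| + `|g b| < `|g x| * n%:R.
  by rewrite mulrC -ltr_pdivrMr // truncnS_gt.
have : `|g (x *+ n)| <= `|g a| + `|g b|.
  have /andP[h1 h2] := bnd (x *+ n).
  have := ler_norm (g b); have := ler_norm (- g a); rewrite normrN.
  by have := normr_ge0 (g a); have := normr_ge0 (g b); rewrite ler_norml; lra.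
by rewrite gn normrMn -mulr_natr leNgt hn.
Qed.

Variables (q r : nat) (phi : abelianization_iso R G q r) (v : G -> R).
Hypothesis cv : real_char v.

Let vc : continuous v. Proof. by case: cv. Qed.
Let vM g h : v (g * h)%g = v g + v h. Proof. by case: cv. Qed.

(** The kernel of [v] is a closed subgroup containing all commutators. *)
Lemma real_char_G0 g : G0 g -> v g = 0.
Proof.
have cl : closed (v @^-1` [set 0]).
  by apply: closed_comp => // x _; exact: vc.
move=> Gg; suff : (v @^-1` [set 0]) g by [].
apply: cl; move: Gg; apply: closure_subset => x /(_ (v @^-1` [set 0])); apply.
split; first split=> /=; first exact: hom1.
  by move=> y z /= hy hz; rewrite vM homV // hy hz subr0.
move=> _ [y [z ->]] /=; rewrite commgEl conjgE !vM !homV //; ring.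
Qed.

Lemma real_char_pi0 x y : pi0 x = pi0 y -> v x = v y.
Proof.
move=> /eqmodP /asboolP /real_char_G0; rewrite vM homV //; lra.
Qed.

(** The character carried over to [R^q x T^r]. Any representative will do, as [v] is constant on the
    cosets of [G0]. *)
Let W z := v (repr (abiso_inv phi z)).

Let pi0_repr z : pi0 (repr (abiso_inv phi z)) = abiso_inv phi z.
Proof. exact: reprK. Qed.

Let WE x : v x = W (abiso phi (pi0 x)).
Proof. by apply: real_char_pi0; rewrite pi0_repr abisoK. Qed.

Let WD : {morph W : y z / y + z}.
Proof.
move=> y z; rewrite -vM WE abisoM !pi0_repr !abiso_invK //.
Qed.

Let Wc : continuous W.
Proof.
move=> z; apply: (@cvg_comp _ _ _ (abiso_inv phi) (v \o repr)).
  exact: abiso_inv_continuous.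
apply: repr_comp_continuous => // a b /eqP ab; apply/eqP.
exact: real_char_pi0.
Qed.

(** [W] is linear along continuous one-parameter subgroups. It is thus determined by the coordinate
    axes of [R^q], and it vanishes on the circles, whose subgroups return to 0 at time 1. This links
    the character found by compactness to the centering of [K], which speaks of coordinates only. *)
Lemma real_char_factor :
  exists c : 'I_q -> R, forall g, v g = \sum_(i < q) c i * pi1 phi g ord0 i.
Proof.
have W0 : W 0 = 0 by have := WD 0 0; rewrite addr0; lra.
have Wlin (gam : R -> 'rV[R]_q * 'rV[circle R]_r) :
    {morph gam : x y / x + y} -> continuous gam -> forall t, W (gam t) = t * W (gam 1).
  move=> gD gc; apply: (additive_continuous_linear (f := W \o gam)).
    by move=> x y /=; rewrite gD WD.
  by move=> x; apply: cvg_comp; [exact: gc|exact: Wc].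
pose e (i : 'I_q) (t : R) : 'rV[R]_q * 'rV[circle R]_r := (t *: delta_mx 0 i, 0).
pose p (t : R) : circle R := (\pi_(Quotient.quot (integers R)) t)%qT.
pose s (j : 'I_r) (t : R) : 'rV[R]_q * 'rV[circle R]_r :=
  (0, \row_k (if k == j then p t else 0)).
have pc : continuous p.
  exact: (@pi_continuous _ (Quotient.quot (integers R))).
have pD : {morph p : x y / x + y} by move=> x y; rewrite /p !raddfD.
have p1 : p 1 = 0.
  have p0 : p 0 = 0 by have := pD 0 0; rewrite addr0 -{1}[p 0]addr0 => /addrI.
  rewrite -p0.
  suff /eqP : ((1 : R) == 0 %[mod Quotient.quot (integers R)])%qT by [].
  by rewrite -Quotient.idealrBE subr0; exact: (int_num1 R).
have We i t : W (e i t) = t * W (e i 1).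
  apply: Wlin => [x y|x]; first by rewrite /e scalerDl -[RHS]/(_, _) addr0.
  move: x; apply: continuous_pair => x; last exact: cvg_cst.
  by apply: cvgZr_tmp; exact: cvg_id.
have Ws j t : W (s j t) = 0.
  rewrite Wlin.
  - suff -> : s j 1 = 0 by rewrite W0 mulr0.
    rewrite /s p1; congr (_, _); apply/rowP => k; rewrite !mxE; by case: ifP.
  - move=> x y; rewrite /s -[RHS]/(_, _) addr0; congr (_, _).
    by apply/rowP => k; rewrite !mxE; case: ifP; rewrite ?addr0.
  - apply: continuous_pair => x; first exact: cvg_cst.
    move=> P [Q nQ QP]; have : \forall t \near x, Q ord0 j (p t).
      by apply: (pc x (Q ord0 j)); have := nQ ord0 j; rewrite mxE eqxx.
    apply: filterS => y Qy; apply: QP => i k /=; rewrite (ord1 i) mxE.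
    case: eqP => [->//|kj]; have := nQ ord0 k; rewrite mxE.
    by case: eqP => // _; exact: nbhs_singleton.
exists (fun i => W (e i 1)) => g.
rewrite WE /pi1; set z := abiso phi (pi0 g).
have zE : z = \sum_i e i (z.1 ord0 i) + \sum_j s j (repr (z.2 ord0 j)).
  rewrite [LHS]surjective_pairing [RHS]surjective_pairing.
  rewrite ![(_ + _).1]/= ![(_ + _).2]/=.
  rewrite !(big_morph fst (id1 := 0) (op1 := +%R)) // !(big_morph snd (id1 := 0) (op1 := +%R)) //=.
  rewrite [X in _ + X]big1 // addr0 [X in X + _]big1 // add0r; congr (_, _).
    by rewrite {1}[z.1]row_sum_delta.
  apply/rowP => k; rewrite summxE (bigD1 k) //= big1 => [|j jk].
    by rewrite mxE eqxx addr0 /p reprK.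
  by rewrite mxE eq_sym (negbTE jk).
rewrite {1}zE WD !(big_morph W WD W0) [X in _ + X]big1 ?addr0 => [|j _]; last exact: Ws.
by apply: eq_bigr => i _; rewrite We mulrC.
Qed.
End CharacterFactorization.

(** * Haar measure *)

Section BorelGroup.
Context {R : realType} {G : topologicalGroupType}.
Hypothesis scG : @second_countable G.
Local Notation BG := (borel G).

Lemma open_borel (O : set G) : open O -> measurable (O : set BG).
Proof. by move=> oO; exact: sub_sigma_algebra. Qed.

Lemma continuous_borel_fun d (T : measurableType d) (f : T -> G) :
  (forall O : set G, open O -> measurable (f @^-1` O)) ->
  measurable_fun setT (f : T -> BG).
Proof.
move=> mf; apply: (@measurability _ _ T BG setT (f : T -> BG) (@open G)) => //.
by move=> _ [V oV <-]; rewrite setTI; exact: mf.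
Qed.

(** By second countability an open set of the product is a countable union of open rectangles. Joint
    measurability of the group operations, and with it every use of Tonelli, rests on this. *)
Lemma open_prod_borel (O : set (G * G)) : open O -> measurable (O : set (BG * BG)).
Proof.
move=> oO; have [B cB [Bo Bb]] := scG.
pose D := [set p : set G * set G | [/\ B p.1, B p.2 & p.1 `*` p.2 `<=` O]].
have cD : countable D.
  apply: (@sub_countable _ _ _ (B `*` B)); last exact: countableX.
  by apply: subset_card_le => p [].
rewrite (_ : O = \bigcup_(p in D) (p.1 `*` p.2)).
  rewrite bigcup_set_type; apply: countable_bigcupT_measurable.
    by rewrite (eq_countable (card_setT D)).
  move=> [p /set_mem [B1 B2 _]] /=; apply: measurableX; apply: open_borel; exact: Bo.
apply/seteqP; split=> [[x y] Oxy|z [p [_ _]]]; last exact.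
have [[P Q] /= [nP nQ] PQ] : nbhs (x, y) O by apply: open_nbhs_nbhs.
have [V [BV Vx] VP] := Bb x P nP; have [W [BW Wy] WQ] := Bb y Q nQ.
exists (V, W) => //=; split=> //= z [z1 z2]; apply: PQ; split => /=; [exact: VP|exact: WQ].
Qed.

Lemma measurable_continuous2 (f : G * G -> G) : continuous f ->
  measurable_fun setT (f : BG * BG -> BG).
Proof.
move=> cf; apply: continuous_borel_fun => O oO; apply: open_prod_borel.
by apply: open_comp => // x _; exact: cf.
Qed.

Lemma measurable_mulg2 d (T : measurableType d) (f g : T -> BG) :
  measurable_fun setT f -> measurable_fun setT g ->
  measurable_fun setT (fun x => (f x * g x)%g : BG).
Proof.
move=> mf mg; apply: (@measurableT_comp _ _ _ _ _ _ (fun z : BG * BG => (z.1 * z.2)%g : BG)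
  _ (fun x => (f x, g x))).
  by apply: measurable_continuous2; exact: mulg_continuous.
exact: measurable_fun_pair.
Qed.

Lemma measurable_invg1 d (T : measurableType d) (f : T -> BG) :
  measurable_fun setT f -> measurable_fun setT (fun x => (f x)^-1%g : BG).
Proof.
move=> mf; apply: (@measurableT_comp _ _ _ _ _ _ (fun z : BG => z^-1%g : BG)) => //.
apply: continuous_borel_fun => O oO; apply: open_borel.
by apply: open_comp => // x _; exact: invg_continuous.
Qed.

Lemma continuous_measurable_real (f : G -> R) : continuous f ->
  measurable_fun setT (f : BG -> R).
Proof.
move=> cf; apply: (measurability _ (RGenOInfty.measurableE R)) => //.
move=> _ [_ [x ->] <-]; rewrite setTI; apply: open_borel.
by apply: open_comp => [z _|]; [exact: cf|exact: interval_open].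
Qed.

(** Meant for [rho] and [dist_to], which need not be continuous but are integer valued with open
    sublevel sets. *)
Lemma measurable_nat_sublevel (f : G -> R) :
  (forall x, exists n : nat, f x = n%:R) ->
  (forall n : nat, open [set x | f x <= n%:R]) -> measurable_fun setT (f : BG -> R).
Proof.
move=> fn fo; apply: (measurability _ (RGenOInfty.measurableE R)) => //.
move=> _ [_ [a ->] <-]; rewrite setTI.
rewrite (_ : _ @^-1` _ =
    ~` \bigcup_(n in [set n : nat | (n%:R : R) <= a]) [set x : BG | f x <= n%:R]).
  by apply: measurableC; apply: bigcup_measurable => n _; exact: open_borel.
apply/seteqP; split=> x /=; rewrite in_itv /= andbT.
  by move=> ax [n /= na] /le_trans /(_ na); rewrite leNgt ax.
move=> h; rewrite ltNge; apply/negP => fa; apply: h.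
by have [n e] := fn x; exists n; rewrite /= -e.
Qed.

Lemma measurable_rho (U : set G) : generating_nbhs U ->
  measurable_fun setT (@rho R G U : BG -> R).
Proof.
move=> gU; apply: measurable_nat_sublevel => [x|[|n]].
- by have [n [_ _ ->]] := rho_attained gU (R := R) x; exists n.
- rewrite (_ : mkset _ = set0); first exact: open0.
  by apply/seteqP; split=> x //=; have := rho_ge1 gU (R := R) x; lra.
- rewrite (_ : mkset _ = setpow U n.+1); first exact: open_setpow.
  by apply/seteqP; split=> x; rewrite /mkset => /(rho_leP gU x (ltn0Sn n)).
Qed.

Section Haar.
Variable mu : {measure set BG -> \bar R}.
Hypothesis hmu : left_haar mu.
Local Open Scope ereal_scope.

Lemma haar_preimage (g : G) (A : set BG) : measurable A ->
  mu ((fun x : G => (g * x)%g) @^-1` A) = mu A.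
Proof.
move=> mA; case: hmu => inv _ _; rewrite -(inv g^-1%g A mA).
by rewrite mull_image invgK.
Qed.

Lemma measurable_mull (g : G) : measurable_fun setT ((fun x => (g * x)%g) : BG -> BG).
Proof. by apply: measurable_mulg2. Qed.

Lemma haar_ge0_integral (g : G) (f : BG -> \bar R) :
  measurable_fun setT f -> (forall x, 0 <= f x) ->
  \int[mu]_x (f (g * x)%g) = \int[mu]_x (f x).
Proof.
move=> mf f0.
rewrite -[LHS](@ge0_integral_pushforward _ _ BG BG R _ (measurable_mull g) mu setT f) //.
apply: eq_measure_integral => [|mg A mA _]; first exact: measurable_mull.
exact: haar_preimage.
Qed.

Lemma haar_integral (g : G) (f : BG -> \bar R) : measurable_fun setT f ->
  \int[mu]_x (f (g * x)%g) = \int[mu]_x (f x).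
Proof.
move=> mf; rewrite integralE [RHS]integralE; congr (_ - _).
  rewrite -(haar_ge0_integral g (measurable_funepos mf)) //.
  by apply: eq_integral => x _; rewrite !funeposE.
rewrite -(haar_ge0_integral g (measurable_funeneg mf)) //.
by apply: eq_integral => x _; rewrite !funenegE.
Qed.

Lemma haar_integrable (g : G) (f : BG -> \bar R) :
  mu.-integrable setT f -> mu.-integrable setT (fun x => f (g * x)%g).
Proof.
move=> /integrableP[mf intf]; apply/integrableP; split.
  by apply: (measurableT_comp (f := f)) => //; exact: measurable_mull.
rewrite (haar_ge0_integral g (f := fun x => `|f x|)) //.
exact: measurableT_comp.
Qed.

Variable U : set G.
Hypothesis gU : generating_nbhs U.

Lemma haar_cover (O : set G) (s : seq G) (A : set G) : open O ->
  measurable (A : set BG) ->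
  (forall x, A x -> exists2 y, y \in s & O (y^-1 * x)%g) ->
  mu A <= (size s)%:R%:E * mu O.
Proof.
move=> oO mA cov; have mO := open_borel oO.
have mC y : measurable (((fun x => (y^-1 * x)%g) @^-1` O) : set BG).
  by rewrite -[X in measurable X]setTI; exact: measurable_mull.
apply: (@le_trans _ _ (\sum_(y <- s) mu ((fun x => (y^-1 * x)%g) @^-1` O))).
  apply: le_trans (_ : mu (\big[setU/set0]_(y <- s) ((fun x => (y^-1 * x)%g) @^-1` O)) <= _).
    apply: le_measure; [exact: mem_set| |].
      by apply: mem_set; apply: bigsetU_measurable => y _.
    by move=> x /cov [y ys Oy]; rewrite -bigcup_seq; exists y.
  elim: s {cov} => [|y s ih]; first by rewrite !big_nil measure0.
  rewrite !big_cons; apply: le_trans (measureU2 _ _ _) _ => //.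
    by apply: bigsetU_measurable => z _.
  by rewrite leeD2l.
rewrite (eq_bigr (fun=> mu O)) => [|y _]; last exact: haar_preimage.
by rewrite big_const_seq count_predT; elim: (size s) => [|n ih]; rewrite /= ?mul0e // ?natr1 -natr1 EFinD ge0_muleDl // mul1e addeC leeD2r.
Qed.

Lemma haar_gen_lty : mu U < +oo.
Proof.
case: hmu => _ fin _; apply: le_lt_trans (fin _ (gen_compact gU)).
apply: le_measure; [apply: mem_set|apply: mem_set|exact: subset_closure].
  by apply: open_borel; exact: gen_open.
rewrite -[closure U]setCK; apply: measurableC; apply: open_borel.
by rewrite openC; exact: closed_closure.
Qed.

(** Finitely many left translates of [U], say [m], cover [U U]; hence [m^n] of them cover [U^(n+1)].
    Gaussian decay beats this exponential growth. *)
Lemma haar_growth : exists2 m : nat, (0 < m)%N &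
  forall n, mu (setpow U n.+1) <= (m ^ n)%:R%:E * mu U.
Proof.
have nU := gen_nbhs gU.
have cov2 : exists s : seq G, forall x, setpow U 2 x -> exists2 y, y \in s & U (y^-1 * x)%g.
  have : nbhs (1%g, 1%g) ((fun z : G * G => (z.1 * z.2)%g) @^-1` U).
    by apply: mulg_continuous; rewrite /= mulg1.
  move=> [[P Q] /= [nP nQ] PQ].
  have nO : nbhs 1%g (P `&` Q) by exact: filterI.
  have [s Hs] := closure_cover gU nO.
  (* For [w] near [y], write [u w = (u y) (y^-1 w)]. To have [u y] close to some [z y], the
     neighbourhood with which [U] is covered must be conjugated by [y], so the list of the [z]
     depends on [y]. *)
  have /choice [f Hf] : forall y : G, exists l : seq G, forall x, closure U x ->
      exists2 z, z \in l & (P `&` Q) ((z * y)^-1 * (x * y))%g.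
    move=> y; have [|l Hl] := @closure_cover _ _ gU [set w | (P `&` Q) (y^-1 * w * y)%g].
      have cf : continuous (fun w : G => y^-1 * w * y)%g.
        apply: continuous_mul2 => w; last exact: cvg_cst.
        exact: continuous_mull.
      by apply: (cf 1%g); rewrite mulg1 mulVg.
    exists l => x /Hl [z zl Hz]; exists z => //.
    by move: Hz; rewrite /= invgM !mulgA.
  exists (flatten [seq [seq (z * y)%g | z <- f y] | y <- s]) => _ [_ [_ -> [u Uu <-]] [w Uw <-]].
  have [y ys [Py Qy]] := Hs w (subset_closure Uw).
  have [z zf [Pz Qz]] := Hf y u (subset_closure Uu).
  exists (z * y)%g.
    by apply/flattenP; exists [seq (z * y)%g | z <- f y]; apply: map_f.
  have /= := PQ ((z * y)^-1 * (u * y), y^-1 * w)%g (conj Pz Qy).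
  by rewrite mul1g !mulgA mulgK.
have [s Hs] := cov2.
pose t n := iter n (fun l => [seq (x * y)%g | x <- l, y <- s]) [:: 1%g].
have st n : size (t n) = (size s ^ n)%N.
  by elim: n => //= n ih; rewrite size_allpairs -/(t n) ih expnSr.
have ct n x : setpow U n.+1 x -> exists2 y, y \in t n & U (y^-1 * x)%g.
  elim: n x => [|n ih] x.
    move=> [_ -> [u Uu <-]]; exists 1%g; first by rewrite inE.
    by rewrite invg1 !mul1g.
  move=> [z /ih [y yt Uyz] [u Uu <-]].
  have [w ws Uw] : exists2 w, w \in s & U (w^-1 * (y^-1 * z * u))%g.
    apply: Hs; exists (y^-1 * z)%g; last by exists u.
    exact: setpow1.
  exists (y * w)%g; first by apply/allpairsP; exists (y, w).
  by rewrite invgM -!mulgA; move: Uw; rewrite -!mulgA.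
exists (size s); last first.
  move=> n; rewrite -st; apply: haar_cover (ct n); first exact: gen_open gU.
  by apply: open_borel; apply: open_setpow.
have [y ys _] : exists2 y, y \in s & U (y^-1 * 1)%g.
  by apply: Hs; apply: (setpow_leq gU (m := 0)).
by case: s ys {Hs t st ct}.
Qed.

Lemma haar_sigma_finite : sigma_finite setT mu.
Proof.
have [m m0 Hm] := haar_growth.
exists (fun n => setpow U n.+1).
  apply/seteqP; split=> // x _; have [n Hn] := gen_gen gU x.
  by exists n => //; exact: (setpow_leq gU (leqnSn n)).
move=> n; split; first by apply: open_borel; apply: open_setpow.
apply: le_lt_trans (Hm n) _; apply: lte_mul_pinfty => //; last exact: haar_gen_lty.
Qed.

(** If [O] were null, so would be [U], covered by finitely many translates of [O], then every power
    of [U] by [haar_growth], and finally [G]. *)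
Lemma haar_open_gt0 (O : set G) : nbhs 1%g O -> open O -> 0 < mu O.
Proof.
move=> nO oO; rewrite lt0e measure_ge0 andbT; apply/negP => /eqP mO0.
case: (hmu) => _ _ /negP; apply; apply/eqP.
have [s Hs] := closure_cover gU nO.
have mU0 : mu U = 0.
  apply/le_anti; rewrite measure_ge0 andbT.
  have := @haar_cover O s U oO (open_borel (gen_open gU)).
  by rewrite mO0 mule0; apply => x /subset_closure; exact: Hs.
have [m m0 Hm] := haar_growth.
rewrite (_ : setT = \bigcup_n (setpow U n.+1)).
  apply/eqP; rewrite -measure_le0.
  have mS n : measurable (setpow U n.+1 : set BG).
    by apply: open_borel; exact: open_setpow.
  apply: le_trans (@measure_sigma_subadditive _ _ _ mu (\bigcup_n setpow U n.+1)
    (fun n => setpow U n.+1) mS _ _) _.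
  - by apply: bigcup_measurable => n _.
  - exact: subset_refl.
  rewrite eseries0 // => n _ _; apply/eqP; rewrite -measure_le0.
  by have := Hm n; rewrite mU0 mule0.
apply/seteqP; split=> // x _; have [n Hn] := gen_gen gU x.
by exists n => //; exact: (setpow_leq gU (leqnSn n)).
Qed.

End Haar.
End BorelGroup.

(** * Moments of sub-Gaussian densities *)

Section Moments.
Context {R : realType} {G : topologicalGroupType}.
Hypothesis scG : @second_countable G.
Local Notation BG := (borel G).
Variable mu : {measure set BG -> \bar R}.
Hypothesis hmu : left_haar mu.
Variable U : set G.
Hypothesis gU : generating_nbhs U.
Local Notation rho := (@rho R G U).

Lemma gaussian_integral_lty (b : R) : 0 < b -> exists2 M : R, 0 <= M &
  (\int[mu]_x (expR (- b * rho x ^+ 2))%:E <= M%:E)%E.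
Proof.
move=> b0.
have [m m0 Hm] := haar_growth scG hmu gU.
have mU : (mu U < +oo)%E := haar_gen_lty hmu gU.
have mUfin : mu U = (fine (mu U))%:E by rewrite fineK // ge0_fin_numE.
have mS n : measurable (setpow U n.+1 : set BG).
  by apply: open_borel; exact: open_setpow.
(* The 2 in the logarithm yields the factor [2^-n] that makes the sum over the balls [U^(n+1)]
   converge: completing the square in [n] gives [e^(-b (n+1)^2) (2 m)^n <= e^(L^2 / (4 b))]. *)
pose L := ln (2 * m%:R : R).
pose C := expR (L ^+ 2 / (4 * b)) * fine (mu U) * 2.
have C0 : 0 <= C by rewrite !mulr_ge0 ?expR_ge0 // fine_ge0.
exists C => //.
pose q (n : nat) : R := expR (- b * n.+1%:R ^+ 2).
have mq n : measurable_fun setT (fun x : BG => (q n * \1_(setpow U n.+1) x)%:E : \bar R).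
  by apply/measurable_EFinP; apply: measurable_funM.
have q0 n (x : BG) : (0 <= (q n * \1_(setpow U n.+1) x)%:E)%E.
  by rewrite lee_fin mulr_ge0 ?expR_ge0.
apply: (@le_trans _ _ (\int[mu]_x \sum_(n <oo) (q n * \1_(setpow U n.+1) x)%:E)%E).
  apply: ge0_le_integral => //.
  - apply/measurable_EFinP; apply: measurableT_comp => //; apply: measurable_funM => //.
    by apply: measurable_funX; exact: measurable_rho.
  - by apply: ge0_emeasurable_sum.
  - move=> x _; have [n [n0 Hn e]] := rho_attained gU (R := R) x.
    case: n n0 Hn e => // n _ Hn e.
    apply: le_trans (nneseries_lim_ge n.+1 _); last by [].
    rewrite big_nat_recr //= indicE mem_set // mulr1 /q e.
    by apply: leeDr; apply: sume_ge0.
rewrite integral_nneseries //.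
apply: (@le_trans _ _ (\sum_(n <oo) (C / (2 ^ n.+1)%:R)%:E)%E); last first.
  by rewrite epsilon_trick0.
apply: lee_nneseries => [n _ _|n _]; first by apply: integral_ge0.
under eq_integral do rewrite EFinM.
rewrite ge0_integralZl //; [|by apply/measurable_EFinP; exact: measurable_indic|by rewrite lee_fin expR_ge0].
rewrite integral_indic // setIT.
apply: (@le_trans _ _ ((q n)%:E * ((m ^ n)%:R%:E * mu U))%E).
  by apply: lee_wpmul2l => //; rewrite lee_fin expR_ge0.
rewrite mUfin -!EFinM lee_fin /C.
have h : q n * (2 * m%:R) ^+ n <= expR (L ^+ 2 / (4 * b)).
  have m2 : 0 < 2 * m%:R :> R by rewrite mulr_gt0 // ltr0n.
  rewrite /q -[2 * _](lnK) ?posrE // -/L -expRM_natl -expRD ler_expR.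
  have : 0 <= (L - 2 * b * n%:R) ^+ 2 / (4 * b).
    by rewrite mulr_ge0 ?sqr_ge0 // invr_ge0; lra.
  have -> : (L - 2 * b * n%:R) ^+ 2 / (4 * b) =
      L ^+ 2 / (4 * b) - n%:R * L + b * n%:R ^+ 2 by field; lra.
  have n0 : 0 <= n%:R :> R by [].
  have : 0 <= b * (2 * n%:R + 1) by rewrite mulr_ge0 //; lra.
  rewrite -[n.+1%:R]natr1; nra.
rewrite natrX natrX [2 ^+ n.+1]exprS.
have p2 : 0 < 2 ^+ n :> R by rewrite exprn_gt0.
have -> : expR (L ^+ 2 / (4 * b)) * fine (mu U) * 2 / (2 * 2 ^+ n) =
   (expR (L ^+ 2 / (4 * b)) / 2 ^+ n) * fine (mu U) by field; lra.
rewrite mulrA ler_wpM2r ?fine_ge0 // ler_pdivlMr //.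
by rewrite -mulrA -exprMn [m%:R * _]mulrC.
Qed.

Variables (K : G -> R) (c b : R).
Hypothesis mK : measurable_fun setT (K : BG -> R).
Hypothesis K0 : forall g, 0 <= K g.
Hypothesis c0 : 0 < c.
Hypothesis b0 : 0 < b.
Hypothesis Kg : forall g, K g <= c * expR (- b * rho g ^+ 2).

(** From [t r - b r^2 <= t^2 / (2 b) - (b / 2) r^2]. The growth in [t] matters as much as the
    finiteness: at [t = l] it is of the form [e^(O(l^2))], which is what large [l] requires. *)
Lemma exponential_moment : exists2 M : R, 0 <= M & forall t : R, 0 <= t ->
  (\int[mu]_x (K x * expR (t * rho x))%:E <= (M * expR (t ^+ 2 / (2 * b)))%:E)%E.
Proof.
have hb := b0.
have b20 : 0 < b / 2 by lra.
have [M M0 HM] := gaussian_integral_lty b20.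
exists (c * M); first by rewrite mulr_ge0 // ltW.
move=> t t0; pose A := c * expR (t ^+ 2 / (2 * b)).
have A0 : 0 <= A by rewrite mulr_ge0 ?expR_ge0 // ltW.
have mr : measurable_fun setT (rho : BG -> R) by exact: measurable_rho.
have mg : measurable_fun setT (fun x : BG => (expR (- (b / 2) * rho x ^+ 2))%:E : \bar R).
  apply/measurable_EFinP; apply: measurableT_comp => //; apply: measurable_funM => //.
  exact: measurable_funX.
apply: (@le_trans _ _ (\int[mu]_x (A%:E * (expR (- (b / 2) * rho x ^+ 2))%:E))%E).
  apply: ge0_le_integral => //.
  - by move=> x _; rewrite lee_fin mulr_ge0 ?expR_ge0.
  - apply/measurable_EFinP; apply: measurable_funM => //; apply: measurableT_comp => //.
    exact: measurable_funM.
  - exact: measurable_funeM.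
  - move=> x _; rewrite -EFinM lee_fin.
    apply: (@le_trans _ _ (c * expR (- b * rho x ^+ 2) * expR (t * rho x))).
      by rewrite ler_pM2r ?expR_gt0.
    rewrite /A -!mulrA ler_pM2l // -!expRD ler_expR.
    have : 0 <= (t - b * rho x) ^+ 2 / (2 * b).
      by rewrite mulr_ge0 ?sqr_ge0 // invr_ge0; lra.
    have -> : (t - b * rho x) ^+ 2 / (2 * b) =
      t ^+ 2 / (2 * b) - t * rho x + (b / 2) * rho x ^+ 2 by field; lra.
    lra.
rewrite ge0_integralZl //.
have -> : c * M * expR (t ^+ 2 / (2 * b)) = A * M by rewrite /A; ring.
by rewrite [leRHS]EFinM; apply: lee_wpmul2l => //; rewrite lee_fin.
Qed.

Lemma real_char_bound (v : G -> R) : real_char v ->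
  exists2 M, 0 <= M & forall g, `|v g| <= M * rho g.
Proof.
move=> [cv vM].
have nO : nbhs 1%g [set x | `|v x| < 1].
  have /cvgrPdist_lt /(_ 1 ltr01) := cv 1%g.
  by apply: filterS => x; rewrite hom1 // sub0r normrN.
have [s Hs] := closure_cover gU nO.
have Hc x : U x -> `|v x| <= \sum_(y <- s) `|v y| + 1.
  move=> /subset_closure /Hs [y ys]; rewrite /= vM homV // => /ltW h.
  have -> : v x = v y + (- v y + v x) by ring.
  apply: le_trans (ler_normD _ _) (lerD _ h).
  by rewrite (big_rem y) //= lerDl sumr_ge0.
exists (\sum_(y <- s) `|v y| + 1); first by rewrite addr_ge0 // sumr_ge0.
move=> g; have [n [_ Hn ->]] := rho_attained gU (R := R) g.
elim: n g Hn => [g ->|n ih g [x Hx [u Uu <-]]]; first by rewrite hom1 // normr0 mulr0.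
rewrite vM -natr1 mulrDr mulr1; apply: le_trans (ler_normD _ _) _.
by apply: lerD; [exact: ih|exact: Hc].
Qed.

Lemma real_char_integrable (v : G -> R) : real_char v ->
  mu.-integrable setT (fun x : BG => (K x * v x)%:E).
Proof.
move=> cv; have [M M0 HM] := real_char_bound cv.
have [M1 M10 HM1] := exponential_moment.
have mv : measurable_fun setT (v : BG -> R).
  by apply: continuous_measurable_real; case: cv.
have mr : measurable_fun setT (rho : BG -> R) by exact: measurable_rho.
apply/integrableP; split; first by apply/measurable_EFinP; exact: measurable_funM.
apply: (@le_lt_trans _ _ (\int[mu]_x (M%:E * (K x * expR (1 * rho x))%:E))%E).
  apply: ge0_le_integral => //.
  - by apply/measurable_EFinP; apply: measurableT_comp => //; exact: measurable_funM.
  - apply: measurable_funeM; apply/measurable_EFinP; apply: measurable_funM => //.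
    by apply: measurableT_comp => //; exact: measurable_funM.
  - move=> x _; rewrite -EFinM /= lee_fin normrM (ger0_norm (K0 x)) mulrCA.
    rewrite ler_wpM2l //; apply: le_trans (HM x) _; rewrite ler_wpM2l // mul1r.
    by have := expR_ge1Dx (rho x); lra.
rewrite ge0_integralZl //; last 2 first.
- apply/measurable_EFinP; apply: measurable_funM => //.
  by apply: measurableT_comp => //; exact: measurable_funM.
- by move=> x _; rewrite lee_fin mulr_ge0 ?expR_ge0.
apply: (@le_lt_trans _ _ (M%:E * (M1 * expR (1 ^+ 2 / (2 * b)))%:E)%E).
  by apply: lee_wpmul2l; [rewrite lee_fin|exact: HM1].
by rewrite -EFinM ltry.
Qed.

Lemma real_char_pi1 (q r : nat) (phi : abelianization_iso R G q r) (i : 'I_q) :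
  real_char (fun g => pi1 phi g ord0 i).
Proof.
split; last by move=> g h; rewrite /pi1 abisoM mxE.
move=> x; apply: (@cvg_comp _ _ _ (fun g => abiso phi (pi0 g))
  (fun z => z.1 ord0 i) _ (nbhs (abiso phi (pi0 x)))).
  apply: (@cvg_comp _ _ _ pi0 (abiso phi)); last exact: abiso_continuous.
  exact: (@pi_continuous _ {eq_quot coset_rel}%qT).
apply: (@cvg_comp _ _ _ fst (fun z : 'rV[R]_q => z ord0 i)); first exact: cvg_fst.
exact: coord_continuous.
Qed.

(** Centering concerns the coordinates of [pi1]; by [real_char_factor] every real character is a
    linear combination of these, and each coordinate is integrable against [K]. *)
Lemma real_char_centered (q r : nat) (phi : abelianization_iso R G q r) (v : G -> R) :
  centered mu phi K -> real_char v -> (\int[mu]_x (K x * v x)%:E = 0)%E.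
Proof.
move=> cK cv; have [a va] := real_char_factor phi cv.
have -> : (fun x : BG => (K x * v x)%:E) =
    (fun x : BG => \sum_(i < q) (a i)%:E * (K x * pi1 phi x ord0 i)%:E)%E.
  apply/funext => x; rewrite va mulr_sumr sumEFin; congr (_%:E).
  by apply: eq_bigr => i _; rewrite mulrCA.
have int i := real_char_integrable (real_char_pi1 phi i).
rewrite integral_sum //; last by move=> i; exact: integrableZl.
by apply: big1 => i _; rewrite integralZl // cK mule0.
Qed.

End Moments.

(** * Displacement *)

Section Neighbourhoods.
Context {G : topologicalGroupType}.

Lemma nbhs_symmetric_split (O : set G) : nbhs 1%g O -> exists V : set G,
  [/\ open V, V 1%g, forall x, V x -> V x^-1%g, V `<=` O
    & forall x y, V x -> V y -> O (x * y)%g].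
Proof.
move=> nO.
have : nbhs (1%g, 1%g) ((fun z : G * G => (z.1 * z.2)%g) @^-1` O).
  by apply: mulg_continuous; rewrite /= mulg1.
move=> [[P Q] /= [nP nQ] PQ].
have oI (A : set G) : open A -> open ((fun x : G => x^-1%g) @^-1` A).
  by move=> oA; apply: open_comp => // x _; exact: invg_continuous.
pose V0 := (P `&` Q `&` O)°.
have nV0 : nbhs 1%g V0.
  by apply: nbhs_interior; apply: filterI => //; exact: filterI.
have V1 : V0 1%g by exact: nbhs_singleton nV0.
have V0s := @interior_subset _ (P `&` Q `&` O).
exists (V0 `&` (fun x => x^-1%g) @^-1` V0); split.
- by apply: openI; [exact: open_interior|apply: oI; exact: open_interior].
- by split; rewrite /= ?invg1.
- by move=> x [h1 h2]; split; rewrite /= ?invgK.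
- by move=> x [/V0s[]].
- by move=> x y [/V0s[[Px _] _] _] [/V0s[[_ Qy] _] _]; exact: (PQ (x, y)).
Qed.

(** The subgroup generated by [V] is open, and it is closed because it contains every [x] for which
    [x V] meets it. Connectedness of [G] enters the proof here only. *)
Lemma connected_setpow (V : set G) : connected [set: G] -> open V -> V 1%g ->
  (forall x, V x -> V x^-1%g) -> forall g, exists n, setpow V n g.
Proof.
move=> cG oV V1 VV; pose H := [set g | exists n, setpow V n g].
have step x v : H x -> V v -> H (x * v)%g.
  by move=> [n Hx] Vv; exists n.+1, x => //; exists v.
have nxV x : nbhs x [set (x * y)%g | y in V].
  by apply: open_nbhs_nbhs; split; [exact: open_mull|exists 1%g; rewrite ?mulg1].
suff HT : H = setT by move=> g; have : H g by rewrite HT.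
apply: cG.
- by exists 1%g, 0%N.
- exists H; last by rewrite setTI.
  rewrite openE => x Hx; apply: filterS (nxV x) => _ [v Vv <-]; exact: step.
- exists H; last by rewrite setTI.
  move=> x /(_ _ (nxV x)) [y [Hy [v Vv e]]].
  by rewrite -(mulgK v x) e; apply: step => //; exact: VV.
Qed.

End Neighbourhoods.

Lemma ge0_le_integralT d (T : measurableType d) (R : realType)
    (mu : {measure set T -> \bar R}) (f g : T -> \bar R) :
  (forall x, 0 <= f x)%E -> (forall x, f x <= g x)%E ->
  measurable_fun setT f -> measurable_fun setT g ->
  (\int[mu]_x f x <= \int[mu]_x g x)%E.
Proof.
move=> f0 fg mf mg; by apply: ge0_le_integral => // x _.
Qed.

Section Displacement.
Context {R : realType} {G : topologicalGroupType}.
Hypothesis scG : @second_countable G.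
Local Notation BG := (borel G).
Variable mu : {sigma_finite_measure set BG -> \bar R}.
Hypothesis hmu : left_haar mu.
Local Open Scope ereal_scope.

Definition disp (f : G -> R) (g : G) : \bar R :=
  \int[mu]_x ((f (g^-1 * x)%g - f x) ^+ 2)%:E.

(** The coercive quantity. For [f] in L^2 the double integral of [K h K k disp f (h^-1 k)] is
    [2 (|f|^2 - |T f|^2)]; this is what remains of it, up to a constant, when [K] is bounded below
    on [W] by a constant and elsewhere by 0. *)
Definition disp_avg (W : set G) (f : G -> R) : \bar R :=
  \int[mu]_h \int[mu]_k (((\1_W h : R) * \1_W k)%:E * disp f (h^-1 * k)%g).

Section Fixed.
Variables (f : G -> R) (N : R).
Hypothesis mf : measurable_fun setT (f : BG -> R).
Hypothesis fN : \int[mu]_x (f x ^+ 2)%:E = N%:E.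

Lemma measurable_shift g : measurable_fun setT (fun x : BG => f (g * x)%g).
Proof. exact: (measurableT_comp (f := f : BG -> R) mf (measurable_mull scG g)). Qed.

Lemma measurable_sq (a : BG -> R) : measurable_fun setT a ->
  measurable_fun setT (fun x => (a x ^+ 2)%:E : \bar R).
Proof. by move=> ma; apply/measurable_EFinP; exact: measurable_funX. Qed.

Lemma shift_norm g : \int[mu]_x (f (g * x)%g ^+ 2)%:E = N%:E.
Proof.
rewrite -fN -(haar_ge0_integral scG hmu g (f := fun x : BG => (f x ^+ 2)%:E)) //.
  exact: measurable_sq.
by move=> x; rewrite lee_fin sqr_ge0.
Qed.

Lemma disp_ge0 g : 0 <= disp f g.
Proof. by apply: integral_ge0 => x _; rewrite lee_fin sqr_ge0. Qed.

Lemma integral_sqD_le (a b : BG -> R) : measurable_fun setT a -> measurable_fun setT b ->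
  \int[mu]_x ((a x + b x) ^+ 2)%:E <=
    2%:E * \int[mu]_x (a x ^+ 2)%:E + 2%:E * \int[mu]_x (b x ^+ 2)%:E.
Proof.
move=> ma mb.
rewrite -!ge0_integralZl //; try exact: measurable_sq;
  try by move=> x _; rewrite lee_fin sqr_ge0.
rewrite -ge0_integralD //; last first.
- by apply: measurable_funeM; exact: measurable_sq.
- by move=> x _; rewrite -EFinM lee_fin mulr_ge0 ?sqr_ge0.
- by apply: measurable_funeM; exact: measurable_sq.
- by move=> x _; rewrite -EFinM lee_fin mulr_ge0 ?sqr_ge0.
apply: ge0_le_integral => //.
- by move=> x _; rewrite lee_fin sqr_ge0.
- by apply: measurable_sq; exact: measurable_funD.
- by apply: emeasurable_funD; apply: measurable_funeM; exact: measurable_sq.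
- move=> x _; rewrite -!EFinM -EFinD lee_fin.
  by have := sqr_ge0 (a x - b x); nra.
Qed.

Lemma disp_le g : disp f g <= (4 * N)%:E.
Proof.
have := integral_sqD_le (measurable_shift g^-1%g) (measurable_funN mf).
rewrite shift_norm; under [X in _ + _ * X]eq_integral do rewrite /= sqrrN.
by rewrite fN -!EFinM -EFinD; congr (_ <= _%:E); lra.
Qed.

Lemma disp_fin g : disp f g = (fine (disp f g))%:E.
Proof.
rewrite fineK // ge0_fin_numE ?disp_ge0 //.
by apply: le_lt_trans (disp_le g) _; rewrite ltry.
Qed.

Lemma disp_shift h k :
  \int[mu]_x ((f (h^-1 * x)%g - f (k^-1 * x)%g) ^+ 2)%:E = disp f (h^-1 * k)%g.
Proof.
rewrite -(haar_ge0_integral scG hmu h (f := fun x : BG =>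
  ((f (h^-1 * x)%g - f (k^-1 * x)%g) ^+ 2)%:E)).
- apply: eq_integral => x _; rewrite mulKg invgM invgK mulgA.
  by rewrite -sqrrN opprB.
- by apply: measurable_sq; apply: measurable_funB; exact: measurable_shift.
- by move=> x; rewrite lee_fin sqr_ge0.
Qed.

Lemma disp_inv g : disp f g^-1%g = disp f g.
Proof.
rewrite -[g^-1%g]mulg1 -disp_shift /disp.
by apply: eq_integral => x _; rewrite invg1 mul1g.
Qed.

Lemma disp_mul g h : disp f (g * h)%g <= 2%:E * disp f g + 2%:E * disp f h.
Proof.
have -> : disp f h = \int[mu]_x ((f ((g * h)^-1 * x)%g - f (g^-1 * x)%g) ^+ 2)%:E.
  by rewrite disp_shift invgM mulgVK disp_inv.
rewrite addeC; apply: le_trans (integral_sqD_le _ _).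
- by rewrite le_eqVlt; apply/orP; left; apply/eqP; apply: eq_integral => x _; rewrite subrKA.
- by apply: measurable_funB; exact: measurable_shift.
- by apply: measurable_funB => //; exact: measurable_shift.
Qed.

Lemma measurable_disp : measurable_fun setT (disp f : BG -> \bar R).
Proof.
apply: (@measurable_fun_fubini_tonelli_F _ _ BG BG R mu
  (fun z => ((f (z.1^-1 * z.2)%g - f z.2) ^+ 2)%:E)) => [|x].
  apply/measurable_EFinP; apply: measurable_funX; apply: measurable_funB.
    apply: (measurableT_comp (f := f : BG -> R) mf).
    by apply: measurable_mulg2 => //; apply: measurable_invg1.
  exact: (measurableT_comp (f := f : BG -> R) mf).
by rewrite lee_fin sqr_ge0.
Qed.

Lemma measurable_indicM_disp (W : set G) g : measurable (W : set BG) ->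
  measurable_fun setT (fun k : BG => (\1_W k)%:E * disp f (g * k)%g).
Proof.
move=> mW; apply: emeasurable_funM.
  by apply/measurable_EFinP; exact: measurable_indic.
exact: (measurableT_comp measurable_disp (measurable_mull scG g)).
Qed.

Lemma disp_avg_fin (W : set G) : open W -> mu W < +oo ->
  disp_avg W f = (fine (disp_avg W f))%:E /\ (0 <= fine (disp_avg W f))%R.
Proof.
move=> oW Woo; have mW := open_borel oW.
have N0 : (0 <= N)%R.
  by rewrite -lee_fin -fN; apply: integral_ge0 => x _; rewrite lee_fin sqr_ge0.
have i0 (x : BG) : (0 <= \1_W x :> R)%R by rewrite indicE.
have a0 : 0 <= disp_avg W f.
  apply: integral_ge0 => h _; apply: integral_ge0 => k _.
  by rewrite mule_ge0 ?disp_ge0 // lee_fin mulr_ge0.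
split; last by rewrite fine_ge0.
rewrite fineK // ge0_fin_numE //.
have Wfin : \int[mu]_x (\1_W x)%:E = (fine (mu W))%:E.
  by rewrite integral_indic // setIT fineK // ge0_fin_numE.
apply: (@le_lt_trans _ _ (\int[mu]_h (((4 * N) * fine (mu W))%:E * (\1_W h)%:E))).
  apply: ge0_le_integral => //.
  - move=> h _; apply: integral_ge0 => k _.
    by rewrite mule_ge0 ?disp_ge0 // lee_fin mulr_ge0.
  - apply: (@measurable_fun_fubini_tonelli_F _ _ BG BG R mu
      (fun z => ((\1_W z.1 : R) * \1_W z.2)%:E * disp f (z.1^-1 * z.2)%g)) => [|z].
      apply: emeasurable_funM.
        apply/measurable_EFinP; apply: measurable_funM.
          by apply: (measurableT_comp (f := \1_W : BG -> R)) => //; exact: measurable_indic.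
        by apply: (measurableT_comp (f := \1_W : BG -> R)) => //; exact: measurable_indic.
      apply: (measurableT_comp measurable_disp).
      by apply: measurable_mulg2 => //; apply: measurable_invg1.
    by rewrite mule_ge0 ?disp_ge0 // lee_fin mulr_ge0.
  - by apply: measurable_funeM; apply/measurable_EFinP; exact: measurable_indic.
  move=> h _; apply: (@le_trans _ _ (\int[mu]_k ((4 * N * \1_W h)%:E * (\1_W k)%:E))).
    apply: ge0_le_integral => //.
    - by move=> k _; rewrite mule_ge0 ?disp_ge0 // lee_fin mulr_ge0.
    - under eq_fun do rewrite EFinM -muleA.
      by apply: measurable_funeM; exact: measurable_indicM_disp.
    - by apply: measurable_funeM; apply/measurable_EFinP; exact: measurable_indic.
    - move=> k _; rewrite [leRHS](_ : _ = ((\1_W h : R) * \1_W k)%:E * (4 * N)%:E).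
        by apply: lee_wpmul2l; [rewrite lee_fin mulr_ge0|exact: disp_le].
      by rewrite -!EFinM; congr (_%:E); ring.
  rewrite ge0_integralZl //;
    [|by apply/measurable_EFinP; exact: measurable_indic|by rewrite lee_fin !mulr_ge0].
  rewrite Wfin -!EFinM lee_fin.
  by rewrite le_eqVlt; apply/orP; left; apply/eqP; ring.
rewrite ge0_integralZl //; [|by apply/measurable_EFinP; exact: measurable_indic
  |by rewrite lee_fin !mulr_ge0 // fine_ge0].
by rewrite Wfin -!EFinM ltry.
Qed.

(** For [k] in [V2], [disp f u] is at most [2 disp f k + 2 disp f (u^-1 k)], where both arguments
    lie in [V1]; averaging over [k] bounds [mu V2 * disp f u] by 4 times the integral of [disp f]
    over [V1]. For each [h] in [V1] that integral is at most the one of [disp f (h^-1 k)] over [k]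
    in [W], since [h V1] lies in [W]. *)
Lemma disp_le_avg (W V1 V2 : set G) u : open W -> mu W < +oo ->
  open V1 -> open V2 -> V1 `<=` W -> V2 `<=` V1 ->
  (forall x y, V1 x -> V1 y -> W (x * y)%g) ->
  (forall x y, V2 x -> V2 y -> V1 (x^-1 * y)%g) -> V2 u ->
  mu V1 * (mu V2 * disp f u) <= 4%:E * disp_avg W f.
Proof.
move=> oW Woo oV1 oV2 V1W V21 V11 V22 Vu.
have [mW mV1 mV2] := And3 (open_borel oW) (open_borel oV1) (open_borel oV2).
have i0 (A : set G) (x : BG) : (0 <= \1_A x :> R)%R by rewrite indicE.
have d0 (A : set G) g (k : BG) : 0 <= (\1_A k)%:E * disp f (g * k)%g.
  by rewrite mule_ge0 ?disp_ge0 // lee_fin.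
have md (A : set G) g : open A ->
  measurable_fun setT (fun k : BG => (\1_A k)%:E * disp f (g * k)%g).
  by move=> oA; apply: measurable_indicM_disp; exact: open_borel.
pose S := \int[mu]_k ((\1_V1 k)%:E * disp f (1 * k)%g).
have S0 : 0 <= S by apply: integral_ge0.
have indle (A B : set G) (x y : BG) : (A x -> B y) -> (\1_A x <= \1_B y :> R)%R.
  move=> AB; rewrite !indicE; case: (asboolP (A x)) => [Ax|nAx].
    by rewrite !mem_set //; exact: AB.
  by rewrite (memNset nAx).
have hS : mu V2 * disp f u <= 4%:E * S.
  have -> : mu V2 * disp f u = \int[mu]_k ((\1_V2 k)%:E * disp f u).
    rewrite disp_fin ge0_integralZr //.
    - by rewrite integral_indic // setIT.
    - by apply/measurable_EFinP; exact: measurable_indic.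
    - by rewrite -disp_fin disp_ge0.
  apply: (@le_trans _ _ (\int[mu]_k (2%:E * ((\1_V2 k)%:E * disp f (1 * k)%g) +
      2%:E * ((\1_V2 k)%:E * disp f (u^-1 * k)%g)))).
    apply: ge0_le_integral => //.
    - by move=> k _; rewrite mule_ge0 ?disp_ge0 // lee_fin.
    - rewrite disp_fin; apply: emeasurable_funM => //.
      by apply/measurable_EFinP; exact: measurable_indic.
    - by apply: emeasurable_funD; apply: measurable_funeM; exact: md.
    move=> k _; rewrite !(muleCA 2%:E) -ge0_muleDr ?mule_ge0 ?disp_ge0 //.
    apply: lee_wpmul2l; first by rewrite lee_fin.
    rewrite mul1g -(disp_inv (u^-1 * k)%g).
    have {1}-> : u = (k * (u^-1 * k)^-1)%g by rewrite invgM invgK mulVKg.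
    exact: disp_mul.
  rewrite ge0_integralD //; last first.
  - by apply: measurable_funeM; exact: (md V2 u^-1%g).
  - by move=> k _; rewrite mule_ge0.
  - by apply: measurable_funeM; exact: (md V2 1%g).
  - by move=> k _; rewrite mule_ge0.
  rewrite (ge0_integralZl _ measurableT (md V2 1%g oV2)) //.
  rewrite (ge0_integralZl _ measurableT (md V2 u^-1%g oV2)) //.
  have -> : 4%:E * S = 2%:E * S + 2%:E * S.
    by rewrite -ge0_muleDl // -EFinD; congr (_%:E * _); ring.
  have h1 : \int[mu]_k ((\1_V2 k)%:E * disp f (1 * k)%g) <= S.
    apply: ge0_le_integralT => [k|k||]; [exact: d0| |exact: (md V2 1%g)|exact: (md V1 1%g)].
    apply: lee_wpmul2r; first exact: disp_ge0.
    by rewrite lee_fin; apply: indle; exact: V21.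
  have h2 : \int[mu]_k ((\1_V2 k)%:E * disp f (u^-1 * k)%g) <= S.
    rewrite -(haar_ge0_integral scG hmu u (md V2 u^-1%g oV2) (d0 V2 u^-1%g)).
    apply: ge0_le_integralT => [k|k||]; [exact: (d0 V2 u^-1%g (u * k)%g)| | |].
    - rewrite mulKg mul1g; apply: lee_wpmul2r; first exact: disp_ge0.
      rewrite lee_fin; apply: indle => Vuk; rewrite -(mulKg u k); exact: V22.
    - exact: (measurableT_comp (md V2 u^-1%g oV2) (measurable_mull scG u)).
    - exact: (md V1 1%g).
  have two0 : 0 <= 2%:E :> \bar R by rewrite lee_fin.
  by apply: leeD; [exact: (lee_wpmul2l two0 h1)|exact: (lee_wpmul2l two0 h2)].
have hA : mu V1 * S <= disp_avg W f.
  have mI : measurable_fun setT (fun h : BG => (\1_V1 h)%:E : \bar R).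
    by apply/measurable_EFinP; exact: measurable_indic.
  have -> : mu V1 * S = \int[mu]_h (S * (\1_V1 h)%:E).
    by rewrite ge0_integralZl // ?integral_indic ?setIT // muleC.
  rewrite /disp_avg; apply: ge0_le_integralT; last 2 first.
  - exact: emeasurable_funM.
  - apply: (@measurable_fun_fubini_tonelli_F _ _ BG BG R mu
      (fun z => ((\1_W z.1 : R) * \1_W z.2)%:E * disp f (z.1^-1 * z.2)%g)) => [|z].
      apply: emeasurable_funM.
        apply/measurable_EFinP; apply: measurable_funM.
          by apply: (measurableT_comp (f := \1_W : BG -> R)) => //; exact: measurable_indic.
        by apply: (measurableT_comp (f := \1_W : BG -> R)) => //; exact: measurable_indic.
      apply: (measurableT_comp measurable_disp).
      by apply: measurable_mulg2 => //; apply: measurable_invg1.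
    by rewrite mule_ge0 ?disp_ge0 // lee_fin mulr_ge0.
  - by move=> h; rewrite mule_ge0 // lee_fin.
  move=> h; rewrite [\1_V1 h]indicE; case: (asboolP (V1 h)) => [Vh|nVh]; last first.
    rewrite (memNset nVh) mule0; apply: integral_ge0 => k _.
    by rewrite mule_ge0 ?disp_ge0 // lee_fin mulr_ge0.
  rewrite (mem_set Vh) mule1.
  have -> : \int[mu]_k (((\1_W h : R) * \1_W k)%:E * disp f (h^-1 * k)%g) =
      \int[mu]_k ((\1_W k)%:E * disp f (h^-1 * k)%g).
    by apply: eq_integral => k _; rewrite [\1_W h]indicE (mem_set (V1W _ Vh)) mul1r.
  rewrite -(haar_ge0_integral scG hmu h (md W h^-1%g oW) (d0 W h^-1%g)).
  apply: ge0_le_integralT => [k|k||]; [exact: d0| |exact: (md V1 1%g)|].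
  - rewrite mulKg mul1g; apply: lee_wpmul2r; first exact: disp_ge0.
    by rewrite lee_fin; apply: indle => Vk; exact: V11.
  - exact: (measurableT_comp (md W h^-1%g oW) (measurable_mull scG h)).
apply: (@le_trans _ _ (mu V1 * (4%:E * S))); first exact: lee_wpmul2l.
by rewrite muleCA; apply: lee_wpmul2l.
Qed.

End Fixed.

Local Open Scope ring_scope.

(** Each letter costs the factor 2 of [disp_mul], so the bound is exponential in the word length; as
    [4 <= e^3], the rate 3 covers both the doubling and the contribution of the new letter. *)
Lemma disp_bounds (U W : set G) : connected [set: G] -> generating_nbhs U ->
  open W -> W 1%g -> (mu W < +oo)%E ->
  exists2 C : R, 0 <= C & forall (f : G -> R) (N : R),
    measurable_fun setT (f : BG -> R) -> (\int[mu]_x (f x ^+ 2)%:E = N%:E)%E ->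
    forall g, fine (disp f g) <= C * expR (3 * rho U g) * fine (disp_avg W f).
Proof.
move=> cG gU oW W1 Woo.
have nW : nbhs 1%g W by exact: open_nbhs_nbhs.
have [V1 [oV1 V11 _ V1W V1M]] := nbhs_symmetric_split nW.
have nV1 : nbhs 1%g V1 by exact: open_nbhs_nbhs.
have [V2 [oV2 V21 V2V V2V1 V2M]] := nbhs_symmetric_split nV1.
have nV2 : nbhs 1%g V2 by exact: open_nbhs_nbhs.
have m1 := haar_open_gt0 scG hmu gU nV1 oV1.
have m2 := haar_open_gt0 scG hmu gU nV2 oV2.
have fin (V : set G) : open V -> V `<=` W -> (mu V)%E = (fine (mu V))%:E.
  move=> oV VW; rewrite fineK // ge0_fin_numE //; apply: le_lt_trans Woo.
  by apply: le_measure => //; apply: mem_set; exact: open_borel.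
have f1 := fin V1 oV1 V1W; have f2 := fin V2 oV2 (subset_trans V2V1 V1W).
have {}m1 : 0 < fine (mu V1) by rewrite -lte_fin -f1.
have {}m2 : 0 < fine (mu V2) by rewrite -lte_fin -f2.
set a1 := fine (mu V1) in f1 m1; set a2 := fine (mu V2) in f2 m2.
pose C2 := 4 / (a1 * a2).
have C20 : 0 <= C2 by rewrite mulr_ge0 // invr_ge0 mulr_ge0 // ltW.
have local f N (mf : measurable_fun setT (f : BG -> R))
    (fN : (\int[mu]_x (f x ^+ 2)%:E = N%:E)%E) u : V2 u ->
    fine (disp f u) <= C2 * fine (disp_avg W f).
  move=> Vu.
  have := disp_le_avg mf fN oW Woo oV1 oV2 V1W V2V1 V1M
    (fun x y Vx Vy => V2M _ _ (V2V _ Vx) Vy) Vu.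
  rewrite f1 f2 [disp f u](disp_fin mf fN) [disp_avg W f](disp_avg_fin mf fN oW Woo).1.
  rewrite -!EFinM lee_fin => h.
  have p12 : 0 < a1 * a2 by exact: mulr_gt0.
  rewrite /C2 mulrAC ler_pdivlMr //; apply: le_trans h.
  by rewrite le_eqVlt; apply/orP; left; apply/eqP; ring.
have mul f N (mf : measurable_fun setT (f : BG -> R))
    (fN : (\int[mu]_x (f x ^+ 2)%:E = N%:E)%E) g h :
    fine (disp f (g * h)%g) <= 2 * fine (disp f g) + 2 * fine (disp f h).
  rewrite -lee_fin EFinD !EFinM -!(disp_fin mf fN).
  exact: disp_mul.
(* The number of letters from [V2] that make up [g] is not controlled, so this constant depends on
   [g]; a finite cover of [U] by translates of [V2] then gives a constant uniform on [U]. *)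
have pt g : exists2 Cg : R, 0 <= Cg & forall (f : G -> R) (N : R),
    measurable_fun setT (f : BG -> R) -> (\int[mu]_x (f x ^+ 2)%:E = N%:E)%E ->
    fine (disp f g) <= Cg * fine (disp_avg W f).
  have [n] := connected_setpow cG oV2 V21 V2V g.
  elim: n g => [g ->|n ih g [x /ih [C C0 HC] [v Vv <-]]].
    by exists C2 => // f N mf fN; apply: (local f N).
  exists (2 * C + 2 * C2) => [|f N mf fN]; first by rewrite addr_ge0 // mulr_ge0.
  apply: le_trans (mul f N mf fN x v) _.
  by have := HC f N mf fN; have := local f N mf fN v Vv; lra.
have /choice [Cf HCf] : forall g, exists c : R, 0 <= c /\ forall (f : G -> R) (N : R),
    measurable_fun setT (f : BG -> R) -> (\int[mu]_x (f x ^+ 2)%:E = N%:E)%E ->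
    fine (disp f g) <= c * fine (disp_avg W f).
  by move=> g; have [C C0 HC] := pt g; exists C.
have [s Hs] := closure_cover gU nV2.
pose C := 2 * \sum_(y <- s) Cf y + 2 * C2.
have C0 : 0 <= C.
  by rewrite addr_ge0 // mulr_ge0 // sumr_ge0 // => y _; exact: (HCf y).1.
have onU f N (mf : measurable_fun setT (f : BG -> R))
    (fN : (\int[mu]_x (f x ^+ 2)%:E = N%:E)%E) u : U u ->
    fine (disp f u) <= C * fine (disp_avg W f).
  move=> /subset_closure /Hs [y ys Vy].
  have Q0 := (disp_avg_fin mf fN oW Woo).2.
  have h : Cf y <= \sum_(y <- s) Cf y.
    by rewrite (big_rem y) //= lerDl sumr_ge0 // => z _; exact: (HCf z).1.
  have := mul f N mf fN y (y^-1 * u)%g; rewrite mulVKg => /le_trans; apply.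
  have := (HCf y).2 f N mf fN; have := local f N mf fN _ Vy.
  have := ler_wpM2r Q0 h; rewrite /C; lra.
exists C => // f N mf fN g.
have Q0 := (disp_avg_fin mf fN oW Woo).2.
have CQ : 0 <= C * fine (disp_avg W f) by exact: mulr_ge0.
have [n [n0 Hn ->]] := rho_attained gU (R := R) g.
have e1 x : 0 <= x -> 1 <= expR x :> R by exact: one_le_expR.
case: n n0 Hn => // n _; elim: n g => [|n ih] g.
  move=> [x -> [u Uu <-]]; rewrite mul1g (le_trans (onU f N mf fN u Uu)) //.
  by rewrite mulrAC ler_peMr // e1 //; lra.
move=> [x Hx [u Uu <-]].
have := mul f N mf fN x u; have := onU f N mf fN u Uu; have := ih x Hx.
have -> : 3 * n.+2%:R = 3 * n.+1%:R + 3 :> R by rewrite -[n.+2%:R]natr1; ring.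
rewrite expRD.
have : 1 <= expR (3 * n.+1%:R) :> R by apply: one_le_expR; exact: mulr_ge0.
have := @expR_ge1Dx R 3.
move: (expR (3 * n.+1%:R)) (expR 3) => a b b3 a1'.
have -> : C * (a * b) * fine (disp_avg W f) = C * fine (disp_avg W f) * (a * b) by ring.
have -> : C * a * fine (disp_avg W f) = C * fine (disp_avg W f) * a by ring.
move: (C * fine (disp_avg W f)) CQ => q q0 h1 h2 h3.
have p1 : 0 <= q * (a * (b - 4)) by rewrite !mulr_ge0 //; lra.
have p2 : 0 <= q * (a - 1) by rewrite mulr_ge0 //; lra.
lra.
Qed.

End Displacement.

(** * The weighted L^2 inequality *)

(** From [e^y - 1 - y <= y^2 max(1, e^y)] and [s <= e^s]. The remainder is of order [l^2], at the
    price of an exponential in [s] that the moments of [K] absorb. *)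
Lemma expR_le_quadratic (R : realType) (y l s : R) : 0 <= l -> l <= 1 -> 0 <= s ->
  `|y| <= l * s -> expR y <= 1 + y + l ^+ 2 * expR (3 * s).
Proof.
move=> l0 l1 s0 hy.
have ls : l * s <= s by rewrite ler_piMl.
have e1 : expR y - 1 <= y * expR y.
  have := @expR_ge1Dx R (- y); rewrite -(ler_pM2r (expR_gt0 y)) -expRD addNr expR0.
  by lra.
have y2 : y ^+ 2 <= l ^+ 2 * expR s ^+ 2.
  have ss : s <= expR s by have := expR_ge1Dx s; lra.
  rewrite -exprMn -(real_normK (num_real y)); apply: lerXn2r; rewrite ?nnegrE //.
    by rewrite mulr_ge0 ?expR_ge0.
  by apply: le_trans hy _; rewrite ler_wpM2l.
have -> : 3 * s = s + (s + s) by ring.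
rewrite !expRD; have := expR_ge0 s.
have es : 1 <= expR s by exact: one_le_expR.
have [y0|y0] := leP 0 y.
  have eys : expR y <= expR s by rewrite ler_expR; apply: le_trans ls; rewrite -(ger0_norm y0).
  have h1 : y * (expR y - 1) <= y * (y * expR y) by rewrite ler_wpM2l.
  have h2 : y ^+ 2 * expR y <= (l ^+ 2 * expR s ^+ 2) * expR s.
    by rewrite ler_pM ?sqr_ge0 ?expR_ge0.
  by lra.
have h1 : y * (expR y - 1) <= y * y.
  by rewrite ler_wnM2l ?(ltW y0) //; have := expR_ge1Dx y; lra.
have h2 : l ^+ 2 * expR s ^+ 2 * 1 <= l ^+ 2 * expR s ^+ 2 * expR s.
  by rewrite ler_wpM2l // mulr_ge0 ?sqr_ge0.
by lra.
Qed.

(** Factor [a^2 - b^2 = (a - b) (a + b)] and apply the weighted arithmetic-geometric inequality. The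
    weight [e] stays free: [a - b] will be a displacement, to be absorbed, and the other term
    carries [l^2]. *)
Lemma sqr_diff_le (R : realType) (d a b l e r : R) : 0 <= l -> 0 < e -> 0 <= r ->
  `|d| <= l * r ->
  `|d * (a ^+ 2 - b ^+ 2)| <=
    r * (e / 2 * (a - b) ^+ 2 + l ^+ 2 / e * (a ^+ 2 + b ^+ 2)).
Proof.
move=> l0 e0 r0 hd.
have p : 0 < e^-1 by rewrite invr_gt0.
have ne : e != 0 by rewrite gt_eqF.
have h t : `|t| <= l -> t * (a - b) * (a + b) <=
    e / 2 * (a - b) ^+ 2 + l ^+ 2 / e * (a ^+ 2 + b ^+ 2).
  move=> ht.
  have h1 : t ^+ 2 <= l ^+ 2.
    by rewrite -(real_normK (num_real t)); apply: lerXn2r; rewrite ?nnegrE.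
  have h2 : 0 <= (e * (a - b) - t * (a + b)) ^+ 2 / (2 * e).
    by rewrite mulr_ge0 ?sqr_ge0 // invr_ge0 mulr_ge0 // ltW.
  have h3 : (e * (a - b) - t * (a + b)) ^+ 2 / (2 * e) =
    e / 2 * (a - b) ^+ 2 - t * (a - b) * (a + b) + t ^+ 2 / 2 * (a + b) ^+ 2 / e.
    by field.
  have h4 : t ^+ 2 / 2 * (a + b) ^+ 2 / e <= l ^+ 2 / 2 * (a + b) ^+ 2 / e.
    by rewrite ler_pM2r // ler_wpM2r ?sqr_ge0 // ler_pM2r.
  have h5 := mulr_ge0 (mulr_ge0 (sqr_ge0 l) (ltW p)) (sqr_ge0 (a - b)).
  have h6 : l ^+ 2 / 2 * (a + b) ^+ 2 / e + l ^+ 2 / e * (a - b) ^+ 2 / 2 =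
    l ^+ 2 / e * (a ^+ 2 + b ^+ 2) by field.
  by lra.
have [r00|rn] := eqVneq r 0.
  by move: hd; rewrite r00 mulr0 normr_le0 => /eqP->; rewrite !mul0r normr0.
have rp : 0 < r by rewrite lt_def rn.
have ht s : `|s| = `|d| -> `|s / r| <= l.
  by move=> es; rewrite normrM es normfV (ger0_norm r0) ler_pdivrMr.
have sc s : `|s| = `|d| -> s * (a ^+ 2 - b ^+ 2) <=
    r * (e / 2 * (a - b) ^+ 2 + l ^+ 2 / e * (a ^+ 2 + b ^+ 2)).
  move=> es; have := h _ (ht s es); rewrite -(ler_pM2l rp) => /(le_trans _); apply.
  by rewrite le_eqVlt; apply/orP; left; apply/eqP; field.
rewrite ler_norml sc // andbT lerNl -mulNr; apply: sc; exact: normrN.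
Qed.

Section HasIntegral.
Context {d : measure_display} {T : measurableType d} {R : realType}.
Variable mu : {measure set T -> \bar R}.

(** Integrability and value are kept together, so that linear identities between signed integrals
    compose without side conditions. *)
Definition has_integral (F : T -> R) (r : R) : Prop :=
  mu.-integrable setT (EFin \o F) /\ (\int[mu]_x (F x)%:E = r%:E)%E.

Lemma has_integralD F1 F2 r1 r2 : has_integral F1 r1 -> has_integral F2 r2 ->
  has_integral (fun x => F1 x + F2 x) (r1 + r2).
Proof.
move=> [i1 e1] [i2 e2]; split; first exact: (integrableD measurableT i1 i2).
by under eq_integral do rewrite EFinD; rewrite integralD // e1 e2.
Qed.

Lemma has_integralZ F r a : has_integral F r -> has_integral (fun x => a * F x) (a * r).
Proof.
move=> [i1 e1]; split; first exact: (integrableZl measurableT a i1).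
by under eq_integral do rewrite EFinM; rewrite integralZl // e1.
Qed.

Lemma has_integral_le F1 F2 r1 r2 : has_integral F1 r1 -> has_integral F2 r2 ->
  (forall x, F1 x <= F2 x) -> r1 <= r2.
Proof.
move=> [i1 e1] [i2 e2] le; rewrite -lee_fin -e1 -e2.
by apply: le_integral => // x _; rewrite lee_fin.
Qed.

Lemma has_integral_ge0 (F : T -> R) r : measurable_fun setT F -> (forall x, 0 <= F x) ->
  (\int[mu]_x (F x)%:E = r%:E)%E -> has_integral F r.
Proof.
move=> mF F0 e; split=> //; apply/integrableP; split; first exact/measurable_EFinP.
under eq_integral do rewrite /= ger0_norm //.
by rewrite e ltry.
Qed.

Lemma has_integral_bounded (F a : T -> R) (r M : R) : measurable_fun setT a ->
  has_integral F r -> (forall x, `|a x| <= M) ->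
  exists s, has_integral (fun x => a x * F x) s.
Proof.
move=> ma [iF _] aM.
have i : mu.-integrable setT (EFin \o (fun x => a x * F x)).
  have mF : measurable_fun setT F by apply/measurable_EFinP; case/integrableP: iF.
  apply: (@le_integrable _ _ _ mu setT measurableT _ (fun x => M%:E * (F x)%:E)%E) => //.
  - by apply/measurable_EFinP; exact: measurable_funM.
  - move=> x _; rewrite -EFinM /= lee_fin !normrM ler_wpM2r //.
    exact: le_trans (ler_norm M).
  - exact: integrableZl.
exists (fine (\int[mu]_x (a x * F x)%:E)%E); split=> //.
by rewrite fineK //; exact: integrable_fin_num.
Qed.

Lemma eq_has_integral F1 F2 r : (forall x, F1 x = F2 x) -> has_integral F1 r -> has_integral F2 r.
Proof. by move=> /funext ->. Qed.

End HasIntegral.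

(** * The bound for a fixed pair of translations [h], [k] *)

Section PairBound.
Context {R : realType} {G : topologicalGroupType}.
Hypothesis scG : @second_countable G.
Local Notation BG := (borel G).
Variable mu : {sigma_finite_measure set BG -> \bar R}.
Hypothesis hmu : left_haar mu.
Variable U : set G.
Hypothesis gU : generating_nbhs U.
Local Notation rho := (@rho R G U).

Lemma has_integral_shift g (F : BG -> R) r : has_integral mu F r ->
  has_integral mu (fun x => F (g * x)%g) r.
Proof.
move=> [iF e]; split; first exact: (haar_integrable scG hmu g iF).
rewrite -e; apply: (haar_integral scG hmu g (f := EFin \o F)).
by case/integrableP: iF.
Qed.

Variables (eta f : G -> R) (l M N : R).
Hypothesis meta : measurable_fun setT (eta : BG -> R).
Hypothesis etaL : forall h x, `|eta (h * x)%g - eta x| <= l * rho h.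
Hypothesis etaM : forall x, `|eta x| <= M.
Hypothesis l0 : 0 < l.
Hypothesis mf : measurable_fun setT (f : BG -> R).
Hypothesis f0 : forall x, 0 <= f x.
Hypothesis fN : (\int[mu]_x (f x ^+ 2)%:E = N%:E)%E.

(** What is left of the weight [e^(2 eta)] when [u = e^(-eta) f] is substituted in the product of
    the translates of [u] by [h] and by [k]. *)
Definition tilt h k x := expR (2 * eta x - eta (h^-1 * x)%g - eta (k^-1 * x)%g).

Let i2 : has_integral mu (fun x : BG => f x ^+ 2) N.
Proof.
by apply: has_integral_ge0 => // [|x]; [exact: measurable_funX|exact: sqr_ge0].
Qed.

Let me g : measurable_fun setT (fun x : BG => eta (g * x)%g).
Proof. exact: measurable_shift. Qed.

Let mfs g : measurable_fun setT (fun x : BG => f (g * x)%g).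
Proof. exact: measurable_shift. Qed.

Let mtilt h k : measurable_fun setT (tilt h k : BG -> R).
Proof.
apply: measurableT_comp => //; apply: measurable_funB => //.
by apply: measurable_funB => //; exact: measurable_funM.
Qed.

Lemma tilt_bound h k x : `|2 * eta (h * x)%g - eta x - eta ((k^-1 * h) * x)%g| <=
  l * (rho h + rho k).
Proof.
have -> : 2 * eta (h * x)%g - eta x - eta (k^-1 * h * x)%g =
  (eta (h * x)%g - eta x) - (eta (k^-1 * (h * x))%g - eta (h * x)%g).
  by rewrite mulgA; ring.
apply: le_trans (ler_normB _ _) _; rewrite mulrDr; apply: lerD; first exact: etaL.
by rewrite -(rhoV gU (R := R) k); exact: etaL.
Qed.

Lemma tilt_ge h k x : expR (- (l * (rho h + rho k))) <= tilt h k x.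
Proof.
rewrite ler_expR; have := tilt_bound h k (h^-1 * x)%g.
by rewrite mulVKg -mulgA mulVKg ler_norml => /andP[].
Qed.

Lemma tilted_norm h k : (\int[mu]_x (tilt h k x * f (h^-1 * x)%g ^+ 2)%:E =
  \int[mu]_x (expR (2 * eta (h * x)%g - eta x - eta ((k^-1 * h) * x)%g) * f x ^+ 2)%:E)%E.
Proof.
rewrite -(haar_ge0_integral scG hmu h (f := fun x : BG =>
  (tilt h k x * f (h^-1 * x)%g ^+ 2)%:E)).
- by apply: eq_integral => x _; rewrite /tilt !mulKg mulgA.
- by apply/measurable_EFinP; apply: measurable_funM => //; exact: measurable_funX.
- by move=> x; rewrite lee_fin mulr_ge0 ?expR_ge0 ?sqr_ge0.
Qed.

Lemma tilt_sym h k x : tilt h k x = tilt k h x.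
Proof. by rewrite /tilt addrAC. Qed.

(* 2 a b = a^2 + b^2 - (a - b)^2: the last term is the coercivity that absorbs
   the first order terms in the tilt. *)
Lemma pair_polarization h k :
  (2%:E * \int[mu]_x (tilt h k x * (f (h^-1 * x)%g * f (k^-1 * x)%g))%:E +
   (expR (- (l * (rho h + rho k))))%:E * disp mu f (h^-1 * k)%g <=
   \int[mu]_x (tilt h k x * f (h^-1 * x)%g ^+ 2)%:E +
   \int[mu]_x (tilt k h x * f (k^-1 * x)%g ^+ 2)%:E)%E.
Proof.
rewrite -(disp_shift scG hmu mf).
have m1 : measurable_fun setT
    (fun x : BG => (tilt h k x * (f (h^-1 * x)%g * f (k^-1 * x)%g))%:E : \bar R).
  by apply/measurable_EFinP; apply: measurable_funM => //; exact: measurable_funM.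
have m2 : measurable_fun setT
    (fun x : BG => ((f (h^-1 * x)%g - f (k^-1 * x)%g) ^+ 2)%:E : \bar R).
  by apply/measurable_EFinP; apply: measurable_funX; exact: measurable_funB.
have m3 h' k' : measurable_fun setT
    (fun x : BG => (tilt h' k' x * f (h'^-1 * x)%g ^+ 2)%:E : \bar R).
  by apply/measurable_EFinP; apply: measurable_funM => //; exact: measurable_funX.
have p1 x : (0 <= (tilt h k x * (f (h^-1 * x)%g * f (k^-1 * x)%g))%:E)%E.
  by rewrite lee_fin !mulr_ge0 ?expR_ge0.
have p2 (x : BG) : (0 <= ((f (h^-1 * x)%g - f (k^-1 * x)%g) ^+ 2)%:E)%E.
  by rewrite lee_fin sqr_ge0.
have p3 h' k' (x : BG) : (0 <= (tilt h' k' x * f (h'^-1 * x)%g ^+ 2)%:E)%E.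
  by rewrite lee_fin mulr_ge0 ?expR_ge0 ?sqr_ge0.
have e0 : 0 <= expR (- (l * (rho h + rho k))) by exact: expR_ge0.
rewrite -(ge0_integralZl _ measurableT m1) // -(ge0_integralZl _ measurableT m2) //.
rewrite -(ge0_integralD _ measurableT _ (measurable_funeM _ m1) _ (measurable_funeM _ m2));
  [|by move=> x _; rewrite mule_ge0|by move=> x _; rewrite mule_ge0 // lee_fin].
rewrite -(ge0_integralD _ measurableT _ (m3 h k) _ (m3 k h)) //.
apply: ge0_le_integralT => [x|x||].
- by rewrite adde_ge0 // mule_ge0 // lee_fin.
- rewrite -!EFinM -!EFinD lee_fin (tilt_sym k h).
  have := ler_wpM2r (sqr_ge0 (f (h^-1 * x)%g - f (k^-1 * x)%g)) (tilt_ge h k x).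
  by lra.
- by apply: emeasurable_funD; exact: measurable_funeM.
- exact: emeasurable_funD.
Qed.

Lemma tilted_norm_crude h k : (\int[mu]_x (tilt h k x * f (h^-1 * x)%g ^+ 2)%:E <=
  (expR (l * (rho h + rho k)) * N)%:E)%E.
Proof.
rewrite tilted_norm EFinM -fN -ge0_integralZl //;
  [|by apply/measurable_EFinP; exact: measurable_funX|by move=> x _; rewrite lee_fin sqr_ge0].
apply: ge0_le_integralT => [x|x||].
- by rewrite lee_fin mulr_ge0 ?expR_ge0 ?sqr_ge0.
- rewrite -EFinM lee_fin ler_wpM2r ?sqr_ge0 // ler_expR.
  by apply: le_trans (ler_norm _) _; exact: tilt_bound.
- apply/measurable_EFinP; apply: measurable_funM; last exact: measurable_funX.
  apply: measurableT_comp => //; apply: measurable_funB => //.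
  by apply: measurable_funB => //; exact: measurable_funM.
- by apply: measurable_funeM; apply/measurable_EFinP; exact: measurable_funX.
Qed.

(** For [N > 0] this is [N] times the mean shift of [eta] under [g] for the probability density
    [f^2 / N]. The integrand is integrable, so [fine] loses nothing. *)
Definition energy_shift (g : G) : R :=
  fine (\int[mu]_x ((eta (g * x)%g - eta x) * f x ^+ 2)%:E)%E.
Local Notation A := energy_shift.

Lemma energy_shiftP g :
  has_integral mu (fun x : BG => (eta (g * x)%g - eta x) * f x ^+ 2) (A g).
Proof.
have [|x|s Hs] := @has_integral_bounded _ _ _ mu _
  (fun x : BG => eta (g * x)%g - eta x) N (l * rho g) _ i2.
- exact: measurable_funB.
- exact: etaL.
by rewrite /A (_ : (\int[mu]_x _)%E = s%:E) //; case: Hs.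
Qed.

Lemma energy_shift_le u : `|A u| <= l * rho u * N.
Proof.
have h := energy_shiftP u; have k := has_integralZ (l * rho u) i2.
rewrite ler_norml; apply/andP; split.
  rewrite -mulNr; apply: has_integral_le (has_integralZ (- (l * rho u)) i2) h _ => x.
  rewrite ler_wpM2r ?sqr_ge0 //; have := etaL u x; rewrite ler_norml; by case/andP.
apply: has_integral_le h k _ => x; rewrite ler_wpM2r ?sqr_ge0 //.
exact: le_trans (ler_norm _) (etaL u x).
Qed.

(** By left invariance the defect is the integral of [eta (g x) - eta x] against
    [f(h^-1 x)^2 - f(x)^2]; [sqr_diff_le] applies pointwise with [r = rho g]. *)
Lemma energy_shift_quasi_hom e g h : 0 < e -> `|A (g * h)%g - A g - A h| <=
  rho g * (e / 2 * fine (disp mu f h) + l ^+ 2 / e * (N + N)).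
Proof.
move=> e0.
have h1 := has_integral_shift h^-1%g (has_integralD (energy_shiftP (g * h)%g)
  (has_integralZ (-1) (energy_shiftP h))).
have h2 := has_integralD h1 (has_integralZ (-1) (energy_shiftP g)).
have h3 : has_integral mu (fun x : BG =>
    (eta (g * x)%g - eta x) * (f (h^-1 * x)%g ^+ 2 - f x ^+ 2)) (A (g * h)%g - A g - A h).
  have -> : A (g * h)%g - A g - A h = A (g * h)%g + -1 * A h + -1 * A g by ring.
  by apply: eq_has_integral h2 => x; rewrite -[(g * h * _)%g]mulgA !mulVKg; ring.
have h4 : has_integral mu (fun x : BG => rho g * (e / 2 * (f (h^-1 * x)%g - f x) ^+ 2 +
    l ^+ 2 / e * (f (h^-1 * x)%g ^+ 2 + f x ^+ 2)))
    (rho g * (e / 2 * fine (disp mu f h) + l ^+ 2 / e * (N + N))).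
  apply: has_integralZ; apply: has_integralD; apply: has_integralZ.
    apply: has_integral_ge0 => [|x|].
    - by apply: measurable_funX; exact: measurable_funB.
    - exact: sqr_ge0.
    - by rewrite -(disp_fin scG hmu mf fN).
  by apply: has_integralD => //; exact: (has_integral_shift h^-1%g i2).
have le x : `|(eta (g * x)%g - eta x) * (f (h^-1 * x)%g ^+ 2 - f x ^+ 2)| <=
    rho g * (e / 2 * (f (h^-1 * x)%g - f x) ^+ 2 +
    l ^+ 2 / e * (f (h^-1 * x)%g ^+ 2 + f x ^+ 2)).
  by apply: sqr_diff_le; [exact: ltW|exact: e0|exact: rho_ge0|exact: etaL].
rewrite ler_norml; apply/andP; split.
  rewrite -mulN1r; apply: has_integral_le (has_integralZ (-1) h4) h3 _ => x.
  by have := le x; rewrite ler_norml mulN1r => /andP[].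
by apply: has_integral_le h3 h4 _ => x; exact: le_trans (ler_norm _) (le x).
Qed.

(** After translation by [h] the exponent is [2 (eta (h x) - eta x) - (eta (k^-1 h x) - eta x)]. Its
    first order part integrates against [f^2] to [2 A h - A (k^-1 h)], and [expR_le_quadratic]
    bounds the rest. *)
Lemma tilted_norm_fine h k : l <= 1 ->
  (\int[mu]_x (tilt h k x * f (h^-1 * x)%g ^+ 2)%:E <=
  (N + 2 * A h - A (k^-1 * h)%g + l ^+ 2 * expR (3 * (rho h + rho k)) * N)%:E)%E.
Proof.
move=> l1; rewrite tilted_norm; set c := l ^+ 2 * expR _.
have [i <-] : has_integral mu (fun x : BG =>
  (1 + (2 * eta (h * x)%g - eta x - eta ((k^-1 * h) * x)%g) + c) * f x ^+ 2)
  (N + 2 * A h - A (k^-1 * h)%g + c * N).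
  have := has_integralD (has_integralD (has_integralD i2
     (has_integralZ 2 (energy_shiftP h)))
     (has_integralZ (-1) (energy_shiftP (k^-1 * h)%g))) (has_integralZ c i2).
  by rewrite mulN1r; apply: eq_has_integral => x; ring.
apply: ge0_le_integralT => [x|x||].
- by rewrite lee_fin mulr_ge0 ?expR_ge0 ?sqr_ge0.
- rewrite lee_fin ler_wpM2r ?sqr_ge0 //; apply: expR_le_quadratic => //.
  + exact: ltW.
  + by rewrite addr_ge0 //; exact: rho_ge0.
  + exact: tilt_bound.
- apply/measurable_EFinP; apply: measurable_funM; last exact: measurable_funX.
  apply: measurableT_comp => //; apply: measurable_funB => //.
  by apply: measurable_funB => //; exact: measurable_funM.
- by case/integrableP: i.
Qed.

(** The two tilted norms contribute [2 A h + 2 A k - A (k^-1 h) - A (h^-1 k)]. With [A] replaced by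
    a nearby character [v] this becomes [2 v h + 2 v k], as the last two values cancel; the
    coefficients 2, 2, 1, 1 add up to the 6 in the error. The character depends on [eta] and [f] but
    not on [h] and [k], so it can be integrated against [K]. *)
Lemma pair_bound (Cs Cd Q e : R) : 0 < e -> l <= 1 -> 0 < N -> 0 <= Q -> 0 <= Cd -> 0 < Cs ->
  (forall g, fine (disp mu f g) <= Cd * expR (3 * rho g) * Q) ->
  (forall (A : G -> R) (B M : R), 0 < B -> quasi_hom U B A ->
    (forall u, U u -> `|A u| <= M) ->
    exists v, real_char v /\ forall u, U u -> `|A u - v u| <= Cs * B) ->
  exists2 v, real_char v & forall h k,
  (2%:E * \int[mu]_x (tilt h k x * (f (h^-1 * x)%g * f (k^-1 * x)%g))%:E +
   (expR (- (l * (rho h + rho k))))%:E * disp mu f (h^-1 * k)%g <=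
   (2 * N + 2 * v h + 2 * v k + (6 * (Cs + 1) * (Cd * Q * e / 2 + 2 * l ^+ 2 * N / e) + 2 * l ^+ 2 * N) *
    (expR (4 * rho h) * expR (4 * rho k)))%:E)%E.
Proof.
move=> e0 l1 N0 Q0 Cd0 Cs0 Hd Hs.
have lp := l0.
(* The defect of [A], with the displacement replaced by its bound in terms of [Q]. The term in
   [l^2 N] makes it strictly positive, as the approximation by a character demands. *)
set B := Cd * Q * e / 2 + 2 * l ^+ 2 * N / e.
have B0 : 0 < B.
  apply: ltr_wpDl; first by rewrite !mulr_ge0 // ltW.
  by rewrite !mulr_gt0 ?invr_gt0 // exprn_gt0.
have qA : quasi_hom U B A.
  move=> g h; apply: le_trans (energy_shift_quasi_hom g h e0) _.
  have r1 := rho_ge1 gU (R := R) g; have r0 := rho_ge0 gU (R := R) g.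
  rewrite [3 * _]mulrDr expRD mulrCA; apply: ler_pM => //.
  - have D0 : 0 <= fine (disp mu f h) by rewrite fine_ge0 // disp_ge0.
    by apply: addr_ge0; apply: mulr_ge0; rewrite ?divr_ge0 ?sqr_ge0 ?addr_ge0 ?(ltW e0) ?(ltW N0).
  - by have := expR_ge1Dx (3 * rho g); lra.
  rewrite /B mulrDl; apply: lerD.
    have := ler_wpM2l (_ : 0 <= e / 2) (Hd h); rewrite divr_ge0 ?(ltW e0) // => /(_ isT).
    by move=> /le_trans; apply; rewrite le_eqVlt; apply/orP; left; apply/eqP; field.
  have -> : l ^+ 2 / e * (N + N) = 2 * l ^+ 2 * N / e by field; rewrite gt_eqF.
  rewrite ler_peMr ?one_le_expR //; last by rewrite mulr_ge0 //; exact: rho_ge0.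
  have l20 : 0 <= l ^+ 2 by exact: sqr_ge0.
  by rewrite divr_ge0 ?(ltW e0) // mulr_ge0 ?(ltW N0) // mulr_ge0.
have [|v [cv Hv]] := Hs A B (l * N) B0 qA.
  by move=> u Uu; have := energy_shift_le u; rewrite (rho_gen gU Uu) mulr1.
exists v => // h k.
have [vc vM] := cv.
(* Subtracting a homomorphism leaves the defect unchanged, so [A - v], small on [U], has controlled
   growth on all of [G]. *)
have qE : quasi_hom U B (fun g => A g - v g).
  move=> g g'; rewrite vM; have := qA g g'.
  by rewrite (_ : A (g * g')%g - _ - _ - _ = A (g * g')%g - A g - A g') //; ring.
have HE := quasi_hom_growth gU B0 Cs0 qE Hv.
apply: le_trans (pair_polarization h k) _.
apply: le_trans (leeD (tilted_norm_fine h k l1) (tilted_norm_fine k h l1)) _.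
rewrite -EFinD lee_fin.
have E1 g : 1 <= expR (4 * rho g).
  by apply: one_le_expR; rewrite mulr_ge0 //; exact: rho_ge0.
have BC : 0 <= B * (Cs + 1) by rewrite mulr_ge0 ?(ltW B0) //; lra.
have HV g : v g^-1%g = - v g by exact: homV.
have E2 g g' : expR (4 * rho (g'^-1 * g)%g) <= expR (4 * rho g) * expR (4 * rho g').
  rewrite -expRD ler_expR -mulrDr ler_pM2l //.
  by apply: le_trans (rhoM gU _ _) _; rewrite rhoV // addrC.
set Eh := expR (4 * rho h); set Ek := expR (4 * rho k).
have Eh1 : 1 <= Eh by exact: E1.
have Ek1 : 1 <= Ek by exact: E1.
have b1 : `|A h - v h| <= B * (Cs + 1) * (Eh * Ek).
  by apply: le_trans (HE h) _; rewrite ler_wpM2l // ler_peMr // expR_ge0.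
have b2 : `|A k - v k| <= B * (Cs + 1) * (Eh * Ek).
  by apply: le_trans (HE k) _; rewrite ler_wpM2l // ler_peMl // expR_ge0.
have b3 : `|A (k^-1 * h)%g - (v h - v k)| <= B * (Cs + 1) * (Eh * Ek).
  have := HE (k^-1 * h)%g; rewrite vM HV [- v k + _]addrC => /le_trans; apply.
  by rewrite ler_wpM2l //; exact: E2.
have b4 : `|A (h^-1 * k)%g - (v k - v h)| <= B * (Cs + 1) * (Eh * Ek).
  have := HE (h^-1 * k)%g; rewrite vM HV [- v h + _]addrC => /le_trans; apply.
  by rewrite ler_wpM2l // [Eh * Ek]mulrC; exact: E2.
have b5 : l ^+ 2 * expR (3 * (rho h + rho k)) * N <= l ^+ 2 * N * (Eh * Ek).
  rewrite mulrAC ler_wpM2l //; first by rewrite mulr_ge0 ?sqr_ge0 // ltW.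
  rewrite -expRD ler_expR -mulrDr ler_wpM2r ?addr_ge0 ?rho_ge0 //; lra.
have b6 : l ^+ 2 * expR (3 * (rho k + rho h)) * N <= l ^+ 2 * N * (Eh * Ek).
  by rewrite [rho k + _]addrC.
move: b1 b2 b3 b4; rewrite !ler_norml => /andP[_ b1] /andP[_ b2] /andP[b3 _] /andP[b4 _].
lra.
Qed.

End PairBound.

Lemma has_integral_dom d (T : measurableType d) (R : realType)
    (mu : {measure set T -> \bar R}) (a : T -> \bar R) (F : T -> R) (r : R) :
  measurable_fun setT a -> (forall x, 0 <= a x)%E -> (forall x, a x <= (F x)%:E)%E ->
  has_integral mu F r -> (\int[mu]_x a x <= r%:E)%E.
Proof.
move=> ma a0 aF [iF <-]; apply: ge0_le_integralT => //.
by case/integrableP: iF.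
Qed.

Lemma has_integral_dom2 d (T : measurableType d) (R : realType)
    (mu : {measure set T -> \bar R}) (s t : R) (a b : T -> \bar R) (F : T -> R) (r : R) :
  0 <= s -> 0 <= t -> measurable_fun setT a -> measurable_fun setT b ->
  (forall x, 0 <= a x)%E -> (forall x, 0 <= b x)%E ->
  (forall x, s%:E * a x + t%:E * b x <= (F x)%:E)%E ->
  has_integral mu F r ->
  (s%:E * \int[mu]_x a x + t%:E * \int[mu]_x b x <= r%:E)%E.
Proof.
move=> s0 t0 ma mb a0 b0 le hF.
have pa x : (0 <= s%:E * a x)%E by rewrite mule_ge0 // lee_fin.
have pb x : (0 <= t%:E * b x)%E by rewrite mule_ge0 // lee_fin.
have msa := measurable_funeM s%:E ma; have mtb := measurable_funeM t%:E mb.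
rewrite -(ge0_integralZl _ measurableT ma) // -(ge0_integralZl _ measurableT mb) //.
rewrite -(ge0_integralD _ measurableT _ msa _ mtb) //.
apply: has_integral_dom hF => // [|x]; first exact: emeasurable_funD.
by rewrite adde_ge0.
Qed.

(** * Integration of the pair bound against [K h K k] *)

Section PairIntegral.
Context {R : realType} {G : topologicalGroupType}.
Hypothesis scG : @second_countable G.
Local Notation BG := (borel G).
Variable mu : {sigma_finite_measure set BG -> \bar R}.
Hypothesis hmu : left_haar mu.
Variable U : set G.
Hypothesis cG : connected [set: G].
Hypothesis gU : generating_nbhs U.
Local Notation rho := (@rho R G U).

Lemma measurable_rho1 d (T : measurableType d) (g : T -> BG) :
  measurable_fun setT g -> measurable_fun setT (fun x => rho (g x)).
Proof.
by move=> mg; apply: (measurableT_comp (f := rho : BG -> R)) => //; exact: measurable_rho.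
Qed.

Variables (K : G -> R) (W : set G) (k0 Mk a : R).
Hypothesis mK : measurable_fun setT (K : BG -> R).
Hypothesis K0 : forall g, 0 <= K g.
Hypothesis K1 : (\int[mu]_x (K x)%:E = 1)%E.
Hypothesis oW : open W.
Hypothesis W1 : W 1%g.
Hypothesis WU : W `<=` U.
Hypothesis k00 : 0 < k0.
Hypothesis WK : forall x, W x -> k0 <= K x.
Hypothesis Mk0 : 0 <= Mk.
Hypothesis a0 : 0 <= a.
Hypothesis Kmom : forall t, 0 <= t ->
  (\int[mu]_x (K x * expR (t * rho x))%:E <= (Mk * expR (a * t ^+ 2))%:E)%E.
Hypothesis Kchar : forall v, real_char v ->
  has_integral mu (fun x : BG => K x * v x) 0.

Definition pair_integral (eta f : G -> R) h k : \bar R :=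
  \int[mu]_x (tilt eta h k x * (f (h^-1 * x)%g * f (k^-1 * x)%g))%:E.

Lemma has_integral_moment t : 0 <= t -> exists2 m,
  has_integral mu (fun x : BG => K x * expR (t * rho x)) m & 0 <= m <= Mk * expR (a * t ^+ 2).
Proof.
move=> t0; have := Kmom t0.
have m1 : measurable_fun setT (fun x : BG => K x * expR (t * rho x)).
  apply: measurable_funM => //; apply: measurableT_comp => //; apply: measurable_funM => //.
  exact: measurable_rho1.
have p1 (x : BG) : 0 <= K x * expR (t * rho x) by rewrite mulr_ge0 ?expR_ge0.
set I := (\int[mu]_x _)%E => hI.
have I0 : (0 <= I)%E by apply: integral_ge0 => x _; rewrite lee_fin.
have If : I = (fine I)%:E.
  by rewrite fineK // ge0_fin_numE //; apply: le_lt_trans hI _; rewrite ltry.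
exists (fine I); first exact: has_integral_ge0.
by move: I0 hI; rewrite If !lee_fin => -> ->.
Qed.

Section Fixed.
Variables (eta f : G -> R) (l M N : R).
Hypothesis meta : measurable_fun setT (eta : BG -> R).
Hypothesis etaL : forall h x, `|eta (h * x)%g - eta x| <= l * rho h.
Hypothesis etaM : forall x, `|eta x| <= M.
Hypothesis l0 : 0 < l.
Hypothesis mf : measurable_fun setT (f : BG -> R).
Hypothesis f0 : forall x, 0 <= f x.
Hypothesis fN : (\int[mu]_x (f x ^+ 2)%:E = N%:E)%E.
Local Notation I := (pair_integral eta f).

Let I0 h k : (0 <= I h k)%E.
Proof. by apply: integral_ge0 => x _; rewrite lee_fin !mulr_ge0 ?expR_ge0. Qed.

Let mI : measurable_fun setT (fun z : BG * BG => I z.1 z.2).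
Proof.
have mc (g : BG -> R) (s : BG * BG * BG -> BG) : measurable_fun setT g ->
    measurable_fun setT s -> measurable_fun setT (fun z => g ((s z)^-1 * z.2)%g).
  move=> mg ms; apply: (measurableT_comp (f := g)) => //.
  by apply: measurable_mulg2 => //; apply: measurable_invg1.
have m1 : measurable_fun setT (fun z : BG * BG * BG => z.1.1).
  exact: (measurableT_comp measurable_fst measurable_fst).
have m2 : measurable_fun setT (fun z : BG * BG * BG => z.1.2).
  exact: (measurableT_comp measurable_snd measurable_fst).
apply: (@measurable_fun_fubini_tonelli_F _ _ (BG * BG)%type BG R mu
  (fun z => (tilt eta z.1.1 z.1.2 z.2 * (f (z.1.1^-1 * z.2)%g * f (z.1.2^-1 * z.2)%g))%:E)) => [|z].
  apply/measurable_EFinP; apply: measurable_funM; last first.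
    by apply: measurable_funM; exact: mc.
  apply: measurableT_comp => //; apply: measurable_funB; last exact: mc.
  apply: measurable_funB; last exact: mc.
  apply: measurable_funM => //.
  exact: (measurableT_comp (f := eta : BG -> R) meta).
by rewrite lee_fin !mulr_ge0 ?expR_ge0.
Qed.

Let mKI : measurable_fun setT (fun z : BG * BG => ((K z.1 * K z.2)%:E * I z.1 z.2)%E).
Proof.
apply: emeasurable_funM => //; apply/measurable_EFinP; apply: measurable_funM.
  exact: (measurableT_comp (f := K : BG -> R) mK).
exact: (measurableT_comp (f := K : BG -> R) mK).
Qed.

Let KI0 h k : (0 <= (K h * K k)%:E * I h k)%E.
Proof. by rewrite mule_ge0 // lee_fin mulr_ge0. Qed.

Let mKI2 h : measurable_fun setT (fun k : BG => ((K h * K k)%:E * I h k)%E).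
Proof.
apply: (measurableT_comp (f := fun z : BG * BG => ((K z.1 * K z.2)%:E * I z.1 z.2)%E)
  (g := fun k : BG => (h, k)) mKI).
exact: measurable_fun_pair.
Qed.

Let mKI1 : measurable_fun setT (fun h : BG => \int[mu]_k ((K h * K k)%:E * I h k))%E.
Proof.
by apply: (@measurable_fun_fubini_tonelli_F _ _ BG BG R mu
  (fun z => ((K z.1 * K z.2)%:E * I z.1 z.2)%E)) => // z.
Qed.

(** Without the displacement term only the exponential moment of [K] at [l] is involved. This
    suffices for [l > 1], and for [f] of norm zero. *)
Lemma pair_integral_crude m :
  has_integral mu (fun x : BG => K x * expR (l * rho x)) m ->
  (\int[mu]_h \int[mu]_k ((K h * K k)%:E * I h k) <= (m * m * N)%:E)%E.
Proof.
move=> hm; have lp := l0.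
have le h k : (I h k <= (expR (l * (rho h + rho k)) * N)%:E)%E.
  have := pair_polarization scG hmu gU meta etaL mf f0 h k.
  move/le_trans => /(_ _ (leeD (tilted_norm_crude scG hmu gU meta etaL mf fN h k)
    (tilted_norm_crude scG hmu gU meta etaL mf fN k h))).
  rewrite [rho k + rho h]addrC -/(I h k) => h1.
  have : (2%:E * I h k <= 2%:E * (expR (l * (rho h + rho k)) * N)%:E)%E.
    apply: le_trans (leeDl _ _) (le_trans h1 _).
      by rewrite mule_ge0 ?disp_ge0 // lee_fin expR_ge0.
    by rewrite -EFinD -EFinM lee_fin; lra.
  by rewrite lee_pmul2l.
apply: (@has_integral_dom _ _ _ _ _ (fun h : BG => K h * expR (l * rho h) * (m * N))) => //.
- by move=> h; apply: integral_ge0 => k _.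
- move=> h; apply: (@has_integral_dom _ _ _ _ _ (fun k : BG =>
    (K h * expR (l * rho h) * N) * (K k * expR (l * rho k)))) => //.
  + move=> k; apply: le_trans (lee_wpmul2l _ (le h k)) _; first by rewrite lee_fin mulr_ge0.
    rewrite -EFinM lee_fin mulrDr expRD.
    by rewrite le_eqVlt; apply/orP; left; apply/eqP; ring.
  + have -> : K h * expR (l * rho h) * (m * N) = K h * expR (l * rho h) * N * m by ring.
    exact: has_integralZ.
have -> : m * m * N = (m * N) * m by ring.
by apply: eq_has_integral (has_integralZ (m * N) hm) => x; rewrite mulrC.
Qed.

(** The terms in [v] integrate to 0 against [K]. On [W x W] one has [K h K k >= k0^2], and [rho] is
    1 because [W] lies in [U]; as [l <= 1], the coefficient of the displacement there is at least
    [e^-2 k0^2]. *)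
Lemma pair_integral_fine (v : G -> R) (b Q m : R) : l <= 1 -> real_char v ->
  disp_avg mu W f = Q%:E -> 0 <= Q ->
  has_integral mu (fun x : BG => K x * expR (4 * rho x)) m ->
  (forall h k, (2%:E * I h k +
     (expR (- (l * (rho h + rho k))))%:E * disp mu f (h^-1 * k)%g <=
     (2 * N + 2 * v h + 2 * v k + b * (expR (4 * rho h) * expR (4 * rho k)))%:E)%E) ->
  (2%:E * \int[mu]_h \int[mu]_k ((K h * K k)%:E * I h k) +
    (expR (- 2) * k0 ^+ 2)%:E * Q%:E <= (2 * N + b * (m * m))%:E)%E.
Proof.
move=> l1 cv QE Q0 hm Hb; have lp := l0; have kp := k00.
set c := expR (- 2) * k0 ^+ 2.
have c0 : 0 <= c by rewrite mulr_ge0 ?expR_ge0 ?sqr_ge0.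
have mW : measurable (W : set BG) by exact: open_borel.
have i0 (x : BG) : 0 <= \1_W x :> R by rewrite indicE.
have D0 h k : (0 <= ((\1_W h : R) * \1_W k)%:E * disp mu f (h^-1 * k)%g)%E.
  by rewrite mule_ge0 ?disp_ge0 // lee_fin mulr_ge0.
have mD : measurable_fun setT (fun z : BG * BG =>
    (((\1_W z.1 : R) * \1_W z.2)%:E * disp mu f (z.1^-1 * z.2)%g)%E).
  apply: emeasurable_funM.
    apply/measurable_EFinP; apply: measurable_funM.
      by apply: (measurableT_comp (f := \1_W : BG -> R)) => //; exact: measurable_indic.
    by apply: (measurableT_comp (f := \1_W : BG -> R)) => //; exact: measurable_indic.
  apply: (measurableT_comp (g := fun z : BG * BG => (z.1^-1 * z.2)%g : BG)
    (measurable_disp scG mu mf)).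
  by apply: measurable_mulg2 => //; apply: measurable_invg1.
have mD2 h : measurable_fun setT (fun k : BG =>
    (((\1_W h : R) * \1_W k)%:E * disp mu f (h^-1 * k)%g)%E).
  apply: (measurableT_comp (f := fun z : BG * BG =>
    (((\1_W z.1 : R) * \1_W z.2)%:E * disp mu f (z.1^-1 * z.2)%g)%E)
    (g := fun k : BG => (h, k)) mD).
  exact: measurable_fun_pair.
have mD1 : measurable_fun setT (fun h : BG => \int[mu]_k
    (((\1_W h : R) * \1_W k)%:E * disp mu f (h^-1 * k)%g))%E.
  by apply: (@measurable_fun_fubini_tonelli_F _ _ BG BG R mu
    (fun z => (((\1_W z.1 : R) * \1_W z.2)%:E * disp mu f (z.1^-1 * z.2)%g)%E)) => // z.
have two0 : (0 <= 2%:E :> \bar R)%E by rewrite lee_fin.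
have c0e : (0 <= c%:E)%E by rewrite lee_fin.
have pt h k : (2%:E * ((K h * K k)%:E * I h k) +
    c%:E * (((\1_W h : R) * \1_W k)%:E * disp mu f (h^-1 * k)%g) <=
    (K h * K k * (2 * N + 2 * v h + 2 * v k + b * (expR (4 * rho h) * expR (4 * rho k))))%:E)%E.
  have KK : (0 <= (K h * K k)%:E)%E by rewrite lee_fin mulr_ge0.
  rewrite [leRHS]EFinM; apply: le_trans (lee_wpmul2l KK (Hb h k)).
  have p1 : (0 <= 2%:E * I h k)%E by exact: mule_ge0.
  have p2 : (0 <= (expR (- (l * (rho h + rho k))))%:E * disp mu f (h^-1 * k)%g)%E.
    by apply: mule_ge0; [rewrite lee_fin expR_ge0|exact: disp_ge0].
  rewrite [leRHS](ge0_muleDr _ p1 p2).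
  apply: leeD; first by rewrite muleCA.
  rewrite !muleA; apply: lee_wpmul2r; first exact: disp_ge0.
  rewrite -!EFinM lee_fin.
  have [Wh|nWh] := pselect (W h); last first.
    by rewrite [\1_W h]indicE (memNset nWh) mul0r mulr0 !mulr_ge0 ?expR_ge0.
  have [Wk|nWk] := pselect (W k); last first.
    by rewrite [\1_W k]indicE (memNset nWk) !mulr0 !mulr_ge0 ?expR_ge0.
  rewrite !indicE (mem_set Wh) (mem_set Wk) !mulr1 /c mulrC.
  apply: ler_pM; rewrite ?sqr_ge0 ?expR_ge0 //.
    by rewrite expr2 ler_pM ?WK // ltW.
  rewrite ler_expR (rho_gen gU (WU Wh)) (rho_gen gU (WU Wk)); lra.
have -> : (Q%:E = \int[mu]_h \int[mu]_k
    (((\1_W h : R) * \1_W k)%:E * disp mu f (h^-1 * k)%g))%E by rewrite -QE.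
have hK : has_integral mu (K : BG -> R) 1 by exact: has_integral_ge0.
have hv := Kchar cv.
have iKI h : (0 <= \int[mu]_k ((K h * K k)%:E * I h k))%E by apply: integral_ge0 => k _.
have iD h : (0 <= \int[mu]_k (((\1_W h : R) * \1_W k)%:E * disp mu f (h^-1 * k)%g))%E.
  by apply: integral_ge0 => k _.
have two0R : 0 <= 2 :> R by [].
apply: (has_integral_dom2 (F := fun h : BG => (2 * N) * K h + 2 * (K h * v h) +
    (b * m) * (K h * expR (4 * rho h))) two0R c0 mKI1 mD1 iKI iD).
  move=> h; apply: (has_integral_dom2 two0R c0 (mKI2 h) (mD2 h) (KI0 h) (D0 h) (pt h)).
  have := has_integralZ (K h) (has_integralD (has_integralD
    (has_integralZ (2 * N + 2 * v h) hK) (has_integralZ 2 hv))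
    (has_integralZ (b * expR (4 * rho h)) hm)).
  rewrite (_ : K h * _ = (2 * N) * K h + 2 * (K h * v h) +
    (b * m) * (K h * expR (4 * rho h))); last by ring.
  by apply: eq_has_integral => k; ring.
have -> : 2 * N + b * (m * m) = 2 * N * 1 + 2 * 0 + b * m * m by ring.
by apply: has_integralD; [apply: has_integralD|]; exact: has_integralZ.
Qed.

End Fixed.

(* For [l > 1] the moments of [K] suffice. For [l <= 1] the first order terms
   are the values of a character up to [C * (e * Q + l ^+ 2 * N / e)]; the
   character integrates to 0 against [K] and, [e] being small, the coercive
   term absorbs [e * Q]. *)
Lemma pair_integral_le : exists2 w : R, 0 < w & forall (eta f : G -> R) (l M N : R),
  measurable_fun setT (eta : BG -> R) ->
  (forall h x, `|eta (h * x)%g - eta x| <= l * rho h) ->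
  (forall x, `|eta x| <= M) -> 0 < l ->
  measurable_fun setT (f : BG -> R) -> (forall x, 0 <= f x) ->
  (\int[mu]_x (f x ^+ 2)%:E = N%:E)%E ->
  (\int[mu]_h \int[mu]_k ((K h * K k)%:E * pair_integral eta f h k) <=
    (expR (w * l ^+ 2) * N)%:E)%E.
Proof.
have hkp := k00; have ha := a0; have hMk := Mk0.
have Woo : (mu W < +oo)%E.
  apply: le_lt_trans (haar_gen_lty hmu gU); apply: le_measure => //.
    by apply: mem_set; exact: open_borel.
  by apply: mem_set; apply: open_borel; exact: gen_open.
have [Cs [Cs0 HCs]] := quasi_hom_near_char (R := R) gU.
have [Cd Cd0 HCd] := disp_bounds scG hmu cG gU oW W1 Woo.
have [m hm /andP[m0 _]] := has_integral_moment (ler0n R 4).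
pose c1 := expR (- 2) * k0 ^+ 2.
have c10 : 0 < c1 by rewrite mulr_gt0 ?expR_gt0 // exprn_gt0.
(* Chosen so that [3 (Cs + 1) Cd m^2 e <= c1], where 3 is half the 6 of [pair_bound]: the part of
   the error proportional to [Q] is then at most the coercive term. The 1 added to [Cd] and to
   [m * m] keeps [D] positive. *)
pose D := 3 * (Cs + 1) * (Cd + 1) * (m * m + 1).
have D0 : 0 < D.
  by rewrite !mulr_gt0 //; [lra|lra|rewrite ltr_wpDl ?mulr_ge0].
pose e := c1 / D.
have e0 : 0 < e by rewrite divr_gt0.
pose C3 := (6 * (Cs + 1) / e + 1) * (m * m).
have C30 : 0 <= C3.
  rewrite mulr_ge0 ?mulr_ge0 // addr_ge0 // mulr_ge0 ?invr_ge0 ?(ltW e0) // mulr_ge0 //; lra.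
(* [Mk^2 + 2 a] serves [l > 1], where [Mk^2 <= e^(Mk^2 l^2)]; [C3] serves [l <= 1]. *)
exists (Mk ^+ 2 + 2 * a + C3 + 1).
  by rewrite ltr_wpDl // !addr_ge0 ?sqr_ge0 // mulr_ge0.
move=> eta f l M N meta etaL etaM l0 mf f0 fN.
have N0 : 0 <= N.
  by rewrite -lee_fin -fN; apply: integral_ge0 => x _; rewrite lee_fin sqr_ge0.
set w := _ + 1.
have l20 : 0 <= l ^+ 2 by exact: sqr_ge0.
(* [pair_bound] needs a strictly positive defect, hence [N > 0]. *)
have [N00|Np] : N = 0 \/ 0 < N by move: N0; rewrite le_eqVlt => /predU1P[<-|]; [left|right].
  have [m' hm' _] := has_integral_moment (ltW l0).
  have := pair_integral_crude meta etaL l0 mf f0 fN hm'.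
  by rewrite N00 !mulr0.
have [l1|l1] := leP l 1; last first.
  have [m' hm' /andP[m'0 m'le]] := has_integral_moment (ltW l0).
  apply: le_trans (pair_integral_crude meta etaL l0 mf f0 fN hm') _.
  rewrite lee_fin ler_wpM2r //.
  apply: (@le_trans _ _ ((Mk * expR (a * l ^+ 2)) * (Mk * expR (a * l ^+ 2)))).
    exact: ler_pM.
  have -> : Mk * expR (a * l ^+ 2) * (Mk * expR (a * l ^+ 2)) =
      Mk ^+ 2 * expR (2 * a * l ^+ 2).
    rewrite (_ : 2 * a * l ^+ 2 = a * l ^+ 2 + a * l ^+ 2); last by ring.
    by rewrite expRD; ring.
  have l21 : 1 <= l ^+ 2 by rewrite exprn_ege1 // ltW.
  have h1 : Mk ^+ 2 <= expR (Mk ^+ 2 * l ^+ 2).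
    have h2 := expR_ge1Dx (Mk ^+ 2 * l ^+ 2).
    have h3 : Mk ^+ 2 <= Mk ^+ 2 * l ^+ 2 by rewrite ler_peMr ?sqr_ge0.
    lra.
  apply: (@le_trans _ _ (expR (Mk ^+ 2 * l ^+ 2) * expR (2 * a * l ^+ 2))).
    by rewrite ler_pM2r ?expR_gt0.
  rewrite -expRD ler_expR -mulrDl ler_wpM2r // /w; lra.
have [QE Q0] := disp_avg_fin scG hmu mf fN oW Woo.
set Q := fine (disp_avg mu W f) in QE Q0.
have [v cv Hv] := pair_bound scG hmu gU meta etaL l0 mf f0 fN e0 l1 Np Q0 Cd0 Cs0
  (fun g => HCd f N mf fN g) HCs.
have := pair_integral_fine meta l0 mf f0 l1 cv QE Q0 hm Hv.
set X := (\int[mu]_h _)%E => hX.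
have X0 : (0 <= X)%E.
  apply: integral_ge0 => h _; apply: integral_ge0 => k _.
  rewrite mule_ge0 ?lee_fin ?mulr_ge0 //.
  by apply: integral_ge0 => x _; rewrite lee_fin !mulr_ge0 ?expR_ge0.
have Xf : X = (fine X)%:E.
  rewrite fineK // ge0_fin_numE //.
  have : (2%:E * X < +oo)%E.
    apply: le_lt_trans (le_trans (leeDl _ _) hX) _; last by rewrite ltry.
    by rewrite -EFinM lee_fin mulr_ge0 // ltW.
  by rewrite !ltey; apply: contra => /eqP ->; rewrite gt0_muley // lte_fin.
move: hX; rewrite Xf -!EFinM -EFinD !lee_fin; set x := fine X => hX.
have Ce : 3 * (Cs + 1) * Cd * (m * m) * e <= c1.
  have De : D * e = c1 by rewrite /e mulrCA divff ?mulr1 // gt_eqF.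
  rewrite -[leRHS]De ler_wpM2r ?(ltW e0) // /D.
  have mm : 0 <= m * m by exact: mulr_ge0.
  have Cs1 : 0 <= 3 * (Cs + 1) by lra.
  have p1 : 0 <= 3 * (Cs + 1) * (Cd + m * m + 1) by rewrite mulr_ge0 //; lra.
  lra.
have CeQ := ler_wpM2r Q0 Ce.
have fin : x <= N * (1 + C3 * l ^+ 2).
  have e_eq : 2 * l ^+ 2 * N / e = 2 * (l ^+ 2 * N / e) by ring.
  rewrite /C3; move: hX; rewrite -/c1.
  have -> : (6 * (Cs + 1) / e + 1) * (m * m) * l ^+ 2 =
    6 * (Cs + 1) * (m * m) * (l ^+ 2 / e) + m * m * l ^+ 2 by ring.
  rewrite (_ : 2 * l ^+ 2 * N / e = 2 * N * (l ^+ 2 / e)); last by ring.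
  move: (l ^+ 2 / e) (l ^+ 2) => p q.
  have -> : Cd * Q * e / 2 = 2^-1 * (Cd * Q * e) by ring.
  lra.
apply: le_trans fin _; rewrite mulrC ler_wpM2r //.
apply: le_trans (expR_ge1Dx _) _; rewrite ler_expR ler_wpM2r // /w.
have := sqr_ge0 Mk; lra.
Qed.

End PairIntegral.

(** * The averaging operator and its weighted L^2 bound *)

Section Averaging.
Context {R : realType} {G : topologicalGroupType}.
Hypothesis scG : @second_countable G.
Local Notation BG := (borel G).
Variable mu : {sigma_finite_measure set BG -> \bar R}.
Hypothesis hmu : left_haar mu.
Variable K : G -> R.
Hypothesis mK : measurable_fun setT (K : BG -> R).
Hypothesis K0 : forall g, 0 <= K g.
Hypothesis K1 : (\int[mu]_x (K x)%:E = 1)%E.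
Local Open Scope ereal_scope.

(** [T] on nonnegative extended functions, for which every integral makes sense. Complex functions
    are reached at the end by pointwise domination. *)
Definition avg_op (u : G -> \bar R) (x : G) : \bar R :=
  \int[mu]_h ((K h)%:E * u (h^-1 * x)%g).

Let K0e h : 0 <= (K h)%:E. Proof. by rewrite lee_fin. Qed.

Let mKe : measurable_fun setT (fun h : BG => (K h)%:E : \bar R).
Proof. exact/measurable_EFinP. Qed.

Lemma measurable_translate (u : BG -> \bar R) d (T : measurableType d) (a b : T -> BG) :
  measurable_fun setT u -> measurable_fun setT a -> measurable_fun setT b ->
  measurable_fun setT (fun t => u ((a t)^-1 * b t)%g).
Proof.
move=> mu' ma mb; apply: (measurableT_comp (f := u)
  (g := fun t => ((a t)^-1 * b t)%g : BG) mu').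
by apply: measurable_mulg2 => //; exact: measurable_invg1.
Qed.

Section OneFunction.
Variable u : G -> \bar R.
Hypothesis mu' : measurable_fun setT (u : BG -> \bar R).
Hypothesis u0 : forall x, 0 <= u x.

Let mint (x : G) : measurable_fun setT (fun h : BG => (K h)%:E * u (h^-1 * x)%g).
Proof.
apply: emeasurable_funM => //.
by apply: (measurable_translate (b := fun=> x : BG) mu').
Qed.

Let int0 (x h : G) : 0 <= (K h)%:E * u (h^-1 * x)%g.
Proof. exact: mule_ge0. Qed.

Lemma avg_op_ge0 x : 0 <= avg_op u x.
Proof. by apply: integral_ge0 => h _; exact: int0. Qed.

Let mxh : measurable_fun setT (fun z : BG * BG => (K z.2)%:E * u (z.2^-1 * z.1)%g).
Proof.
apply: emeasurable_funM.
  exact: (measurableT_comp (f := fun h : BG => (K h)%:E : \bar R) mKe).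
exact: (measurable_translate mu').
Qed.

Lemma measurable_avg_op : measurable_fun setT (avg_op u : BG -> \bar R).
Proof.
apply: (@measurable_fun_fubini_tonelli_F _ _ BG BG R mu
  (fun z => (K z.2)%:E * u (z.2^-1 * z.1)%g) mxh) => z.
exact: int0.
Qed.

Lemma integral_avg_op : \int[mu]_x avg_op u x = \int[mu]_x u x.
Proof.
rewrite /avg_op.
rewrite (@fubini_tonelli _ _ BG BG R mu mu
  (fun z => (K z.2)%:E * u (z.2^-1 * z.1)%g) mxh) => [|z]; last exact: int0.
transitivity (\int[mu]_h ((K h)%:E * \int[mu]_x u x)).
  apply: eq_integral => h _ /=.
  have mh : measurable_fun setT (fun x : BG => u (h^-1 * x)%g).
    exact: (measurableT_comp (f := u : BG -> \bar R) mu' (measurable_mull scG h^-1%g)).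
  by rewrite (ge0_integralZl _ measurableT mh) // (haar_ge0_integral scG hmu h^-1%g mu' u0).
rewrite (ge0_integralZr _ measurableT mKe) // ?K1 ?mul1e //.
by apply: integral_ge0 => x _.
Qed.

Lemma avg_op_sq (eta : G -> R) : measurable_fun setT (eta : BG -> R) ->
  \int[mu]_x ((expR (2 * eta x))%:E * (avg_op u x * avg_op u x)) =
  \int[mu]_h \int[mu]_k ((K h * K k)%:E *
    \int[mu]_x ((expR (2 * eta x))%:E * (u (h^-1 * x)%g * u (k^-1 * x)%g))).
Proof.
move=> meta.
pose g (x : G) : \bar R := (expR (2 * eta x))%:E.
have g0 x : 0 <= g x by rewrite lee_fin expR_ge0.
have mg : measurable_fun setT (g : BG -> \bar R).
  by apply/measurable_EFinP; apply: measurableT_comp => //; exact: measurable_funM.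
pose F (x h k : G) := g x * ((K h)%:E * u (h^-1 * x)%g) * ((K k)%:E * u (k^-1 * x)%g).
have F0 x h k : 0 <= F x h k by apply: mule_ge0 => //; exact: mule_ge0.
have mF d (T : measurableType d) (a b c : T -> BG) : measurable_fun setT a ->
    measurable_fun setT b -> measurable_fun setT c ->
    measurable_fun setT (fun t => F (a t) (b t) (c t)).
  move=> ma mb mc.
  have mKc (s : T -> BG) : measurable_fun setT s ->
      measurable_fun setT (fun t => (K (s t))%:E * u ((s t)^-1 * a t)%g).
    move=> ms; apply: emeasurable_funM.
      exact: (measurableT_comp (f := fun h : BG => (K h)%:E : \bar R) mKe).
    exact: (measurable_translate mu').
  apply: emeasurable_funM; last exact: mKc.
  apply: emeasurable_funM; last exact: mKc.
  exact: (measurableT_comp (f := g : BG -> \bar R) mg).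
have m11 : measurable_fun setT (fun z : BG * BG * BG => z.1.1).
  exact: (measurableT_comp measurable_fst measurable_fst).
have m12 : measurable_fun setT (fun z : BG * BG * BG => z.1.2).
  exact: (measurableT_comp measurable_snd measurable_fst).
have m3 : measurable_fun setT (fun z : BG * BG => \int[mu]_k F z.1 z.2 k).
  apply: (@measurable_fun_fubini_tonelli_F _ _ (BG * BG)%type BG R mu
    (fun z => F z.1.1 z.1.2 z.2)) => [|z]; last exact: F0.
  exact: mF.
transitivity (\int[mu]_x \int[mu]_h \int[mu]_k F x h k).
  apply: eq_integral => x _.
  have p0 := avg_op_ge0 x.
  have mgi := measurable_funeM (g x) (mint x).
  have gi0 h : 0 <= g x * ((K h)%:E * u (h^-1 * x)%g) by apply: mule_ge0.
  transitivity (\int[mu]_h (g x * ((K h)%:E * u (h^-1 * x)%g) * avg_op u x)).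
    rewrite (ge0_integralZr _ measurableT mgi) //.
    by rewrite (ge0_integralZl _ measurableT (mint x)) // muleA.
  apply: eq_integral => h _; rewrite /F (ge0_integralZl _ measurableT (mint x)) //.
rewrite (@fubini_tonelli _ _ BG BG R mu mu (fun z => \int[mu]_k F z.1 z.2 k) m3) => [|z];
  last by apply: integral_ge0 => k _; exact: F0.
apply: eq_integral => h _ /=.
have mxk : measurable_fun setT (fun z : BG * BG => F z.1 h z.2).
  exact: (mF _ _ (fun z : BG * BG => z.1) (fun=> h : BG) (fun z : BG * BG => z.2)
    measurable_fst (measurable_cst _) measurable_snd).
rewrite (@fubini_tonelli _ _ BG BG R mu mu (fun z => F z.1 h z.2) mxk) => [|z];
  last exact: F0.
apply: eq_integral => k _ /=.
have mx s : measurable_fun setT (fun x : BG => u (s^-1 * x)%g).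
  exact: (measurableT_comp (f := u : BG -> \bar R) mu' (measurable_mull scG s^-1%g)).
have mgu : measurable_fun setT (fun x : BG => g x * (u (h^-1 * x)%g * u (k^-1 * x)%g)).
  by apply: emeasurable_funM => //; exact: emeasurable_funM.
rewrite -(ge0_integralZl _ measurableT mgu); last 2 first.
- by move=> x _; apply: mule_ge0 => //; exact: mule_ge0.
- by rewrite lee_fin mulr_ge0.
apply: eq_integral => x _; rewrite /F EFinM.
rewrite [g x * _ in LHS]muleCA -!muleA; congr (_ * _).
rewrite [RHS]muleCA; congr (_ * _).
by rewrite [LHS]muleCA.
Qed.

End OneFunction.

Lemma ae_translate (P : G -> Prop) g : {ae mu, forall x : BG, P x} ->
  {ae mu, forall x : BG, P (g * x)%g}.
Proof.
move=> [A [mA A0 PA]]; exists ((fun x => (g * x)%g) @^-1` A); split.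
- by rewrite -[X in measurable X]setTI; exact: (measurable_mull scG g).
- by rewrite (haar_preimage hmu).
- by move=> x /= nP; exact: PA.
Qed.

Variable U : set G.
Hypothesis cG : connected [set: G].
Hypothesis gU : generating_nbhs U.
Local Notation rho := (@rho R G U).
Variables (W : set G) (k0 Mk a : R).
Hypothesis oW : open W.
Hypothesis W1 : W 1%g.
Hypothesis WU : W `<=` U.
Hypothesis k00 : (0 < k0)%R.
Hypothesis WK : forall x, W x -> (k0 <= K x)%R.
Hypothesis Mk0 : (0 <= Mk)%R.
Hypothesis a0 : (0 <= a)%R.
Hypothesis Kmom : forall t, (0 <= t)%R ->
  \int[mu]_x (K x * expR (t * rho x))%:E <= (Mk * expR (a * t ^+ 2))%:E.
Hypothesis Kchar : forall v, real_char v ->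
  has_integral mu (fun x : BG => K x * v x)%R 0%R.

Lemma avg_op_weighted : exists2 w : R, (0 < w)%R & forall (eta : G -> R) (l M : R) (u : G -> \bar R),
  measurable_fun setT (eta : BG -> R) ->
  (forall h x, `|eta (h * x)%g - eta x| <= l * rho h)%R ->
  (forall x, `|eta x| <= M)%R -> (0 < l)%R ->
  measurable_fun setT (u : BG -> \bar R) -> (forall x, 0 <= u x) ->
  \int[mu]_x ((expR (2 * eta x))%:E * (avg_op u x * avg_op u x)) <=
    (expR (w * l ^+ 2))%:E * \int[mu]_x ((expR (2 * eta x))%:E * (u x * u x)).
Proof.
have [w w0 Hw] := pair_integral_le scG hmu cG gU mK K0 K1 oW W1 WU k00 WK Mk0 a0 Kmom Kchar.
exists w => // eta l M u meta etaL etaM l0 mu' u0.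
have me : measurable_fun setT (fun x : BG => (expR (2 * eta x))%:E : \bar R).
  by apply/measurable_EFinP; apply: measurableT_comp => //; exact: measurable_funM.
have muu : measurable_fun setT (fun x : BG => (expR (2 * eta x))%:E * (u x * u x)).
  by apply: emeasurable_funM => //; exact: emeasurable_funM.
have uu0 x : 0 <= (expR (2 * eta x))%:E * (u x * u x).
  by rewrite !mule_ge0 // lee_fin expR_ge0.
set N := (X in _ <= _ * X).
have N0 : 0 <= N by apply: integral_ge0 => x _; exact: uu0.
have [Noo|Nfin] := eqVneq N +oo.
  by rewrite Noo gt0_muley ?leey // lte_fin expR_gt0.
have NE : N = (fine N)%:E by rewrite fineK // ge0_fin_numE // ltey.
have aefin : {ae mu, forall x : BG, u x \is a fin_num}.
  have : mu.-integrable setT (fun x : BG => (expR (2 * eta x))%:E * (u x * u x)).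
    apply/integrableP; split => //; under eq_integral do rewrite gee0_abs //.
    by rewrite -/N ltey.
  move=> /(integrable_ae measurableT); apply: filterS => x /(_ I).
  move: (u0 x); case: (u x) => //= _.
  by rewrite !gt0_muley // lte_fin expR_gt0.
(* [u] may be infinite on a null set, where [fine] returns 0. The translations by [h] and [k] move
   this set, whence [ae_translate] in the comparison of the integrals. *)
pose f x := (expR (eta x) * fine (u x))%R.
have mf : measurable_fun setT (f : BG -> R).
  apply: measurable_funM; first exact: measurableT_comp.
  exact: (measurableT_comp (f := @fine R)).
have f0 x : (0 <= f x)%R by rewrite mulr_ge0 ?expR_ge0 // fine_ge0.
have fN : \int[mu]_x (f x ^+ 2)%:E = (fine N)%:E.
  rewrite -NE /N; apply: ge0_ae_eq_integral => //.
  - by apply/measurable_EFinP; exact: measurable_funX.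
  - by move=> x _; rewrite lee_fin sqr_ge0.
  apply: filterS aefin => x ufin _.
  rewrite -[in RHS](fineK ufin) -!EFinM /f mulrDl !mul1r expRD.
  by congr (_%:E); ring.
rewrite (avg_op_sq mu' u0 meta) NE -EFinM.
apply: le_trans (Hw eta f l M _ meta etaL etaM l0 mf f0 fN).
rewrite le_eqVlt; apply/orP; left; apply/eqP.
apply: eq_integral => h _; apply: eq_integral => k _; congr (_ * _).
have mx s : measurable_fun setT (fun x : BG => u (s^-1 * x)%g).
  exact: (measurableT_comp (f := u : BG -> \bar R) mu' (measurable_mull scG s^-1%g)).
have mfx s : measurable_fun setT (fun x : BG => f (s^-1 * x)%g).
  exact: (measurable_shift scG mf).
have mex s : measurable_fun setT (fun x : BG => eta (s^-1 * x)%g).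
  exact: (measurable_shift scG meta).
apply: ge0_ae_eq_integral => //.
- by apply: emeasurable_funM => //; exact: emeasurable_funM.
- apply/measurable_EFinP; apply: measurable_funM; last exact: measurable_funM.
  apply: measurableT_comp => //; apply: measurable_funB => //.
  by apply: measurable_funB => //; exact: measurable_funM.
- by move=> x _; rewrite !mule_ge0 // lee_fin expR_ge0.
- by move=> x _; rewrite lee_fin; apply: mulr_ge0; [exact: expR_ge0|exact: mulr_ge0].
have := ae_translate h^-1%g aefin; apply: filterS2 (ae_translate k^-1%g aefin).
move=> x uk uh _.
rewrite -[in LHS](fineK uh) -[in LHS](fineK uk) -!EFinM /f /tilt; congr (_%:E).
have -> : (expR (2 * eta x) = expR (2 * eta x - eta (h^-1 * x)%g - eta (k^-1 * x)%g) *
    (expR (eta (h^-1 * x)%g) * expR (eta (k^-1 * x)%g)))%R.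
  by rewrite -!expRD; congr expR; ring.
ring.
Qed.

Lemma iter_avg_op_ge0 n u : (forall x, 0 <= u x) -> forall x, 0 <= iter n avg_op u x.
Proof. by move=> u0; elim: n => //= n ih x; exact: avg_op_ge0. Qed.

Lemma measurable_iter_avg_op n (u : G -> \bar R) : measurable_fun setT (u : BG -> \bar R) ->
  (forall x, 0 <= u x) -> measurable_fun setT (iter n avg_op u : BG -> \bar R).
Proof.
move=> mu' u0; elim: n => //= n ih; apply: measurable_avg_op => //.
exact: iter_avg_op_ge0.
Qed.

Lemma iter_avg_op_weighted : exists2 w : R, (0 < w)%R &
  forall (eta : G -> R) (l M : R) (u : G -> \bar R) n,
  measurable_fun setT (eta : BG -> R) ->
  (forall h x, `|eta (h * x)%g - eta x| <= l * rho h)%R ->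
  (forall x, `|eta x| <= M)%R -> (0 < l)%R ->
  measurable_fun setT (u : BG -> \bar R) -> (forall x, 0 <= u x) ->
  \int[mu]_x ((expR (2 * eta x))%:E * (iter n avg_op u x * iter n avg_op u x)) <=
    (expR (w * l ^+ 2 * n%:R))%:E * \int[mu]_x ((expR (2 * eta x))%:E * (u x * u x)).
Proof.
have [w w0 Hw] := avg_op_weighted; exists w => // eta l M u n meta etaL etaM l0 mu' u0.
elim: n => [|n ih]; first by rewrite mulr0 expR0 mul1e.
have := Hw eta l M (iter n avg_op u) meta etaL etaM l0
  (measurable_iter_avg_op n mu' u0) (iter_avg_op_ge0 n u0).
move/le_trans; apply; rewrite -[n.+1%:R]natr1 mulrDr mulr1 addrC expRD EFinM -muleA.
by apply: lee_wpmul2l => //; rewrite lee_fin expR_ge0.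
Qed.

End Averaging.

(** * Interpolation *)

Section Young.
Context {R : realType}.
Implicit Types (al A B t u z x y p : R).

Lemma expR_convex2 al A B : 0 <= al -> al <= 1 ->
  expR (al * A + (1 - al) * B) <= al * expR A + (1 - al) * expR B.
Proof.
move=> al0 al1; set C := al * A + _.
have h D : expR C * (1 + (D - C)) <= expR D.
  have -> : expR D = expR C * expR (D - C) by rewrite -expRD; congr expR; ring.
  by rewrite ler_pM2l ?expR_gt0 // expR_ge1Dx.
have hA := ler_wpM2l al0 (h A).
have be0 : 0 <= 1 - al by rewrite subr_ge0.
have hB := ler_wpM2l be0 (h B).
apply: le_trans (lerD hA hB); rewrite le_eqVlt; apply/orP; left; apply/eqP.
rewrite /C; ring.
Qed.

(** [u] is the product of [(e^((1 - al) t) u^P)^al] and [(e^(- al t) u^q)^(1 - al)]; convexity of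
    the exponential gives the bound. The parameter [t] stays free, to be optimised after an operator
    has been applied to both sides. *)
Lemma powR_young al t (P q : R) u : 0 <= al -> al <= 1 -> 0 <= u ->
  al * P + (1 - al) * q = 1 ->
  u <= al * expR ((1 - al) * t) * u `^ P + (1 - al) * expR (- (al * t)) * u `^ q.
Proof.
move=> al0 al1 u0 e.
have be0 : 0 <= 1 - al by rewrite subr_ge0.
have [->|un0] := eqVneq u 0.
  by apply: addr_ge0; apply: mulr_ge0; rewrite ?powR_ge0 // mulr_ge0 ?expR_ge0.
have up : 0 < u by rewrite lt_def un0.
rewrite /powR (negbTE un0) -!mulrA -!expRD.
rewrite -{1}(lnK (x := u)) ?posrE //.
apply: le_trans (expR_convex2 _ _ al0 al1); rewrite ler_expR le_eqVlt; apply/orP; left.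
apply/eqP; transitivity ((al * P + (1 - al) * q) * ln u); first by rewrite e mul1r.
ring.
Qed.

(** The optimal [t] is [ln (y / x)] and gives [z <= x^al y^(1 - al)]; the shift by [d] keeps the
    logarithms away from 0. *)
Lemma young_optimal al z x y : 0 <= al -> al <= 1 -> 0 <= x -> 0 <= y ->
  (forall t, z <= al * expR ((1 - al) * t) * x + (1 - al) * expR (- (al * t)) * y) ->
  forall d, 0 < d -> z <= expR (al * ln (x + d) + (1 - al) * ln (y + d)).
Proof.
move=> al0 al1 x0 y0 h d d0.
have be0 : 0 <= 1 - al by rewrite subr_ge0.
have xd : 0 < x + d by rewrite ltr_wpDl.
have yd : 0 < y + d by rewrite ltr_wpDl.
set A := ln _; set B := ln _.
apply: le_trans (h (B - A)) _.
apply: (@le_trans _ _ (al * expR ((1 - al) * (B - A)) * (x + d) +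
    (1 - al) * expR (- (al * (B - A))) * (y + d))).
  by apply: lerD; apply: ler_wpM2l; rewrite ?lerDl ?(ltW d0) ?mulr_ge0 ?expR_ge0.
rewrite -(lnK (x := x + d)) ?posrE // -(lnK (x := y + d)) ?posrE // -/A -/B.
rewrite -!mulrA -!expRD.
have -> : (1 - al) * (B - A) + A = al * A + (1 - al) * B by ring.
have -> : - (al * (B - A)) + B = al * A + (1 - al) * B by ring.
by rewrite -mulrDl (_ : al + (1 - al) = 1) ?mul1r //; ring.
Qed.

Lemma le_add_linear (a b c : R) : 0 <= c ->
  (forall d, 0 < d -> d <= 1 -> a <= b + c * d) -> a <= b.
Proof.
move=> c0 h; apply/ler_addgt0Pr => e e0.
have c1 : 0 < c + 1 by rewrite ltr_wpDl.
pose d := Num.min 1 (e / (c + 1)).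
have d0 : 0 < d by rewrite lt_min ltr01 divr_gt0.
have d1 : d <= 1 by rewrite ge_min lexx.
apply: le_trans (h d d0 d1) _; rewrite lerD2l.
have h1 : d <= e / (c + 1) by rewrite ge_min lexx orbT.
apply: le_trans (ler_wpM2l c0 h1) _.
by rewrite mulrCA ler_piMr ?(ltW e0) // ler_pdivrMr // mul1r lerDl.
Qed.

(** Here [1/p = al/2 + (1 - al)], so [z^p <= x^(2 (p - 1)) y^(2 - p)]. A second use of convexity,
    with weights [p - 1] and [2 - p], makes the bound linear in [x^2] and [y], so that it can be
    integrated term by term; [s] is left free to balance the terms. *)
Lemma young_opt_lt2 p s z x y : 1 < p -> p < 2 -> 0 <= z -> 0 <= x -> 0 <= y ->
  let al := 2 * (p - 1) / p in
  (forall t, z <= al * expR ((1 - al) * t) * x + (1 - al) * expR (- (al * t)) * y) ->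
  z `^ p <= (p - 1) * expR s * (x * x) + (2 - p) * expR (- (s * (p - 1) / (2 - p))) * y.
Proof.
move=> p1 p2 z0 x0 y0 al h.
have pp : 0 < p by lra.
have pn : p != 0 by rewrite gt_eqF.
have qp : 0 < 2 - p by lra.
have qn : 2 - p != 0 by rewrite gt_eqF.
have al0 : 0 <= al by rewrite divr_ge0 // ?mulr_ge0 //; lra.
have al1 : al <= 1 by rewrite /al ler_pdivrMr // mul1r; lra.
set c1 := (p - 1) * expR s; set c2 := (2 - p) * expR _.
have c10 : 0 <= c1 by rewrite mulr_ge0 ?expR_ge0 //; lra.
have c20 : 0 <= c2 by rewrite mulr_ge0 ?expR_ge0 //; lra.
apply: (@le_add_linear _ _ (c1 * (2 * x + 1) + c2)).
  by rewrite addr_ge0 // mulr_ge0 // addr_ge0 // mulr_ge0.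
move=> d d0 d1.
have xd : 0 < x + d by rewrite ltr_wpDl.
have yd : 0 < y + d by rewrite ltr_wpDl.
have := young_optimal al0 al1 x0 y0 h d0.
set A := ln _; set B := ln _; set E := _ + _ => hz.
have : z `^ p <= expR E `^ p.
  by apply: ge0_ler_powR; rewrite ?nnegrE ?expR_ge0 //; lra.
rewrite -expRM => /le_trans; apply.
have -> : E * p = (p - 1) * (A + A + s) + (1 - (p - 1)) * (B - s * (p - 1) / (2 - p)).
  by rewrite /E /al; field; rewrite pn qn.
apply: le_trans (expR_convex2 _ _ _ _) _; [lra|lra|].
rewrite expRD expRD [expR (B - _)]expRD !lnK ?posrE //.
have -> : 1 - (p - 1) = 2 - p by ring.
have -> : (p - 1) * ((x + d) * (x + d) * expR s) +
  (2 - p) * ((y + d) * expR (- (s * (p - 1) / (2 - p)))) =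
  c1 * (x * x) + c2 * y + c1 * (2 * x * d + d * d) + c2 * d by rewrite /c1 /c2; ring.
have dd : d * d <= d by rewrite ler_piMl ?(ltW d0).
have := ler_wpM2l c10 dd; lra.
Qed.

(** The second endpoint is now L^oo, whose contribution is at most 1: optimising gives [z <= x^al],
    and [al p = 2]. *)
Lemma young_opt_ge2 p z x : 2 <= p -> 0 <= z -> 0 <= x -> let al := 2 / p in
  (forall t, z <= al * expR ((1 - al) * t) * x + (1 - al) * expR (- (al * t))) ->
  z `^ p <= x * x.
Proof.
move=> p2 z0 x0 al h.
have pp : 0 < p by lra.
have pn : p != 0 by rewrite gt_eqF.
have al0 : 0 <= al by rewrite divr_ge0 //; lra.
have al1 : al <= 1 by rewrite /al ler_pdivrMr // mul1r.
have be0 : 0 <= 1 - al by rewrite subr_ge0.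
have alp : al * p = 2 by rewrite /al; field.
clearbody al.
apply: (@le_add_linear _ _ (2 * x + 1)); first by rewrite addr_ge0 // mulr_ge0.
move=> d d0 d1.
have xd : 0 < x + d by rewrite ltr_wpDl.
set A := ln (x + d).
have hz : z <= expR (al * A).
  apply: le_trans (h (- A)) _.
  apply: (@le_trans _ _ (al * expR ((1 - al) * - A) * (x + d) + (1 - al) * expR (- (al * - A)))).
    by rewrite lerD2r; apply: ler_wpM2l; [rewrite mulr_ge0 ?expR_ge0|rewrite lerDl ltW].
  rewrite -(lnK (x := x + d)) ?posrE // -/A -!mulrA -expRD.
  have -> : (1 - al) * - A + A = al * A by ring.
  have -> : - (al * - A) = al * A by ring.
  by rewrite -mulrDl (_ : al + (1 - al) = 1) ?mul1r //; ring.
have : z `^ p <= expR (al * A) `^ p.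
  by apply: ge0_ler_powR; rewrite ?nnegrE ?expR_ge0 //; lra.
rewrite -expRM => /le_trans; apply.
have -> : al * A * p = A + A by rewrite mulrAC alp; ring.
rewrite expRD lnK ?posrE //.
have dd : d * d <= d by rewrite ler_piMl ?(ltW d0).
lra.
Qed.

End Young.

(* A positive operator that contracts L^1 and L^oo and has L^2 norm at most
   [expR (A / 2)]: applying it to both sides of Young's inequality and then
   optimising pointwise replaces complex interpolation. *)
Section Interpolation.
Context {d : measure_display} {T : measurableType d} {R : realType}.
Variable mu : {measure set T -> \bar R}.
Variable S : (T -> \bar R) -> T -> \bar R.
Local Open Scope ereal_scope.
Hypothesis mS : forall u, measurable_fun setT u -> (forall x, 0 <= u x) ->
  measurable_fun setT (S u).
Hypothesis S0 : forall u, (forall x, 0 <= u x) -> forall x, 0 <= S u x.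
Hypothesis Sle : forall u v, measurable_fun setT u -> measurable_fun setT v ->
  (forall x, 0 <= u x) -> (forall x, u x <= v x) -> forall x, S u x <= S v x.
Hypothesis Slin : forall (a b : R) u v, (0 <= a)%R -> (0 <= b)%R ->
  measurable_fun setT u -> measurable_fun setT v ->
  (forall x, 0 <= u x) -> (forall x, 0 <= v x) -> forall x,
  S (fun y => a%:E * u y + b%:E * v y) x = a%:E * S u x + b%:E * S v x.
Hypothesis S1 : forall x, S (cst 1) x <= 1.
Hypothesis SL1 : forall u, measurable_fun setT u -> (forall x, 0 <= u x) ->
  \int[mu]_x S u x <= \int[mu]_x u x.
Variable A : R.
Hypothesis SL2 : forall u, measurable_fun setT u -> (forall x, 0 <= u x) ->
  \int[mu]_x (S u x * S u x) <= (expR A)%:E * \int[mu]_x (u x * u x).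

Let young (u : T -> R) (al t P q : R) x : measurable_fun setT u -> (forall x, 0 <= u x)%R ->
  (0 <= al)%R -> (al <= 1)%R -> (al * P + (1 - al) * q = 1)%R ->
  S (EFin \o u) x <= (al * expR ((1 - al) * t))%:E * S (fun y => (u y `^ P)%:E) x +
    ((1 - al) * expR (- (al * t)))%:E * S (fun y => (u y `^ q)%:E) x.
Proof.
move=> mu' u0 al0 al1 e.
have mp (r : R) : measurable_fun setT (fun y => (u y `^ r)%:E : \bar R).
  by apply/measurable_EFinP; apply: (measurableT_comp (measurable_powR r)).
have p0 (r : R) y : 0 <= (u y `^ r)%:E by rewrite lee_fin powR_ge0.
have be0 : (0 <= 1 - al)%R by rewrite subr_ge0.
have c1 : (0 <= al * expR ((1 - al) * t))%R by rewrite mulr_ge0 ?expR_ge0.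
have c2 : (0 <= (1 - al) * expR (- (al * t)))%R by rewrite mulr_ge0 ?expR_ge0.
rewrite -Slin //; apply: Sle => //.
- exact/measurable_EFinP.
- by apply: emeasurable_funD; exact: measurable_funeM.
- by move=> y; rewrite -!EFinM -EFinD lee_fin; exact: powR_young.
Qed.

Lemma interpolate_ge2 (p : R) (u : T -> R) : (2 <= p)%R -> measurable_fun setT u ->
  (forall x, 0 <= u x)%R ->
  \int[mu]_x (S (EFin \o u) x `^ p) <= (expR A)%:E * \int[mu]_x (u x `^ p)%:E.
Proof.
move=> p2 mu' u0; have pp : (0 < p)%R by lra.
have pn : (p != 0)%R by rewrite gt_eqF.
pose X y : \bar R := (u y `^ (p / 2))%:E.
have mX : measurable_fun setT X.
  by apply/measurable_EFinP; apply: (measurableT_comp (measurable_powR (p / 2))).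
have X0 y : 0 <= X y by rewrite lee_fin powR_ge0.
have mEu : measurable_fun setT (EFin \o u) by exact/measurable_EFinP.
have Eu0 y : 0 <= (EFin \o u) y by rewrite lee_fin.
have XX y : X y * X y = (u y `^ p)%:E.
  by rewrite -EFinM -powRD; [congr (_ `^ _)%:E; field|apply/implyP => /eqP; lra].
apply: (@le_trans _ _ (\int[mu]_x (S X x * S X x))); last first.
  apply: le_trans (SL2 mX X0) _; rewrite le_eqVlt; apply/orP; left; apply/eqP.
  by congr (_ * _); apply: eq_integral => x _; exact: XX.
apply: ge0_le_integralT => [x|x||].
- exact: poweR_ge0.
- have al0 : (0 <= 2 / p)%R by rewrite divr_ge0 //; lra.
  have al1 : (2 / p <= 1)%R by rewrite ler_pdivrMr // mul1r.
  (* The exponents are [p / 2] and 0: the L^2 bound governs [X], whose square is [u^p], and [S1]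
     governs [u^0], which is 1 even where [u] vanishes. *)
  have e : (2 / p * (p / 2) + (1 - 2 / p) * 0 = 1)%R by field.
  have h t := young t x mu' u0 al0 al1 e.
  have SX0 := S0 X0 x; have Su0 := S0 Eu0 x.
  have S10 : 0 <= S (fun y => (u y `^ 0)%:E) x.
    by apply: S0 => y; rewrite lee_fin powR_ge0.
  have S11 : S (fun y => (u y `^ 0)%:E) x <= 1.
    rewrite (_ : (fun y => _) = cst 1) ?S1 //.
    by apply/funext => y; rewrite powRr0.
  rewrite -/X in h; move: SX0 h; case: (S X x) => // [s|] s0 h; last first.
    by rewrite mulyy leey.
  have be0 : (0 <= 1 - 2 / p)%R by rewrite subr_ge0.
  have h' t : S (EFin \o u) x <= (2 / p * expR ((1 - 2 / p) * t) * s +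
      (1 - 2 / p) * expR (- (2 / p * t)))%:E.
    apply: le_trans (h t) _; rewrite EFinD EFinM; apply: leeD => //.
    rewrite -[leRHS]mule1; apply: lee_wpmul2l => //.
    by rewrite lee_fin mulr_ge0 ?expR_ge0.
  move: Su0 h'; case: (S (EFin \o u) x) => // [z|] z0 h'; last by have := h' 0%R.
  by rewrite -EFinM poweR_EFin lee_fin; apply: young_opt_ge2.
- apply: (measurableT_comp (measurable_poweR p)); exact: mS.
- by apply: emeasurable_funM; exact: mS.
Qed.

Lemma interpolate_lt2 (p : R) (u : T -> R) : (1 < p)%R -> (p < 2)%R -> measurable_fun setT u ->
  (forall x, 0 <= u x)%R ->
  \int[mu]_x (S (EFin \o u) x `^ p) <= (expR ((p - 1) * A))%:E * \int[mu]_x (u x `^ p)%:E.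
Proof.
move=> p1 p2 mu' u0; have pp : (0 < p)%R by lra.
have pn : (p != 0)%R by rewrite gt_eqF.
have qn : (2 - p != 0)%R by rewrite gt_eqF //; lra.
pose X y : \bar R := (u y `^ (p / 2))%:E; pose Y y : \bar R := (u y `^ p)%:E.
have mp (r : R) : measurable_fun setT (fun y => (u y `^ r)%:E : \bar R).
  by apply/measurable_EFinP; apply: (measurableT_comp (measurable_powR r)).
have mX : measurable_fun setT X := mp (p / 2)%R.
have mY : measurable_fun setT Y := mp p.
have X0 y : 0 <= X y by rewrite lee_fin powR_ge0.
have Y0 y : 0 <= Y y by rewrite lee_fin powR_ge0.
have mEu : measurable_fun setT (EFin \o u) by exact/measurable_EFinP.
have Eu0 y : 0 <= (EFin \o u) y by rewrite lee_fin.
have XX y : X y * X y = Y y.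
  by rewrite -EFinM -powRD; [congr (_ `^ _)%:E; field|apply/implyP => /eqP; lra].
(* With this choice both terms acquire the factor [e^((p - 1) A)], and the weights [p - 1] and
   [2 - p] add up to 1. *)
pose s := (- ((2 - p) * A))%R.
pose c1 := ((p - 1) * expR s)%R; pose c2 := ((2 - p) * expR (- (s * (p - 1) / (2 - p))))%R.
have c10 : (0 < c1)%R by rewrite mulr_gt0 ?expR_gt0 //; lra.
have c20 : (0 < c2)%R by rewrite mulr_gt0 ?expR_gt0 //; lra.
have SX0 := S0 X0; have SY0 := S0 Y0.
have mSX := mS mX X0; have mSY := mS mY Y0.
have mSXX : measurable_fun setT (fun x => S X x * S X x) by exact: emeasurable_funM.
have SXX0 x : 0 <= S X x * S X x by exact: mule_ge0.
apply: (@le_trans _ _ (\int[mu]_x (c1%:E * (S X x * S X x) + c2%:E * S Y x))).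
  apply: ge0_le_integralT => [x|x||].
  - exact: poweR_ge0.
  - pose al := (2 * (p - 1) / p)%R.
    have al0 : (0 <= al)%R by rewrite divr_ge0 // ?mulr_ge0 //; lra.
    have al1 : (al <= 1)%R by rewrite /al ler_pdivrMr // mul1r; lra.
    have e : (al * (p / 2) + (1 - al) * p = 1)%R by rewrite /al; field.
    have h t := young t x mu' u0 al0 al1 e.
    have Su0 := S0 Eu0 x.
    rewrite -/X -/Y in h; move: (SX0 x) (SY0 x) h.
    case: (S X x) => // [a|] a0; last first.
      move=> b0 h; rewrite mulyy gt0_muley ?lte_fin //.
      by rewrite addye ?leey // -ltNye (lt_le_trans _ (mule_ge0 _ b0)) // lee_fin ltW.
    case: (S Y x) => // [b|] b0 h; last first.
      by rewrite gt0_muley ?lte_fin // -EFinM addey ?leey.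
    move: Su0 h; case: (S (EFin \o u) x) => // [z|] z0 h; last by have := h 0%R.
    rewrite -!EFinM -EFinD poweR_EFin lee_fin.
    by apply: young_opt_lt2 => // t; have := h t; rewrite -!EFinM -EFinD lee_fin.
  - apply: (measurableT_comp (measurable_poweR p)); exact: mS.
  - by apply: emeasurable_funD; exact: measurable_funeM.
have c10e : 0 <= c1%:E by rewrite lee_fin ltW.
have c20e : 0 <= c2%:E by rewrite lee_fin ltW.
rewrite (ge0_integralD _ measurableT _ (measurable_funeM _ mSXX) _ (measurable_funeM _ mSY));
  [|by move=> x _; exact: mule_ge0|by move=> x _; exact: mule_ge0].
rewrite (ge0_integralZl _ measurableT mSXX) // (ge0_integralZl _ measurableT mSY) //.
have I0 : 0 <= \int[mu]_x Y x by exact: integral_ge0.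
apply: le_trans (leeD (lee_wpmul2l c10e (SL2 mX X0)) (lee_wpmul2l c20e (SL1 mY Y0))) _.
rewrite (_ : \int[mu]_x (X x * X x) = \int[mu]_x Y x); last first.
  by apply: eq_integral => x _; exact: XX.
rewrite muleA -ge0_muleDl //; last by rewrite mule_ge0 // lee_fin expR_ge0.
apply: lee_wpmul2r => //; rewrite -EFinM -EFinD lee_fin /c1 /c2.
have -> : (- (s * (p - 1) / (2 - p)) = (p - 1) * A)%R by rewrite /s; field.
rewrite -mulrA -expRD; have -> : (s + A = (p - 1) * A)%R by rewrite /s; ring.
by rewrite -mulrDl (_ : (p - 1 + (2 - p) = 1)%R) ?mul1r //; ring.
Qed.

End Interpolation.

(** * Off-diagonal estimates for nonnegative functions *)

Section WordDistance.
Context {R : realType} {G : topologicalGroupType}.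
Variable U : set G.
Hypothesis gU : generating_nbhs U.
Local Notation rho := (@rho R G U).

Definition dist_to (F : set G) (x : G) : R := inf [set rho (x / h)%g | h in F].

Variable F : set G.
Hypothesis F0 : F !=set0.

Let lb0 x : has_lbound [set rho (x / h)%g | h in F].
Proof. by exists 0 => _ [h _ <-]; exact: rho_ge0. Qed.

Lemma dist_to_le x h : F h -> dist_to F x <= rho (x / h)%g.
Proof. by move=> Fh; apply: ge_inf => //; exists h. Qed.

Lemma dist_to_attained x : exists2 h, F h & dist_to F x = rho (x / h)%g.
Proof.
pose P n := `[< exists2 h, F h & rho (x / h)%g <= n%:R >].
have exP : exists n, P n.
  have [h Fh] := F0; have [n [_ _ e]] := rho_attained gU (R := R) (x / h)%g.
  by exists n; apply/asboolP; exists h => //; rewrite e.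
case: (ex_minnP exP) => n /asboolP[h Fh hn] minn; exists h => //.
apply/le_anti; rewrite dist_to_le //=; apply: lb_le_inf; first by exists (rho (x / h)%g), h.
move=> _ [k Fk <-]; apply: le_trans hn _.
have [m [_ _ e]] := rho_attained gU (R := R) (x / k)%g.
by rewrite e ler_nat; apply: minn; apply/asboolP; exists k => //; rewrite e.
Qed.

Lemma dist_to_ge1 x : 1 <= dist_to F x.
Proof. by have [h _ ->] := dist_to_attained x; exact: rho_ge1. Qed.

(** The word length of the identity is 1, not 0; this is the source of a factor [e^(2 l)] in the L^2
    estimate. *)
Lemma dist_to_in x : F x -> dist_to F x = 1.
Proof.
move=> Fx; apply/le_anti; rewrite dist_to_ge1 andbT.
by apply: le_trans (dist_to_le x Fx) _; rewrite mulgV (rho_gen gU (gen1 gU)).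
Qed.

Lemma dist_to_lipschitz h x : `|dist_to F (h * x)%g - dist_to F x| <= rho h.
Proof.
have le g y : dist_to F (g * y)%g <= rho g + dist_to F y.
  have [k Fk ->] := dist_to_attained y.
  by apply: le_trans (dist_to_le _ Fk) _; rewrite -mulgA; exact: rhoM.
have h1 := le h x; have := le h^-1%g (h * x)%g; rewrite mulKg rhoV // => h2.
by rewrite ler_norml; apply/andP; split; lra.
Qed.

Lemma measurable_dist_to : measurable_fun setT (dist_to F : borel G -> R).
Proof.
apply: measurable_nat_sublevel => [x|n].
  have [h _ ->] := dist_to_attained x.
  by have [n [_ _ ->]] := rho_attained gU (R := R) (x / h)%g; exists n.
case: n => [|n].
  rewrite (_ : mkset _ = set0); first exact: open0.
  by apply/seteqP; split=> x //=; have := dist_to_ge1 x; lra.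
rewrite (_ : mkset _ = \bigcup_(h in F) ((fun x => (x / h)%g) @^-1` setpow U n.+1)).
  apply: bigcup_open => h _; apply: open_comp => [x _|]; last exact: open_setpow.
  apply: (@continuous_mul2 _ _ id (fun=> h^-1%g)) => y; first exact: cvg_id.
  exact: cvg_cst.
apply/seteqP; split=> x /=.
  have [h Fh ->] := dist_to_attained x => hn; exists h => //=.
  exact/(rho_leP gU (R := R) _ (ltn0Sn n)).
move=> [h Fh /= /(rho_leP gU (R := R) _ (ltn0Sn n)) hn].
exact: le_trans (dist_to_le x Fh) hn.
Qed.

Lemma set_dist_le_dist_to (E : set G) x : E x -> set_dist U E F <= dist_to F x.
Proof.
move=> Ex; have [h Fh ->] := dist_to_attained x.
apply: ge_inf; last by exists x => //; exists h.
by exists 0 => _ [y _ [k _ <-]]; exact: rho_ge0.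
Qed.

Lemma set_dist_ge1 (E : set G) : E !=set0 -> 1 <= set_dist U E F :> R.
Proof.
move=> [x Ex]; have [h Fh] := F0; apply: lb_le_inf.
  by exists (rho (x / h)%g), x => //; exists h.
by move=> _ [y _ [k _ <-]]; exact: rho_ge1.
Qed.

End WordDistance.

(** * Truncated iterates in L^2 and L^p *)

Section OffDiagonal.
Context {R : realType} {G : topologicalGroupType}.
Hypothesis scG : @second_countable G.
Local Notation BG := (borel G).
Variable mu : {sigma_finite_measure set BG -> \bar R}.
Hypothesis hmu : left_haar mu.
Variable K : G -> R.
Hypothesis mK : measurable_fun setT (K : BG -> R).
Hypothesis K0 : forall g, 0 <= K g.
Hypothesis K1 : (\int[mu]_x (K x)%:E = 1)%E.
Local Open Scope ereal_scope.
Local Notation P := (avg_op mu K).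

Let K0e h : 0 <= (K h)%:E. Proof. by rewrite lee_fin. Qed.

Let mKu (u : G -> \bar R) x : measurable_fun setT (u : BG -> \bar R) ->
  measurable_fun setT (fun h : BG => (K h)%:E * u (h^-1 * x)%g).
Proof.
move=> mu'; apply: emeasurable_funM; first exact/measurable_EFinP.
by apply: (measurable_translate scG (b := fun=> x : BG) mu').
Qed.

Lemma avg_op_le (u v : G -> \bar R) : measurable_fun setT (u : BG -> \bar R) ->
  measurable_fun setT (v : BG -> \bar R) -> (forall x, 0 <= u x) ->
  (forall x, u x <= v x) -> forall x, P u x <= P v x.
Proof.
move=> mu' mv u0 uv x; apply: ge0_le_integralT => [h|h||].
- exact: mule_ge0.
- exact: lee_wpmul2l.
- exact: mKu.
- exact: mKu.
Qed.

Lemma avg_op_lin (a b : R) (u v : G -> \bar R) : (0 <= a)%R -> (0 <= b)%R ->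
  measurable_fun setT (u : BG -> \bar R) -> measurable_fun setT (v : BG -> \bar R) ->
  (forall x, 0 <= u x) -> (forall x, 0 <= v x) -> forall x,
  P (fun y => a%:E * u y + b%:E * v y) x = a%:E * P u x + b%:E * P v x.
Proof.
move=> a0 b0 mu' mv u0 v0 x.
have p1 h : 0 <= (K h)%:E * u (h^-1 * x)%g by exact: mule_ge0.
have p2 h : 0 <= (K h)%:E * v (h^-1 * x)%g by exact: mule_ge0.
have ae : 0 <= a%:E by rewrite lee_fin.
have be : 0 <= b%:E by rewrite lee_fin.
rewrite /avg_op -(ge0_integralZl _ measurableT (mKu x mu')) //.
rewrite -(ge0_integralZl _ measurableT (mKu x mv)) //.
rewrite -(ge0_integralD _ measurableT _ (measurable_funeM _ (mKu x mu')) _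
  (measurable_funeM _ (mKu x mv)));
  [|by move=> h _; exact: mule_ge0|by move=> h _; exact: mule_ge0].
apply: eq_integral => h _.
by rewrite ge0_muleDr ?mule_ge0 // muleCA [_ * (b%:E * _)]muleCA.
Qed.

Lemma avg_op_cst1 x : P (cst 1) x = 1.
Proof. by rewrite /avg_op /=; under eq_integral do rewrite mule1; exact: K1. Qed.

Lemma iter_avg_op_le n (u v : G -> \bar R) : measurable_fun setT (u : BG -> \bar R) ->
  measurable_fun setT (v : BG -> \bar R) -> (forall x, 0 <= u x) ->
  (forall x, u x <= v x) -> forall x, iter n P u x <= iter n P v x.
Proof.
move=> mu' mv u0 uv; elim: n => //= n ih x.
have v0 y : 0 <= v y by exact: le_trans (uv y).
by apply: avg_op_le => //; [exact: measurable_iter_avg_op|exact: measurable_iter_avg_op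
  |exact: iter_avg_op_ge0].
Qed.

Lemma iter_avg_op_lin n (a b : R) (u v : G -> \bar R) : (0 <= a)%R -> (0 <= b)%R ->
  measurable_fun setT (u : BG -> \bar R) -> measurable_fun setT (v : BG -> \bar R) ->
  (forall x, 0 <= u x) -> (forall x, 0 <= v x) -> forall x,
  iter n P (fun y => a%:E * u y + b%:E * v y) x = a%:E * iter n P u x + b%:E * iter n P v x.
Proof.
move=> a0 b0 mu' mv u0 v0; elim: n => //= n ih x.
rewrite (_ : iter n P _ = fun y => a%:E * iter n P u y + b%:E * iter n P v y); last exact/funext.
by apply: avg_op_lin => //; [exact: measurable_iter_avg_op|exact: measurable_iter_avg_op
  |exact: iter_avg_op_ge0|exact: iter_avg_op_ge0].
Qed.

Lemma iter_avg_op_cst1 n : iter n P (cst 1) = cst 1.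
Proof. by elim: n => //= n ->; apply/funext => x; rewrite avg_op_cst1. Qed.

Lemma integral_iter_avg_op n (u : G -> \bar R) : measurable_fun setT (u : BG -> \bar R) ->
  (forall x, 0 <= u x) -> \int[mu]_x iter n P u x = \int[mu]_x u x.
Proof.
move=> mu' u0; elim: n => //= n <-; apply: integral_avg_op => //.
  exact: measurable_iter_avg_op.
exact: iter_avg_op_ge0.
Qed.

Definition cut (E : set G) (u : G -> \bar R) (x : G) : \bar R := (\1_E x)%:E * u x.

Let i0 (E : set G) x : 0 <= (\1_E x : R)%:E. Proof. by rewrite lee_fin indicE. Qed.

Let i1 (E : set G) x : (\1_E x : R)%:E <= 1.
Proof. by rewrite lee_fin indicE lern1; case: (_ \in _). Qed.

Lemma cut_ge0 E u : (forall x, 0 <= u x) -> forall x, 0 <= cut E u x.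
Proof. by move=> u0 x; exact: mule_ge0. Qed.

Lemma cut_le E u : (forall x, 0 <= u x) -> forall x, cut E u x <= u x.
Proof. by move=> u0 x; rewrite -[leRHS]mul1e; apply: lee_wpmul2r. Qed.

Lemma measurable_cut (E : set G) (u : G -> \bar R) : measurable (E : set BG) ->
  measurable_fun setT (u : BG -> \bar R) -> measurable_fun setT (cut E u : BG -> \bar R).
Proof.
move=> mE mu'; apply: emeasurable_funM => //.
by apply/measurable_EFinP; exact: measurable_indic.
Qed.

Definition off_diag n (E F : set G) (u : G -> \bar R) := cut E (iter n P (cut F u)).

Variable U : set G.
Hypothesis cG : connected [set: G].
Hypothesis gU : generating_nbhs U.
Local Notation rho := (@rho R G U).
Variables (W : set G) (k0 Mk a : R).
Hypothesis oW : open W.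
Hypothesis W1 : W 1%g.
Hypothesis WU : W `<=` U.
Hypothesis k00 : (0 < k0)%R.
Hypothesis WK : forall x, W x -> (k0 <= K x)%R.
Hypothesis Mk0 : (0 <= Mk)%R.
Hypothesis a0 : (0 <= a)%R.
Hypothesis Kmom : forall t, (0 <= t)%R ->
  \int[mu]_x (K x * expR (t * rho x))%:E <= (Mk * expR (a * t ^+ 2))%:E.
Hypothesis Kchar : forall v, real_char v ->
  has_integral mu (fun x : BG => K x * v x)%R 0%R.

(* Davies' method with the weight [exp (l * min (d(., F), d(E, F)))], optimised
   over [l]. *)
Lemma off_diag_L2 : exists2 b : R, (0 < b)%R & forall n (E F : set G) (u : G -> \bar R),
  (0 < n)%N -> measurable (E : set BG) -> measurable (F : set BG) ->
  E !=set0 -> F !=set0 ->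
  measurable_fun setT (u : BG -> \bar R) -> (forall x, 0 <= u x) ->
  \int[mu]_x (off_diag n E F u x * off_diag n E F u x) <=
  (expR (1 - b * set_dist U E F ^+ 2 / n%:R))%:E * \int[mu]_x (u x * u x).
Proof.
have [w w0 Hw] := iter_avg_op_weighted scG hmu mK K0 K1 cG gU oW W1 WU k00 WK Mk0 a0 Kmom Kchar.
have w1 : (0 < w + 1)%R by rewrite addr_gt0.
exists (w + 1)^-1%R; first by rewrite invr_gt0.
move=> n E F u n0 mE mF E0 F0 mu' u0.
set D := set_dist U E F.
have D1 : (1 <= D)%R by exact: set_dist_ge1.
have nR : (1 <= n%:R :> R)%R by rewrite ler1n.
(* The weight contributes [e^(-2 l D)] on [E] and [e^(2 l)] on [F], the operator [e^(w l^2 n)]. As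
   [2 l <= 1 + l^2 <= 1 + l^2 n], the exponent is at most [1 - 2 l D + (w + 1) l^2 n], which is
   minimal at this [l], with value [1 - D^2 / ((w + 1) n)]. *)
pose l := (D / ((w + 1) * n%:R))%R.
have l0 : (0 < l)%R by rewrite divr_gt0 ?mulr_gt0 //; lra.
pose psi x := Num.min (dist_to (R := R) U F x) D.
have md := measurable_dist_to (R := R) gU F0.
have mpsi : measurable_fun setT (psi : BG -> R) by exact: measurable_minr.
have psiL h x : (`|psi (h * x)%g - psi x| <= rho h)%R.
  have := dist_to_lipschitz (R := R) gU F0 h x; rewrite /psi.
  case: (leP (dist_to U F (h * x)%g) D); case: (leP (dist_to U F x) D) => ? ?;
    rewrite !ler_norml => /andP[? ?]; apply/andP; split;
    have := rho_ge0 gU (R := R) h; lra.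
have psi0 x : (0 <= psi x)%R.
  by rewrite le_min (le_trans ler01 (dist_to_ge1 gU F0 x)) (le_trans ler01 D1).
have psiD x : (psi x <= D)%R by rewrite ge_min lexx orbT.
pose eta x := (l * psi x)%R.
have meta : measurable_fun setT (eta : BG -> R) by exact: measurable_funM.
have etaL h x : (`|eta (h * x)%g - eta x| <= l * rho h)%R.
  by rewrite -mulrBr normrM (gtr0_norm l0) ler_pM2l.
have etaM x : (`|eta x| <= l * D)%R.
  by rewrite /eta normrM (gtr0_norm l0) (ger0_norm (psi0 x)) ler_pM2l.
have mFu := measurable_cut mF mu'.
have Fu0 := cut_ge0 F u0.
set v := iter n P (cut F u).
have v0 x : 0 <= v x by exact: iter_avg_op_ge0.
have mv : measurable_fun setT (v : BG -> \bar R) by exact: measurable_iter_avg_op.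
have me : measurable_fun setT (fun x : BG => (expR (2 * eta x))%:E : \bar R).
  by apply/measurable_EFinP; apply: measurableT_comp => //; exact: measurable_funM.
have e0 x : 0 <= (expR (2 * eta x))%:E by rewrite lee_fin expR_ge0.
have mevv : measurable_fun setT (fun x : BG => (expR (2 * eta x))%:E * (v x * v x)).
  by apply: emeasurable_funM => //; exact: emeasurable_funM.
have evv0 x : 0 <= (expR (2 * eta x))%:E * (v x * v x) by rewrite !mule_ge0.
have muu : measurable_fun setT (fun x : BG => u x * u x) by exact: emeasurable_funM.
have uu0 x : 0 <= u x * u x by exact: mule_ge0.
have cE : 0 <= (expR (- (2 * l * D)))%:E by rewrite lee_fin expR_ge0.
have cF : 0 <= (expR (2 * l))%:E by rewrite lee_fin expR_ge0.
have sE : \int[mu]_x (off_diag n E F u x * off_diag n E F u x) <=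
    (expR (- (2 * l * D)))%:E * \int[mu]_x ((expR (2 * eta x))%:E * (v x * v x)).
  rewrite -(ge0_integralZl _ measurableT mevv) //.
  apply: ge0_le_integralT => [x|x||].
  - by apply: mule_ge0; exact: cut_ge0.
  - rewrite /off_diag /cut -/v; have [Ex|nEx] := pselect (E x); last first.
      by rewrite indicE (memNset nEx) !mul0e mule_ge0.
    rewrite indicE (mem_set Ex) !mul1e muleA -EFinM -expRD.
    have -> : eta x = (l * D)%R.
      by rewrite /eta /psi min_r //; exact: set_dist_le_dist_to.
    by rewrite (_ : _ + _ = 0)%R ?expR0 ?mul1e //; ring.
  - by apply: emeasurable_funM; exact: measurable_cut.
  - exact: measurable_funeM.
have sF : \int[mu]_x ((expR (2 * eta x))%:E * (cut F u x * cut F u x)) <=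
    (expR (2 * l))%:E * \int[mu]_x (u x * u x).
  rewrite -(ge0_integralZl _ measurableT muu) //.
  apply: ge0_le_integralT => [x|x||].
  - by rewrite !mule_ge0.
  - rewrite /cut; have [Fx|nFx] := pselect (F x); last first.
      by rewrite indicE (memNset nFx) !mul0e mule0 mule_ge0.
    rewrite indicE (mem_set Fx) !mul1e; apply: lee_wpmul2r => //.
    rewrite lee_fin ler_expR -/(eta x) /eta /psi (dist_to_in gU F0 Fx).
    by rewrite min_l //; lra.
  - by apply: emeasurable_funM => //; exact: emeasurable_funM.
  - exact: measurable_funeM.
have sP := Hw eta l (l * D)%R (cut F u) n meta etaL etaM l0 mFu Fu0.
apply: le_trans sE _.
have c2 : 0 <= (expR (w * l ^+ 2 * n%:R))%:E by rewrite lee_fin expR_ge0.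
apply: le_trans (lee_wpmul2l cE (le_trans sP (lee_wpmul2l c2 sF))) _.
rewrite !muleA -!EFinM -!expRD; apply: lee_wpmul2r; first exact: integral_ge0.
rewrite lee_fin ler_expR.
have l2n : (l ^+ 2 * n%:R = l * D / (w + 1))%R.
  by rewrite /l; field; rewrite gt_eqF //= gt_eqF //; lra.
have lD : ((w + 1)^-1 * D ^+ 2 / n%:R = l * D)%R.
  by rewrite /l; field; rewrite ?gt_eqF //; lra.
have ww : (w * (l * D / (w + 1)) + l * D / (w + 1) = l * D)%R.
  by field; rewrite gt_eqF.
have l2 : (l ^+ 2 <= l ^+ 2 * n%:R)%R by rewrite ler_peMr ?sqr_ge0.
have := sqr_ge0 (l - 1)%R; rewrite sqrrB1 => h.
rewrite lD -(mulrA w) l2n; move: l2; rewrite l2n; lra.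
Qed.

(** Truncation preserves positivity and the contractivity on L^1 and L^oo, so the interpolation
    applies to the truncated iterate itself, with [A] read off from [off_diag_L2]. *)
Lemma off_diag_Lp (p : R) : (1 < p)%R -> exists c b : R, [/\ (0 < c)%R, (0 < b)%R &
  forall n (E F : set G) (u : G -> R),
  (0 < n)%N -> measurable (E : set BG) -> measurable (F : set BG) ->
  E !=set0 -> F !=set0 ->
  measurable_fun setT (u : BG -> R) -> (forall x, 0 <= u x)%R ->
  (\int[mu]_x (off_diag n E F (EFin \o u) x `^ p)) `^ p^-1 <=
  (c * expR (- b * set_dist U E F ^+ 2 / n%:R))%:E * (\int[mu]_x (u x `^ p)%:E) `^ p^-1].
Proof.
move=> p1; have [b b0 Hb] := off_diag_L2.
have pp : (0 < p)%R by lra.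
have pn : (p != 0)%R by rewrite gt_eqF.
(* The coefficient of [A] in [interpolate_ge2] and [interpolate_lt2]. The term 1 in [A] becomes the
   constant [e^(th / p)]. *)
pose th : R := (if (2 <= p)%R then 1 else p - 1)%R.
have th0 : (0 < th)%R by rewrite /th; case: ifPn => _ //; lra.
exists (expR (th / p)), (th * b / p)%R; split.
- exact: expR_gt0.
- by rewrite divr_gt0 // mulr_gt0.
move=> n E F u n0 mE mF E0 F0 mu' u0.
set A := (1 - b * set_dist U E F ^+ 2 / n%:R)%R.
have ip0 : (0 <= p^-1)%R by rewrite invr_ge0 ltW.
have key : \int[mu]_x (off_diag n E F (EFin \o u) x `^ p) <=
    (expR (th * A))%:E * \int[mu]_x (u x `^ p)%:E.
  have h1 (v : G -> \bar R) : measurable_fun setT (v : BG -> \bar R) -> (forall x, 0 <= v x) ->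
      measurable_fun setT (off_diag n E F v : BG -> \bar R).
    move=> mv v0; apply: measurable_cut => //; apply: measurable_iter_avg_op => //.
      exact: measurable_cut.
    exact: cut_ge0.
  have h2 (v : G -> \bar R) : (forall x, 0 <= v x) -> forall x, 0 <= off_diag n E F v x.
    by move=> v0; apply: cut_ge0; apply: iter_avg_op_ge0 => //; exact: cut_ge0.
  have h3 (v w : G -> \bar R) : measurable_fun setT (v : BG -> \bar R) ->
      measurable_fun setT (w : BG -> \bar R) -> (forall x, 0 <= v x) ->
      (forall x, v x <= w x) -> forall x, off_diag n E F v x <= off_diag n E F w x.
    move=> mv mw v0 vw x; apply: lee_wpmul2l => //; apply: iter_avg_op_le.
    - exact: measurable_cut.
    - exact: measurable_cut.
    - exact: cut_ge0.
    - by move=> y; exact: lee_wpmul2l.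
  have h4 (s t : R) (v w : G -> \bar R) : (0 <= s)%R -> (0 <= t)%R ->
      measurable_fun setT (v : BG -> \bar R) -> measurable_fun setT (w : BG -> \bar R) ->
      (forall x, 0 <= v x) -> (forall x, 0 <= w x) -> forall x,
      off_diag n E F (fun y => s%:E * v y + t%:E * w y) x =
      s%:E * off_diag n E F v x + t%:E * off_diag n E F w x.
    move=> s0 t0 mv mw v0 w0 x; rewrite /off_diag /cut.
    have se : 0 <= s%:E by rewrite lee_fin.
    have te : 0 <= t%:E by rewrite lee_fin.
    rewrite (_ : (fun y => _ * (_ + _)) = fun y => s%:E * cut F v y + t%:E * cut F w y).
      rewrite iter_avg_op_lin //; try exact: measurable_cut; try exact: cut_ge0.
      by rewrite ge0_muleDr ?mule_ge0 ?iter_avg_op_ge0 //;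
        [rewrite muleCA [_ * (t%:E * _)]muleCA|exact: cut_ge0|exact: cut_ge0].
    apply/funext => y; rewrite ge0_muleDr ?mule_ge0 //.
    by rewrite muleCA [_ * (t%:E * _)]muleCA.
  have h5 x : off_diag n E F (cst 1) x <= 1.
    have cst0 (y : G) : 0 <= (cst 1 : G -> \bar R) y by [].
    rewrite -[leRHS]mul1e; apply: (@lee_pmul _ (\1_E x)%:E 1) => //.
      by apply: iter_avg_op_ge0 => //; exact: cut_ge0.
    apply: (@le_trans _ _ (iter n P (cst 1) x)); last by rewrite iter_avg_op_cst1.
    apply: iter_avg_op_le => //; [exact: measurable_cut|exact: cut_ge0|exact: cut_le].
  have h6 (v : G -> \bar R) : measurable_fun setT (v : BG -> \bar R) -> (forall x, 0 <= v x) ->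
      \int[mu]_x off_diag n E F v x <= \int[mu]_x v x.
    move=> mv v0.
    have mFv := measurable_cut mF mv; have Fv0 := cut_ge0 F v0.
    apply: (@le_trans _ _ (\int[mu]_x iter n P (cut F v) x)).
      apply: ge0_le_integralT => [x|x||].
      - exact: h2.
      - by apply: cut_le => y; exact: iter_avg_op_ge0.
      - exact: h1.
      - exact: measurable_iter_avg_op.
    rewrite integral_iter_avg_op //.
    apply: ge0_le_integralT => //; exact: cut_le.
  have h7 (v : G -> \bar R) : measurable_fun setT (v : BG -> \bar R) -> (forall x, 0 <= v x) ->
      \int[mu]_x (off_diag n E F v x * off_diag n E F v x) <= (expR A)%:E * \int[mu]_x (v x * v x).
    by move=> mv v0; exact: Hb.
  rewrite /th; case: ifPn => p2.
    by rewrite mul1r; have hh := @interpolate_ge2 _ BG R mu (off_diag n E F) h1 h2 h3 h4 h5 A h7; apply: hh.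
  by rewrite -ltNge in p2; have hh := @interpolate_lt2 _ BG R mu (off_diag n E F) h1 h2 h3 h4 h6 A h7; apply: hh.
have i0' : 0 <= \int[mu]_x (u x `^ p)%:E.
  by apply: integral_ge0 => x _; rewrite lee_fin powR_ge0.
have h := @gt0_ler_poweR R p^-1 ip0.
apply: (@le_trans _ _ (((expR (th * A))%:E * \int[mu]_x (u x `^ p)%:E) `^ p^-1)).
  apply: h key; rewrite in_itv /= leey andbT.
    by apply: integral_ge0 => x _; exact: poweR_ge0.
  by rewrite mule_ge0 // lee_fin expR_ge0.
rewrite poweRM ?lee_fin ?expR_ge0 // poweR_EFin -expRM.
rewrite (_ : (th * A * p^-1 = th / p + - (th * b / p) * set_dist U E F ^+ 2 / n%:R)%R).
  by rewrite expRD.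
by rewrite /A; ring.
Qed.

End OffDiagonal.

(** * Complex functions *)

Section ComplexIntegral.
Context {d : measure_display} {T : measurableType d} {R : realType}.
Local Notation normc := ComplexField.Normc.normc.

Lemma normcE_sqrt (z : R[i]) : normc z = Num.sqrt (complex.Re z ^+ 2 + complex.Im z ^+ 2).
Proof. by case: z. Qed.

Lemma normc_ge0 (z : R[i]) : 0 <= normc z.
Proof. by rewrite normcE_sqrt sqrtr_ge0. Qed.

Lemma normc_sqr (z : R[i]) : normc z ^+ 2 = complex.Re z ^+ 2 + complex.Im z ^+ 2.
Proof. by rewrite normcE_sqrt sqr_sqrtr // addr_ge0 ?sqr_ge0. Qed.

Lemma ler_norm_sqr (x y : R) : 0 <= y -> x ^+ 2 <= y ^+ 2 -> `|x| <= y.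
Proof. by move=> y0 h; rewrite -[leRHS]ger0_norm // -ler_sqr ?nnegrE // !real_normK ?num_real. Qed.

Lemma normc_ge_absRe (z : R[i]) : `|complex.Re z| <= normc z.
Proof. by apply: ler_norm_sqr (normc_ge0 z) _; rewrite normc_sqr lerDl sqr_ge0. Qed.

Lemma normc_ge_absIm (z : R[i]) : `|complex.Im z| <= normc z.
Proof. by apply: ler_norm_sqr (normc_ge0 z) _; rewrite normc_sqr lerDr sqr_ge0. Qed.

Lemma normc_real (k : R) : 0 <= k -> normc (k%:C)%C = k.
Proof. by move=> k0; rewrite normcE_sqrt /= expr0n /= addr0 sqrtr_sqr ger0_norm. Qed.

Variable mu : {measure set T -> \bar R}.

Lemma measurable_normc (f : T -> R[i]) :
  measurable_fun setT (fun x => complex.Re (f x)) ->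
  measurable_fun setT (fun x => complex.Im (f x)) ->
  measurable_fun setT (fun x => normc (f x)).
Proof.
move=> mR mI; under eq_fun do rewrite normcE_sqrt.
apply: (measurableT_comp (continuous_measurable_fun (@sqrt_continuous R))).
by apply: measurable_funD; exact: measurable_funX.
Qed.

(** With [z] the integral, [|z|^2] is the integral of [Re z Re f + Im z Im f], which is at most
    [|z| |f|] pointwise by Cauchy-Schwarz. If [|f|] has infinite integral the bound is trivial,
    whatever value [cintegral] takes. *)
Lemma normc_cintegral (f : T -> R[i]) :
  measurable_fun setT (fun x => complex.Re (f x)) ->
  measurable_fun setT (fun x => complex.Im (f x)) ->
  ((normc (cintegral mu f))%:E <= \int[mu]_x (normc (f x))%:E)%E.
Proof.
move=> mR mI; have mN := measurable_normc mR mI.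
have i0 : (0 <= \int[mu]_x (normc (f x))%:E)%E.
  by apply: integral_ge0 => x _; rewrite lee_fin normc_ge0.
have [fin|] := ltP (\int[mu]_x (normc (f x))%:E)%E +oo%E; last first.
  by rewrite leye_eq => /eqP ->; rewrite leey.
have Nfin : (\int[mu]_x (normc (f x))%:E)%E \is a fin_num by rewrite ge0_fin_numE.
set N := fine (\int[mu]_x (normc (f x))%:E)%E.
have eN : (\int[mu]_x (normc (f x))%:E = N%:E)%E by rewrite fineK.
have hN : has_integral mu (fun x => normc (f x)) N.
  by apply: has_integral_ge0 => // x; exact: normc_ge0.
have hI (g : T -> R) : measurable_fun setT g -> (forall x, `|g x| <= normc (f x)) ->
    has_integral mu g (Rintegral mu setT g).
  move=> mg gf.
  have ig : mu.-integrable setT (EFin \o g).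
    apply: (le_integrable measurableT _ _ hN.1); first exact/measurable_EFinP.
    by move=> x _ /=; rewrite lee_fin (ger0_norm (normc_ge0 _)).
  by split=> //; rewrite /Rintegral fineK // integrable_fin_num.
have h1 := hI _ mR (fun x => normc_ge_absRe (f x)).
have h2 := hI _ mI (fun x => normc_ge_absIm (f x)).
rewrite eN lee_fin; set z := cintegral mu f.
have N0 : 0 <= N by rewrite -lee_fin -eN.
have [z0|zn] := eqVneq (normc z) 0; first by rewrite z0.
have zp : 0 < normc z by rewrite lt_def zn normc_ge0.
rewrite -(ler_pM2l zp) -expr2 normc_sqr !expr2.
apply: (has_integral_le (has_integralD (has_integralZ (complex.Re z) h1)
  (has_integralZ (complex.Im z) h2)) (has_integralZ (normc z) hN)) => x.
apply: le_trans (ler_norm _) _; apply: ler_norm_sqr.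
  by rewrite mulr_ge0 ?normc_ge0.
rewrite exprMn !normc_sqr; have := sqr_ge0 (complex.Re z * complex.Im (f x) - complex.Im z * complex.Re (f x)).
by nra.
Qed.

End ComplexIntegral.

Lemma measurable_fun_integral {d1 d2} {T1 : measurableType d1} {T2 : measurableType d2}
    {R : realType} (m : {sigma_finite_measure set T2 -> \bar R}) (g : T1 * T2 -> \bar R) :
  measurable_fun setT g -> measurable_fun setT (fun x => \int[m]_y g (x, y))%E.
Proof.
move=> mg; rewrite (_ : (fun x => _) = fun x =>
    (\int[m]_y (funepos g (x, y)) - \int[m]_y (funeneg g (x, y)))%E); last first.
  apply/funext => x; rewrite integralE; congr (_ - _)%E; apply: eq_integral => y _.
    by rewrite !funeposE.
  by rewrite !funenegE.
apply: emeasurable_funB.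
- apply: (@measurable_fun_fubini_tonelli_F _ _ T1 T2 R m (g^\+)%E).
    exact: measurable_funepos.
  by move=> z; exact: funepos_ge0.
- apply: (@measurable_fun_fubini_tonelli_F _ _ T1 T2 R m (g^\-)%E).
    exact: measurable_funeneg.
  by move=> z; exact: funeneg_ge0.
Qed.

Section ComplexConvolution.
Context {R : realType} {G : topologicalGroupType}.
Hypothesis scG : @second_countable G.
Local Notation BG := (borel G).
Local Notation normc := ComplexField.Normc.normc.
Variable mu : {sigma_finite_measure set BG -> \bar R}.
Variable K : G -> R.
Hypothesis mK : measurable_fun setT (K : BG -> R).
Hypothesis K0 : forall g, 0 <= K g.
Local Notation P := (avg_op mu K).
Local Notation T := (convolution mu (fun g => ((K g)%:C)%C)).

Definition cmeasurable (f : G -> R[i]) : Prop :=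
  measurable_fun setT (fun x : BG => complex.Re (f x)) /\
  measurable_fun setT (fun x : BG => complex.Im (f x)).

Let ReK (f : G -> R[i]) x h :
  complex.Re ((K h)%:C%C * f (h^-1 * x)%g) = K h * complex.Re (f (h^-1 * x)%g).
Proof. by case: (f _) => a b /=; rewrite mul0r subr0. Qed.

Let ImK (f : G -> R[i]) x h :
  complex.Im ((K h)%:C%C * f (h^-1 * x)%g) = K h * complex.Im (f (h^-1 * x)%g).
Proof. by case: (f _) => a b /=; rewrite mul0r addr0. Qed.

Let mKz (u : G -> R) : measurable_fun setT (u : BG -> R) ->
  measurable_fun setT (fun z : BG * BG => (K z.2 * u (z.2^-1 * z.1)%g)%:E : \bar R).
Proof.
move=> mu'; apply/measurable_EFinP; apply: measurable_funM.
  exact: (measurableT_comp (f := K : BG -> R)).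
apply: (measurableT_comp (f := u : BG -> R) (g := fun z : BG * BG => (z.2^-1 * z.1)%g : BG)) => //.
by apply: measurable_mulg2 => //; exact: measurable_invg1.
Qed.

Let mKx (u : G -> R) x : measurable_fun setT (u : BG -> R) ->
  measurable_fun setT (fun h : BG => K h * u (h^-1 * x)%g).
Proof.
move=> mu'; apply: measurable_funM => //.
apply: (measurableT_comp (f := u : BG -> R) (g := fun h : BG => (h^-1 * x)%g : BG)) => //.
by apply: measurable_mulg2 => //; exact: measurable_invg1.
Qed.

Lemma cmeasurable_convolution f : cmeasurable f -> cmeasurable (T f).
Proof.
move=> [mR mI]; split.
- rewrite /convolution /cintegral /=.
  apply: (measurableT_comp (fine_measurable measurableT)); under eq_fun do under eq_integral do rewrite ReK.
  exact: (measurable_fun_integral mu (mKz mR)).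
- rewrite /convolution /cintegral /=.
  apply: (measurableT_comp (fine_measurable measurableT)); under eq_fun do under eq_integral do rewrite ImK.
  exact: (measurable_fun_integral mu (mKz mI)).
Qed.

Lemma normc_convolution f x : cmeasurable f ->
  ((normc (T f x))%:E <= P (fun y => (normc (f y))%:E) x)%E.
Proof.
move=> [mR mI]; apply: le_trans (normc_cintegral _ _ _) _.
- by under eq_fun do rewrite ReK; exact: (mKx x mR).
- by under eq_fun do rewrite ImK; exact: (mKx x mI).
- rewrite /avg_op le_eqVlt; apply/orP; left; apply/eqP; apply: eq_integral => h _.
  by rewrite ComplexField.Normc.normcM normc_real // EFinM.
Qed.

Lemma cmeasurable_chi (E : set BG) f : measurable E -> cmeasurable f -> cmeasurable (chi E f).
Proof.
move=> mE [mR mI]; have mi : measurable_fun setT (\1_E : BG -> R) by exact: measurable_indic.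
have chiE x : chi E f x = ((\1_E x : R)%:C)%C * f x.
  by rewrite /chi !indicE; case: (x \in E).
split.
- rewrite (_ : (fun x => _) = fun x : BG => \1_E x * complex.Re (f x)).
    exact: measurable_funM.
  by apply/funext => x; rewrite chiE; case: (f x) => a b /=; rewrite mul0r subr0.
- rewrite (_ : (fun x => _) = fun x : BG => \1_E x * complex.Im (f x)).
    exact: measurable_funM.
  by apply/funext => x; rewrite chiE; case: (f x) => a b /=; rewrite mul0r addr0.
Qed.

Lemma normc_chi (E : set BG) (f : BG -> R[i]) x : (normc (chi E f x))%:E = cut E (fun y => (normc (f y))%:E) x.
Proof.
rewrite /chi /cut !indicE; case: (x \in E).
  by rewrite !mul1r mul1e.
by rewrite !mul0r mul0e ComplexField.Normc.normc0.
Qed.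

Lemma normc_iter_convolution n f : cmeasurable f -> cmeasurable (iter n T f) /\
  forall x, ((normc (iter n T f x))%:E <= iter n P (fun y => (normc (f y))%:E) x)%E.
Proof.
move=> mf; elim: n => [//|n [mT le]] /=; split; first exact: cmeasurable_convolution.
move=> x; apply: le_trans (normc_convolution x mT) _.
have mN (g : G -> R[i]) : cmeasurable g ->
    measurable_fun setT (fun y : BG => (normc (g y))%:E : \bar R).
  by move=> [mR mI]; apply/measurable_EFinP; exact: measurable_normc.
apply: avg_op_le => //; first exact: mN.
  apply: measurable_iter_avg_op => //; first exact: mN.
  by move=> y; rewrite lee_fin normc_ge0.
by move=> y; rewrite lee_fin normc_ge0.
Qed.

(** As [K] is nonnegative, the complex operator is dominated by the one on nonnegative functions
    applied to [|f|], so both have the same L^p bound. *)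
Lemma normc_off_diag n (E F : set BG) f x : measurable F -> cmeasurable f ->
  ((normc (chi E (iter n T (chi F f)) x))%:E <=
   off_diag mu K n E F (EFin \o (fun y => normc (f y))) x)%E.
Proof.
move=> mF mf; rewrite normc_chi /off_diag.
have [_ h] := normc_iter_convolution n (cmeasurable_chi mF mf).
apply: lee_wpmul2l; first by rewrite lee_fin indicE.
apply: le_trans (h x) _.
by rewrite (_ : (fun y => _) = cut F (EFin \o fun y => normc (f y))) //;
  apply/funext => y; exact: normc_chi.
Qed.

End ComplexConvolution.

(** * From nonnegative functions to the operator norm *)

Section SigmaFinite.
Context {d : measure_display} {T : measurableType d} {R : realType}.
Variables (mu : {measure set T -> \bar R}) (sf : sigma_finite setT mu).

(** The theorem takes a bare measure, whereas Tonelli asks for a sigma-finite instance; the copy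
    attaches such a proof to the same set function. *)
Definition sigma_finite_copy of sigma_finite setT mu : set T -> \bar R := mu.

HB.instance Definition _ := Measure.copy (sigma_finite_copy sf) mu.
HB.instance Definition _ := Measure_isSigmaFinite.Build _ _ _ (sigma_finite_copy sf) sf.

End SigmaFinite.

Section OperatorNorm.
Context {d : measure_display} {T : measurableType d} {R : realType}.
Variable mu : {measure set T -> \bar R}.
Local Notation normc := ComplexField.Normc.normc.
Local Open Scope ereal_scope.

Lemma cLnormE (p : R) (f : T -> R[i]) :
  cLnorm mu p f = (\int[mu]_x (normc (f x) `^ p)%:E) `^ p^-1.
Proof.
rewrite /cLnorm Lnorm.unlock.
by under eq_integral do rewrite gee0_abs ?lee_fin ?normc_ge0 // poweR_EFin.
Qed.

Lemma opnorm_le (p q C : R) (A : (T -> R[i]) -> T -> R[i]) : (0 <= C)%R ->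
  (forall f, cLp mu p f ->
    [/\ measurable_fun setT (fun x => complex.Re (A f x)),
        measurable_fun setT (fun x => complex.Im (A f x)) &
        cLnorm mu q (A f) <= C%:E * cLnorm mu p f]) ->
  opnorm mu p q A <= C%:E.
Proof.
move=> C0 h; apply: ereal_inf_lbound; exists C => //; split=> // f mf.
have [mR mI le] := h f mf; split=> //; split=> //.
apply: le_lt_trans le _; case: mf => _ _ fin.
have f0 : 0 <= cLnorm mu p f by rewrite cLnormE poweR_ge0.
by rewrite lte_mul_pinfty // lee_fin.
Qed.

End OperatorNorm.

Local Open Scope complex_scope.

Theorem theorem1p6 (R : realType) (G : lieGroupType R)
    (mu : {measure set (borel G) -> \bar R}) (U : set G)
    (q r : nat) (phi : abelianization_iso R G q r) (K : G -> R) :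
  connected [set: G] ->
  left_haar mu ->
  generating_nbhs U ->
  sub_gaussian mu U K ->
  centered mu phi K ->
  let T : (G -> R[i]) -> (G -> R[i]) := convolution mu (fun g => (K g)%:C) in
  forall p : R, 1 < p ->
  exists c b : R, [/\ 0 < c, 0 < b &
    forall (n : nat) (E F : set (borel G)),
      (0 < n)%N -> measurable E -> measurable F -> E !=set0 -> F !=set0 ->
      (opnorm mu p p (fun f => chi E (iter n T (chi F f))) <=
        (c * expR (- b * set_dist U E F ^+ 2 / n%:R))%:E)%E].
Proof.
move=> cG hmu gU [[mK K0 K1] [W0 nW kW] [c1 [b1 [c10 b10 Kg]]]] cent T p p1.
have scG : @second_countable G := lie_second_countable.
pose mu' : {sigma_finite_measure set (borel G) -> \bar R} :=
  sigma_finite_copy (haar_sigma_finite scG hmu gU).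
have [Uo _ U1 _ _] := gU.
have [Mk Mk0 Kmom] := exponential_moment scG hmu gU mK K0 c10 b10 Kg.
(* The given neighbourhood is made open and cut down to [U], where [rho] is 1. *)
have WK x : (W0^° `&` U) x -> inf [set K g | g in W0] <= K x.
  move=> [/interior_subset Wx _]; apply: ge_inf; last by exists x.
  by exists 0 => _ [g _ <-].
have oW : open (W0^° `&` U) by apply: openI => //; exact: open_interior.
have b0 : 0 <= (2 * b1)^-1 by rewrite invr_ge0; lra.
have Kmom' t : 0 <= t ->
    (\int[mu']_x (K x * expR (t * rho U x))%:E <= (Mk * expR ((2 * b1)^-1 * t ^+ 2))%:E)%E.
  by move=> t0; rewrite mulrC [_^-1 * _]mulrC mulrC; exact: Kmom.
have Kchar v : real_char v -> has_integral mu' (fun x : borel G => K x * v x) 0.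
  move=> cv; split; first exact: (real_char_integrable scG hmu gU mK K0 c10 b10 Kg cv).
  exact: (real_char_centered scG hmu gU mK K0 c10 b10 Kg cent cv).
have [c [b [cp bp H]]] := @off_diag_Lp R G scG mu' hmu K mK K0 K1 U cG gU _ _ _ _
  oW (conj nW U1) (@subIsetr _ _ _) kW WK Mk0 b0 Kmom' Kchar p p1.
exists c, b; split=> // n E F n0 mE mF E0 F0.
apply: opnorm_le => [|f [mR mI _]]; first by rewrite mulr_ge0 ?expR_ge0 // ltW.
have mf : cmeasurable f by [].
have [mT _] := normc_iter_convolution scG mu' mK K0 n (cmeasurable_chi mF mf).
have [mR' mI'] := cmeasurable_chi mE mT.
split=> //; rewrite !cLnormE.
apply: le_trans (H n E F (fun x => ComplexField.Normc.normc (f x)) n0 mE mF E0 F0 _ _); last 2 first.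
- exact: measurable_normc.
- by move=> x; exact: normc_ge0.
have ip0 : 0 <= p^-1 by rewrite invr_ge0; lra.
have mN := measurable_normc mR' mI'.
have mu0 : measurable_fun setT (fun x : borel G => (ComplexField.Normc.normc (f x))%:E : \bar R).
  by apply/measurable_EFinP; exact: measurable_normc.
apply: (gt0_ler_poweR ip0).
- by rewrite in_itv /= leey andbT; apply: integral_ge0 => x _; rewrite lee_fin powR_ge0.
- by rewrite in_itv /= leey andbT; apply: integral_ge0 => x _; exact: poweR_ge0.
apply: ge0_le_integralT => [x|x||].
- by rewrite lee_fin powR_ge0.
- have le := normc_off_diag scG mu' mK K0 n E x mF mf.
  rewrite -poweR_EFin; apply: (gt0_ler_poweR _ _ _ le); first by lra.
    by rewrite in_itv /= leey andbT lee_fin normc_ge0.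
  rewrite in_itv /= leey andbT; apply: le_trans le; by rewrite lee_fin normc_ge0.
- by apply/measurable_EFinP; apply: (measurableT_comp (measurable_powR p)).
- apply: (measurableT_comp (measurable_poweR p)).
  apply: measurable_cut => //; apply: measurable_iter_avg_op => //.
    exact: measurable_cut.
  by apply: cut_ge0 => y; rewrite lee_fin normc_ge0.
Qed.
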